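(* Let $\mathfrak{g}=\mathfrak{so}_{2n}$ and let $V=V(\Lambda_{n-1})\oplus V(\Lambda_n)$ be the sum of its two half-spin representations. Let $p=0,1$. Define $$M^D_q(\lambda+p\Lambda_n):=\det\left[\genfrac{[}{]}{0pt}{}{2(k+i)+p}{k+i-j-|\lambda_{n-j}|}_q\right]_{i,j=0}^{n-1}.$$ Then the multiplicity of $V(\lambda+p\Lambda_{n-1})$ and of $V(\lambda+p\Lambda_n)$ in $V^{\otimes 2k+p}$ is $M^D_1(\lambda+p\Lambda_n)$. Furthermore, we have $$M^D_q(\lambda+p\Lambda_n)=q^{\|\overline\lambda\|}\,\frac{\prod_{i=1}^n[2k+2n-2i+p]_q!\;\prod_{1\le i<j\le n}[a_i-a_j]_q[a_i+a_j]_q}{\prod_{i=1}^n\left[k+n-1-a_i+\frac p2\right]_q!\left[k+n-1+a_i+\frac p2\right]_q!}\in\mathbb{Z}_{\ge0}[q],$$ where $a_i=\lambda_i+n-i+\frac p2$.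
   Context: $k$ is a positive integer and $\lambda=(\lambda_1\ge\cdots\ge\lambda_{n-1}\ge|\lambda_n|)$ is a sequence of integers with $\lambda_1\le k$, identified with the dominant weight $\sum_i\lambda_i\epsilon_i$ of type $D_n$. In type $D_n$, $\Lambda_n=\frac12(\epsilon_1+\cdots+\epsilon_n)$ and $\Lambda_{n-1}=\frac12(\epsilon_1+\cdots+\epsilon_{n-1}-\epsilon_n)$. $V(\mu)$ is the irreducible representation with highest weight $\mu$. $[m]_q=1+q+\cdots+q^{m-1}$, $[m]_q!=\prod_{j=1}^m[j]_q$, $\genfrac{[}{]}{0pt}{}{a}{b}_q=\frac{[a]_q!}{[b]_q![a-b]_q!}$ (zero if $b<0$ or $b>a$). $\overline\lambda$ is the complement of $\lambda$ in the $n\times k$ rectangle, $\overline\lambda_i=k-\lambda_{n+1-i}$, and $\|\nu\|=\sum_i(i-1)\nu_i$.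
   Formalization: For p=1 the formula for V(λ+Λ_n) and the product formula are stated only for λ_n≥0, and that for V(λ+Λ_{n-1}) only for λ_n≤0; otherwise false: n=2, k=1, λ=(1,1) gives M_1=1, but V(λ+Λ_1) occurs 3 times. Also n≥2. *)

(* Defs.v *)
From HB Require Import structures.
From mathcomp Require Import all_boot all_order all_algebra.
From mathcomp Require Import ring.
From mathcomp.real_closed Require Import mxtens.

Set Implicit Arguments.
Unset Strict Implicit.
Unset Printing Implicit Defensive.

Import Order.TTheory GRing.Theory Num.Theory.

Local Open Scope ring_scope.

Notation "x %:F" := (@FracField.tofrac _ x) : ring_scope.

Definition lie (R : pzRingType) (d : nat) (A B : 'M[R]_d) : 'M[R]_d :=
  A *m B - B *m A.

Section LieAlgebra.
Variables (C : numClosedFieldType) (n : nat).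

(** so_{2n} in its split form: the matrices that are skew for the symmetric
    bilinear form pairing e_i with e_(n+i).  Its elements are the block
    matrices [[A, B], [D, - A^T]] with B and D skew-symmetric. *)
Definition so_form : 'M[C]_(n + n) := block_mx 0 1%:M 1%:M 0.

Definition so : {pred 'M[C]_(n + n)} :=
  [pred A | A^T *m so_form + so_form *m A == 0].

(** The Cartan subalgebra; the weight eps_i maps [cartan h] to [h 0 i]. *)
Definition cartan (h : 'rV[C]_n) : 'M[C]_(n + n) :=
  block_mx (diag_mx h) 0 0 (- diag_mx h).

(** Root vectors for eps_i - eps_j and eps_i + eps_j. *)
Definition root_sub (i j : 'I_n) : 'M[C]_(n + n) :=
  block_mx (delta_mx i j) 0 0 (- delta_mx j i).

Definition root_add (i j : 'I_n) : 'M[C]_(n + n) :=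
  block_mx 0 (delta_mx i j - delta_mx j i) 0 0.

(** Finite-dimensional representations, acting on column vectors.
    Only the values of [rep_act] on [so] are meaningful. *)
Record so_rep := SoRep {
  rep_dim : nat;
  rep_act : 'M[C]_(n + n) -> 'M[C]_rep_dim;
  rep_linear : forall a : C, {in so &, forall x y,
    rep_act (a *: x + y) = a *: rep_act x + rep_act y};
  rep_lie : {in so &, forall x y,
    rep_act (lie x y) = lie (rep_act x) (rep_act y)}
}.

Fact rep0_linear (a : C) : {in so &, forall x y : 'M[C]_(n + n),
  0 = a *: 0 + 0 :> 'M[C]_0}.
Proof. by move=> x y _ _; rewrite scaler0 addr0. Qed.

Fact rep0_lie d : {in so &, forall x y : 'M[C]_(n + n),
  0 = lie 0 0 :> 'M[C]_d}.
Proof. by move=> x y _ _; rewrite /lie mul0mx subr0. Qed.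

Definition rep0 : so_rep := SoRep rep0_linear (@rep0_lie 0).

Fact rep_triv_linear (a : C) : {in so &, forall x y : 'M[C]_(n + n),
  0 = a *: 0 + 0 :> 'M[C]_1}.
Proof. by move=> x y _ _; rewrite scaler0 addr0. Qed.

Definition rep_triv : so_rep := SoRep rep_triv_linear (@rep0_lie 1).

Section Operations.
Variables V W : so_rep.

Definition rep_sum_act (x : 'M[C]_(n + n)) :=
  block_mx (rep_act V x) 0 0 (rep_act W x).

Fact rep_sum_linear (a : C) : {in so &, forall x y,
  rep_sum_act (a *: x + y) = a *: rep_sum_act x + rep_sum_act y}.
Proof.
move=> x y sx sy; rewrite /rep_sum_act !rep_linear //.
by rewrite scale_block_mx add_block_mx !scaler0 !addr0.
Qed.

Fact rep_sum_lie : {in so &, forall x y,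
  rep_sum_act (lie x y) = lie (rep_sum_act x) (rep_sum_act y)}.
Proof.
move=> x y sx sy; rewrite /rep_sum_act !rep_lie // /lie !mulmx_block.
rewrite opp_block_mx add_block_mx.
by rewrite !(mulmx0, mul0mx, addr0, add0r, oppr0).
Qed.

Definition rep_sum : so_rep := SoRep rep_sum_linear rep_sum_lie.

Definition rep_tens_act (x : 'M[C]_(n + n)) :=
  rep_act V x *t 1%:M + 1%:M *t rep_act W x.

Fact rep_tens_linear (a : C) : {in so &, forall x y,
  rep_tens_act (a *: x + y) = a *: rep_tens_act x + rep_tens_act y}.
Proof.
move=> x y sx sy; rewrite /rep_tens_act !rep_linear //.
apply/matrixP => i j.
case: (mxtens_indexP i) => i1 i2; case: (mxtens_indexP j) => j1 j2.
rewrite !mxE !mxtens_indexK /=.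
rewrite !mulrDl !mulrDr !mulrA [_%:R * a]mulrC addrACA.
by rewrite -!mulrA.
Qed.

Fact rep_tens_lie : {in so &, forall x y,
  rep_tens_act (lie x y) = lie (rep_tens_act x) (rep_tens_act y)}.
Proof.
have tBl m m' (A B : 'M[C]_m) (D : 'M[C]_m') : (A - B) *t D = A *t D - B *t D.
  apply/matrixP => i j.
  case: (mxtens_indexP i) => i1 i2; case: (mxtens_indexP j) => j1 j2.
  by rewrite !mxE !mxtens_indexK mulrBl.
have tBr m m' (A B : 'M[C]_m) (D : 'M[C]_m') : D *t (A - B) = D *t A - D *t B.
  apply/matrixP => i j.
  case: (mxtens_indexP i) => i1 i2; case: (mxtens_indexP j) => j1 j2.
  by rewrite !mxE !mxtens_indexK mulrBr.
move=> x y sx sy; rewrite /rep_tens_act !rep_lie // /lie tBl tBr.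
rewrite !mulmxDl !mulmxDr !tensmx_mul !mulmx1 !mul1mx.
by apply/matrixP => i j; rewrite ![in LHS]mxE ![in RHS]mxE; ring.
Qed.

Definition rep_tens : so_rep := SoRep rep_tens_linear rep_tens_lie.

Definition rep_iso : Prop :=
  exists (A : 'M[C]_(rep_dim W, rep_dim V)) (B : 'M[C]_(rep_dim V, rep_dim W)),
    [/\ A *m B = 1%:M, B *m A = 1%:M &
        {in so, forall x, A *m rep_act V x = rep_act W x *m A}].

End Operations.

Definition rep_pow (V : so_rep) (m : nat) : so_rep :=
  iter m (rep_tens V) rep_triv.

Definition irreducible_rep (V : so_rep) : Prop :=
  (0 < rep_dim V)%N /\
  forall U : {vspace 'cV[C]_(rep_dim V)},
    {in so, forall x, {in U, forall v, rep_act V x *m v \in U}} ->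
    U = 0%VS \/ U = fullv.

Definition weight_vector (V : so_rep) (mu : 'I_n -> rat)
    (v : 'cV[C]_(rep_dim V)) : Prop :=
  forall h : 'rV[C]_n,
    rep_act V (cartan h) *m v = (\sum_i ratr (mu i) * h 0 i) *: v.

(** The positive roots are eps_i - eps_j and eps_i + eps_j for i < j. *)
Definition highest_weight_vector (V : so_rep) (mu : 'I_n -> rat)
    (v : 'cV[C]_(rep_dim V)) : Prop :=
  [/\ v != 0, weight_vector mu v &
      forall i j : 'I_n, (i < j)%N ->
        rep_act V (root_sub i j) *m v = 0 /\
        rep_act V (root_add i j) *m v = 0].

(** [V] is a model of V(mu). *)
Definition irrep_of_weight (mu : 'I_n -> rat) (V : so_rep) : Prop :=
  irreducible_rep V /\ exists v, highest_weight_vector (V := V) mu v.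

(** W is a direct sum of m copies of V and of irreducible representations that
    are not isomorphic to V. *)
Definition multiplicity (V W : so_rep) (m : nat) : Prop :=
  exists (r : nat) (S : 'I_r -> so_rep),
    (forall i, irreducible_rep (S i) /\ ~ rep_iso (S i) V) /\
    rep_iso W (rep_sum (\big[rep_sum/rep0]_(i < m) V)
                       (\big[rep_sum/rep0]_(i < r) S i)).

End LieAlgebra.

(** Coordinates of weights are indexed from 0: lambda_i is [lam] at i - 1. *)
Section Weights.
Variable n : nat.

Definition dominant_D (lam : 'I_n -> int) : Prop :=
  (forall i j : 'I_n, (i < j)%N -> lam j <= lam i) /\
  (forall i j : 'I_n, i.+2 = n -> j.+1 = n -> `|lam j| <= lam i).

Definition Lambda_n (i : 'I_n) : rat := 1 / 2%:R.

Definition Lambda_pred_n (i : 'I_n) : rat :=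
  if i.+1 == n then - (1 / 2%:R) else 1 / 2%:R.

Definition shifted_weight (lam : 'I_n -> int) (p : nat) (Lam : 'I_n -> rat)
    (i : 'I_n) : rat :=
  (lam i)%:~R + p%:R * Lam i.

End Weights.

(** q-numbers are polynomials in q = 'X with integer coefficients. *)
Definition qnum (m : nat) : {poly int} := \sum_(i < m) 'X^i.

Definition qfact (m : nat) : {poly int} := \prod_(1 <= j < m.+1) qnum j.

(** The divisor is monic, so this is an exact Euclidean division. *)
Definition qbinom (a : nat) (b : int) : {poly int} :=
  if b is Posz m then
    if (m <= a)%N then qfact a %/ (qfact m * qfact (a - m)) else 0
  else 0.

(** q-numbers and q-factorials of rationals that are natural numbers. *)
Definition qnum_rat (x : rat) : {poly int} := qnum (Num.truncn x).

Definition qfact_rat (x : rat) : {poly int} := qfact (Num.truncn x).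

Section Formulas.
Variables (n k p : nat) (lam : 'I_n -> int).

(** With i, j counted from 0, lambda_(n-j) is [lam (rev_ord j)].
    Only the absolute value of lambda_n enters, whereas for p = 1 the last
    coordinates of lambda + Lambda_n and lambda + Lambda_(n-1) are
    lambda_n + 1/2 and lambda_n - 1/2: [MD] counts the multiplicity of the
    former when lambda_n >= 0 and of the latter when lambda_n <= 0. *)
Definition MD : {poly int} :=
  \det (\matrix_(i < n, j < n)
    qbinom (2 * (k + i) + p)
           (k%:Z + i%:Z - j%:Z - `|lam (rev_ord j)|)).

Definition complement (i : 'I_n) : int := k%:Z - lam (rev_ord i).

Definition weight_norm (nu : 'I_n -> int) : int := \sum_(i < n) i%:Z * nu i.

(** The 1-based n - i is n - (i + 1) for the 0-based i. *)
Definition a_ (i : 'I_n) : rat :=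
  (lam i)%:~R + (n%:R - i.+1%:R) + p%:R / 2%:R.

Definition MD_num : {poly int} :=
  (\prod_(i < n) qfact (2 * k + 2 * n - 2 * i.+1 + p)) *
  (\prod_(i < n) \prod_(j < n | (i < j)%N)
      (qnum_rat (a_ i - a_ j) * qnum_rat (a_ i + a_ j))).

Definition MD_den : {poly int} :=
  \prod_(i < n)
    (qfact_rat (k%:R + n%:R - 1 - a_ i + p%:R / 2%:R) *
     qfact_rat (k%:R + n%:R - 1 + a_ i + p%:R / 2%:R)).

(** The value lies in the field of fractions of Z[q], and the exponent of q is
    an integer. *)
Definition MD_product : {fraction {poly int}} :=
  ('X : {poly int})%:F ^ weight_norm complement *
  (MD_num%:F / MD_den%:F).

End Formulas.

(* Main.v *)
Require Import Defs.
From Stdlib Require Import Classical.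
From mathcomp Require Import all_boot all_order all_algebra all_fingroup.
From mathcomp Require Import ring lra zify.
From mathcomp.real_closed Require Import mxtens.
From mathcomp.multinomials Require Import mpoly.

Set Implicit Arguments.
Unset Strict Implicit.
Unset Printing Implicit Defensive.

Import Order.TTheory GRing.Theory Num.Theory.

Local Open Scope ring_scope.

(** By the Weyl character formula, the multiplicity of V(nu) in a
    representation with character f is the coefficient of x^(nu + rho) in
    (Weyl denominator) * f.  This is proved through the Casimir operator: on
    an irreducible summand it is a scalar, which makes (denominator) *
    (character) an eigenvector of the flat Laplacian sum_i (x_i d/dx_i)^2, so
    its exponents all have the length of the leading one, and the leading one
    is the only dominant exponent of that length.

    The sum of the half-spin representations has character
    prod_i (x_i^(1/2) + x_i^(-1/2)).  In type D_n the denominator is a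
    determinant in the y_j = x_j + 1/x_j, whose i-th row may be any monic
    polynomial of degree i evaluated at the y_j.  For a power W of the spin
    representation the choice (y + 2)^i makes every entry of the coefficient a
    binomial, which gives [MD] at q = 1.

    Positivity of the coefficients of [MD] comes from grading the powers of
    Lambda(C^2n), which is the square of the spin representation: if the
    a-th factor is graded by t^((2a + 1 + p) degree), the character becomes
    a product to which the q-binomial theorem applies with q = t^2, and the
    coefficient of a dominant weight is [MD] up to a power of t.

    For the product formula, the i-th row of [MD] is, up to factorials, a
    polynomial of degree i in q^(-v_j) + q^(v_j + p), where
    v_j = n - j + |lambda_j|; hence [MD] is a Vandermonde determinant. *)

(** * The Lie algebra so_2n and its representations *)

(** Complete reducibility comes from unitarity. The tensor power is replaced by the isomorphic power
    of an explicit spin representation, which respects conjugate transposes in its standard basis;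
    an invariant subspace then has an orthogonal projector commuting with [so], and multiplicities
    are found by splitting such projectors into irreducible ones. The same basis consists of weight
    vectors, so characters are sums over diagonal entries.

    Half-integral exponents never occur. Weights in N/2 + Z are stored as natural exponents shifted
    by N/2, the denominator is shifted by n - 1, and the Euler operators carry these shifts as
    additive constants.

    A single determinant serves both half-spin shifts and both signs of lambda_n. Changing the sign
    of the last coordinate of the weight reflects the lower index of the binomials in one column
    about the middle, and binomials are symmetric under this reflection. *)

Section Bar.
Variable n : nat.

(** The index that [so_form] pairs with [a]. It negates the weights of the vector representation,
    and turns membership in [so] into a skewness condition on entries ([mem_soP]). *)
Definition bar (a : 'I_(n + n)) : 'I_(n + n) :=
  match split a with inl i => rshift n i | inr i => lshift n i end.

Lemma bar_lshift i : bar (lshift n i) = rshift n i.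
Proof. by rewrite /bar (unsplitK (inl i)). Qed.

Lemma bar_rshift i : bar (rshift n i) = lshift n i.
Proof. by rewrite /bar (unsplitK (inr i)). Qed.

Lemma barK : involutive bar.
Proof.
by move=> a; case: (split_ordP a) => i ->; rewrite !(bar_lshift, bar_rshift).
Qed.

Lemma bar_eq a b : (bar a == bar b) = (a == b).
Proof. exact: (inj_eq (inv_inj barK)). Qed.

Lemma bar_sym a b : (a == bar b) = (bar a == b).
Proof. by rewrite -{2}[b]barK bar_eq. Qed.

Lemma sum_bar (V : nmodType) (f : 'I_(n + n) -> V) :
  \sum_a f (bar a) = \sum_a f a.
Proof. by rewrite [RHS](reindex_inj (inv_inj barK)). Qed.

End Bar.

Section SoBasics.
Variables (C : numClosedFieldType) (n : nat).
Local Notation M := 'M[C]_(n + n).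
Implicit Types (x y : M) (a b c d : 'I_(n + n)).

Lemma so_formE a b : so_form C n a b = (b == bar a)%:R.
Proof.
rewrite /so_form; case: (split_ordP a) => i ->; case: (split_ordP b) => j ->;
  rewrite ?(block_mxEul, block_mxEur, block_mxEdl, block_mxEdr) !mxE
    ?bar_lshift ?bar_rshift ?eq_lrshift ?eq_rlshift //.
  by rewrite eq_rshift eq_sym.
by rewrite eq_lshift eq_sym.
Qed.

Lemma mem_soP x : reflect (forall a b, x a b = - x (bar b) (bar a)) (x \in @so C n).
Proof.
have E : forall a b, (x^T *m so_form C n + so_form C n *m x) a b =
    x (bar b) a + x (bar a) b.
  move=> a b; rewrite mxE [X in X + _]mxE [X in _ + X]mxE; congr (_ + _).
    rewrite (bigD1 (bar b)) //= big1 ?addr0 => [|c nc].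
      by rewrite so_formE barK eqxx mulr1 mxE.
    by rewrite so_formE bar_sym eq_sym (negbTE nc) mulr0.
  rewrite (bigD1 (bar a)) //= big1 ?addr0 => [|c nc].
    by rewrite so_formE eqxx mul1r.
  by rewrite so_formE (negbTE nc) mul0r.
have -> : (x \in @so C n) = (x^T *m so_form C n + so_form C n *m x == 0) by [].
apply: (iffP eqP) => [/matrixP h a b|h].
  move: (h b (bar a)); rewrite E mxE barK => /eqP.
  by rewrite addr_eq0 => /eqP.
by apply/matrixP=> a b; rewrite E mxE (h _ a) barK addNr.
Qed.

Lemma so_lin (t : C) x y : x \in @so C n -> y \in @so C n -> t *: x + y \in @so C n.
Proof.
move=> /mem_soP hx /mem_soP hy; apply/mem_soP=> a b.
by rewrite !mxE hx hy mulrN opprD.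
Qed.

Lemma so0 : 0 \in @so C n.
Proof. by apply/mem_soP=> a b; rewrite !mxE oppr0. Qed.

Lemma soZ (t : C) x : x \in @so C n -> t *: x \in @so C n.
Proof. by move=> hx; rewrite -[_ *: _]addr0 so_lin ?so0. Qed.

Lemma soD x y : x \in @so C n -> y \in @so C n -> x + y \in @so C n.
Proof. by move=> hx hy; rewrite -[x]scale1r so_lin. Qed.

Lemma soN x : x \in @so C n -> - x \in @so C n.
Proof. by move=> hx; rewrite -scaleN1r soZ. Qed.

Lemma so_sum (I : Type) (r : seq I) (P : pred I) (f : I -> M) :
  (forall i, P i -> f i \in @so C n) -> \sum_(i <- r | P i) f i \in @so C n.
Proof. by move=> h; elim/big_ind: _ => //; [exact: so0 | exact: soD]. Qed.

Lemma so_bar x a b : x \in @so C n -> x (bar b) (bar a) = - x a b.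
Proof. by move=> /mem_soP h; rewrite (h a b) opprK. Qed.

Lemma so_bar1 x a b : x \in @so C n -> x a (bar b) = - x b (bar a).
Proof. by move=> /mem_soP h; rewrite (h a) barK. Qed.

Lemma lie_so x y : x \in @so C n -> y \in @so C n -> lie x y \in @so C n.
Proof.
move=> hx hy; apply/mem_soP=> a b; rewrite !mxE opprB.
rewrite -[X in _ = X - _]sum_bar -[X in _ = _ - X]sum_bar.
congr (_ - _); apply: eq_bigr => c _;
  by rewrite (so_bar _ _ hx) (so_bar _ _ hy) mulrNN mulrC.
Qed.

(** An overcomplete spanning set: [soF a b] and [soF (bar b) (bar a)] differ by a sign, and
    [soF a (bar a)] is zero. A sum over all index pairs counts everything twice, hence the factor
    1/2 in [so_span] and in [casimir]; in exchange the bracket formula [lie_soF] has a single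
    case. *)
Definition soF a b : M := delta_mx a b - delta_mx (bar b) (bar a).

Lemma soF_so a b : soF a b \in @so C n.
Proof.
apply/mem_soP=> c d; rewrite !mxE opprB !bar_eq !bar_sym.
by rewrite [(d == b) && _]andbC [(bar d == _) && _]andbC.
Qed.

Lemma soF_bar a b : soF (bar b) (bar a) = - soF a b.
Proof. by rewrite /soF !barK opprB. Qed.

Lemma soF_abar a : soF a (bar a) = 0.
Proof. by rewrite /soF barK subrr. Qed.

Lemma so_span x : x \in @so C n -> x = 2^-1 *: \sum_a \sum_b x a b *: soF a b.
Proof.
move=> hx; apply/(scalerI (a := 2)); rewrite ?pnatr_eq0 //.
rewrite scalerA divff ?pnatr_eq0 // scale1r /soF.
under eq_bigr do [under eq_bigr do rewrite scalerBr; rewrite big_split /=].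
rewrite big_split /= -matrix_sum_delta scaler_nat mulr2n.
congr (_ + _); rewrite [LHS]matrix_sum_delta exchange_big -sum_bar /=.
apply: eq_bigr => a _; rewrite -sum_bar; apply: eq_bigr => b _.
by rewrite -scaleNr (so_bar _ _ hx).
Qed.

Lemma lie_soF x a b : x \in @so C n ->
  lie x (soF a b) = \sum_c (x c a *: soF c b) - \sum_c (x b c *: soF a c).
Proof.
move=> hx; have L i j : x *m delta_mx i j = \sum_c x c i *: delta_mx c j.
  apply/matrixP=> k l; rewrite !mxE summxE (bigD1 i) //= big1 ?addr0; last first.
    by move=> c /negbTE nc; rewrite !mxE nc mulr0.
  rewrite (bigD1 k) //= big1 ?addr0; last first.
    by move=> c /negbTE nc; rewrite !mxE eq_sym nc mulr0.
  by rewrite !mxE !eqxx.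
have R i j : delta_mx i j *m x = \sum_c x j c *: delta_mx i c.
  apply/matrixP=> k l; rewrite !mxE summxE (bigD1 j) //= big1 ?addr0; last first.
    by move=> c /negbTE nc; rewrite !mxE nc andbF mul0r.
  rewrite (bigD1 l) //= big1 ?addr0; last first.
    by move=> c /negbTE nc; rewrite !mxE [l == c]eq_sym nc andbF mulr0.
  by rewrite !mxE !eqxx andbT mulrC.
rewrite /lie /soF mulmxBr mulmxBl !L !R.
under [X in _ = X - _]eq_bigr do rewrite scalerBr.
under [X in _ = _ - X]eq_bigr do rewrite scalerBr.
rewrite !sumrB.
rewrite -[X in _ - X - _ = _]sum_bar -[X in _ - (_ - X) = _]sum_bar.
have -> : \sum_c x (bar c) (bar b) *: delta_mx (bar c) (bar a) =
   - \sum_c x b c *: delta_mx (bar c) (bar a) :> M.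
  by rewrite -sumrN; apply: eq_bigr => c _; rewrite (so_bar _ _ hx) scaleNr.
have -> : \sum_c x (bar a) (bar c) *: delta_mx (bar b) (bar c) =
   - \sum_c x c a *: delta_mx (bar b) (bar c) :> M.
  by rewrite -sumrN; apply: eq_bigr => c _; rewrite (so_bar _ _ hx) scaleNr.
rewrite !opprK !opprD !opprK; set A := \sum_c _; set B := \sum_c _.
by rewrite [X in _ + X = _]addrC addrACA [B + _]addrC.
Qed.

Lemma soF_lshift i : soF (lshift n i) (lshift n i) = cartan (delta_mx 0 i).
Proof.
rewrite /soF /cartan bar_lshift.
have -> : diag_mx (delta_mx 0 i) = delta_mx i i :> 'M[C]_n.
  apply/matrixP=> j k; rewrite !mxE eqxx /=; case: (eqVneq j k) => [<-|njk].
    by rewrite mulr1n andbb.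
  by rewrite mulr0n; case: eqVneq => //= ji; rewrite -ji eq_sym (negbTE njk).
apply/matrixP=> a b; case: (split_ordP a) => k ->; case: (split_ordP b) => l ->;
  rewrite ?(block_mxEul, block_mxEur, block_mxEdl, block_mxEdr) !mxE ?eq_lshift
    ?eq_rshift ?eq_lrshift ?eq_rlshift ?subr0 ?sub0r ?andbF ?subrr ?oppr0 //=.
Qed.

Lemma soF_root_sub i j : soF (lshift n i) (lshift n j) = root_sub C i j.
Proof.
rewrite /soF /root_sub !bar_lshift.
apply/matrixP=> a b; case: (split_ordP a) => k ->; case: (split_ordP b) => l ->;
  rewrite ?(block_mxEul, block_mxEur, block_mxEdl, block_mxEdr) !mxE ?eq_shift
    ?subr0 ?sub0r ?andbF ?subrr ?oppr0 //=.
Qed.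

Lemma soF_root_add i j : soF (lshift n i) (rshift n j) = root_add C i j.
Proof.
rewrite /soF /root_add !bar_lshift !bar_rshift.
apply/matrixP=> a b; case: (split_ordP a) => k ->; case: (split_ordP b) => l ->;
  rewrite ?(block_mxEul, block_mxEur, block_mxEdl, block_mxEdr) !mxE ?eq_shift
    ?subr0 ?sub0r ?andbF ?subrr ?oppr0 //=.
Qed.

Lemma cartan_so (h : 'rV[C]_n) : cartan h \in @so C n.
Proof.
apply/mem_soP=> a b; case: (split_ordP a) => k ->; case: (split_ordP b) => l ->;
  rewrite ?bar_lshift ?bar_rshift
    ?(block_mxEul, block_mxEur, block_mxEdl, block_mxEdr) !mxE ?oppr0 ?opprK //;
  by rewrite [l == k]eq_sym; case: eqVneq => [->|]; rewrite ?mulr1n ?mulr0n.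
Qed.

(** The weights of the vector representation. *)
Definition vwt (V : zmodType) (l : 'I_n -> V) (a : 'I_(n + n)) : V :=
  match split a with inl i => l i | inr i => - l i end.

Lemma vwt_lshift (V : zmodType) (l : 'I_n -> V) i : vwt l (lshift n i) = l i.
Proof. by rewrite /vwt (unsplitK (inl i)). Qed.

Lemma vwt_rshift (V : zmodType) (l : 'I_n -> V) i : vwt l (rshift n i) = - l i.
Proof. by rewrite /vwt (unsplitK (inr i)). Qed.

Lemma vwt_bar (V : zmodType) (l : 'I_n -> V) a : vwt l (bar a) = - vwt l a.
Proof.
by case: (split_ordP a) => i ->; rewrite ?bar_lshift ?bar_rshift
  ?vwt_lshift ?vwt_rshift ?opprK.
Qed.

Lemma cartanE (h : 'rV[C]_n) a b : cartan h a b = vwt (h 0) a *+ (a == b).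
Proof.
by case: (split_ordP a) => k ->; case: (split_ordP b) => l ->;
  rewrite ?(block_mxEul, block_mxEur, block_mxEdl, block_mxEdr) !mxE ?eq_shift
    ?vwt_lshift ?vwt_rshift ?mulr0n ?mulNrn.
Qed.

Lemma lie_cartan (h : 'rV[C]_n) a b :
  lie (cartan h) (soF a b) = (vwt (h 0) a - vwt (h 0) b) *: soF a b.
Proof.
rewrite lie_soF ?cartan_so // scalerBl; congr (_ - _).
  rewrite (bigD1 a) //= big1 ?addr0 ?cartanE ?eqxx ?mulr1n // => c nc.
  by rewrite cartanE (negbTE nc) mulr0n scale0r.
rewrite (bigD1 b) //= big1 ?addr0 ?cartanE ?eqxx ?mulr1n // => c nc.
by rewrite cartanE eq_sym (negbTE nc) mulr0n scale0r.
Qed.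

Lemma adj_so x : x \in @so C n -> (map_mx Num.conj x)^T \in @so C n.
Proof.
by move=> hx; apply/mem_soP=> a b; rewrite !mxE (so_bar _ _ hx) rmorphN opprK.
Qed.

Lemma adj_soF a b : (map_mx Num.conj (soF a b))^T = soF b a.
Proof.
by apply/matrixP=> c d; rewrite !mxE rmorphB /= !conjC_nat ![(d == _) && _]andbC.
Qed.

End SoBasics.

(** By excluded middle, a subspace contained in [P] can be enlarged until it fills [P]; [k] bounds
    the remaining codimension. Submodules can thus be given as predicates. *)
Lemma subspace_comprehension (K : fieldType) (vT : vectType K) (P : vT -> Prop) :
  P 0 -> (forall (a : K) u v, P u -> P v -> P (a *: u + v)) ->
  exists U : {vspace vT}, forall v, v \in U <-> P v.
Proof.
move=> P0 Plin.
suff H k (U : {vspace vT}) : (forall v, v \in U -> P v) -> (dim vT - \dim U <= k)%N ->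
    exists U : {vspace vT}, forall v, v \in U <-> P v.
  apply: (H (dim vT) 0%VS); last by rewrite leq_subr.
  by move=> v; rewrite memv0 => /eqP ->.
elim: k U => [|k IH] U PU hk.
  exists U => v; split; first exact: PU.
  move=> _; have -> : U = fullv.
    apply/eqP; rewrite eqEdim subvf /= dimvf -subn_eq0.
    by move: hk; rewrite leqn0.
  exact: memvf.
case: (classic (exists v, P v /\ v \notin U)) => [[v [Pv nv]]|nex].
  apply: (IH (U + <[v]>)%VS).
    move=> w /memv_addP[u /PU Pu [v' /vlineP[a ->] ->]].
    by rewrite addrC; apply: Plin.
  rewrite dimv_disjoint_sum; last first.
    apply/eqP; rewrite -subv0; apply/subvP=> w /memv_capP[wU /vlineP[a wa]].
    rewrite memv0 wa; case: (eqVneq a 0) => [->|na]; first by rewrite scale0r.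
    by move: wU; rewrite wa rpredZeq (negbTE na) (negbTE nv).
  have nv0 : v != 0 by apply: contraNneq nv => ->; rewrite mem0v.
  by rewrite dim_vline nv0; lia.
exists U => v; split; first exact: PU.
by move=> Pv; apply/negP => /negP nv; apply: nex; exists v.
Qed.

Section Reps.
Variables (C : numClosedFieldType) (n : nat).
Implicit Types (V W : so_rep C n) (x y : 'M[C]_(n + n)).
Local Notation so := (@so C n).

Lemma act0 V : rep_act V 0 = 0.
Proof.
have := rep_linear V 1 (so0 C n) (so0 C n).
by rewrite !scale1r addr0 => /eqP; rewrite -subr_eq0 opprD addrA subrr sub0r oppr_eq0 => /eqP.
Qed.

Lemma actZ V (t : C) x : x \in so -> rep_act V (t *: x) = t *: rep_act V x.
Proof. by move=> hx; rewrite -[t *: x]addr0 rep_linear ?so0 // act0 addr0. Qed.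

Lemma actD V x y : x \in so -> y \in so -> rep_act V (x + y) = rep_act V x + rep_act V y.
Proof. by move=> hx hy; rewrite -[x]scale1r rep_linear ?scale1r // . Qed.

Lemma actN V x : x \in so -> rep_act V (- x) = - rep_act V x.
Proof. by move=> hx; rewrite -scaleN1r actZ // scaleN1r. Qed.

Lemma act_sum V (I : Type) (r : seq I) (P : pred I) (f : I -> 'M[C]_(n + n)) :
  (forall i, P i -> f i \in so) ->
  rep_act V (\sum_(i <- r | P i) f i) = \sum_(i <- r | P i) rep_act V (f i).
Proof.
move=> h.
suff [] : (\sum_(i <- r | P i) f i \in so) /\
  rep_act V (\sum_(i <- r | P i) f i) = \sum_(i <- r | P i) rep_act V (f i) by [].
elim/big_rec2: _ => [|i u w Pi [hw IH]]; first by rewrite so0 act0.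
by rewrite soD ?h //= actD ?h // IH.
Qed.

Lemma act_soF_span V x : x \in so ->
  rep_act V x = 2^-1 *: \sum_a \sum_b x a b *: rep_act V (soF C a b).
Proof.
move=> hx; rewrite {1}(so_span hx) actZ; last first.
  by do 2 (apply: so_sum => ? _); rewrite soZ ?soF_so.
congr (_ *: _); rewrite act_sum => [|a _]; last by apply: so_sum=> ? _; rewrite soZ ?soF_so.
apply: eq_bigr => a _; rewrite act_sum => [|b _]; last by rewrite soZ ?soF_so.
by apply: eq_bigr => b _; rewrite actZ ?soF_so.
Qed.

Lemma act_lie V x y (m : nat) (u : 'M[C]_(_, m)) : x \in so -> y \in so ->
  rep_act V x *m (rep_act V y *m u) =
  rep_act V y *m (rep_act V x *m u) + rep_act V (lie x y) *m u.
Proof. by move=> hx hy; rewrite rep_lie // /lie mulmxBl !mulmxA addrC subrK. Qed.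

Definition pairing (k l : 'I_n -> C) : C := \sum_i k i * l i.

Definition wt_vec V (k : 'I_n -> C) (v : 'cV[C]_(rep_dim V)) : Prop :=
  forall h : 'rV[C]_n, rep_act V (cartan h) *m v = pairing k (h 0) *: v.

Definition hw_vec V (k : 'I_n -> C) (v : 'cV[C]_(rep_dim V)) : Prop :=
  [/\ v != 0, wt_vec k v &
      forall i j : 'I_n, (i < j)%N ->
        rep_act V (soF C (lshift n i) (lshift n j)) *m v = 0 /\
        rep_act V (soF C (lshift n i) (rshift n j)) *m v = 0].

Lemma highest_weight_vectorE V mu (v : 'cV[C]_(rep_dim V)) :
  highest_weight_vector mu v -> hw_vec (fun i => ratr (mu i)) v.
Proof.
move=> [v0 wv hv]; split=> // i j ij; have [h1 h2] := hv i j ij.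
by rewrite soF_root_sub soF_root_add.
Qed.

Lemma wt_vec_uniq V k k' (v : 'cV[C]_(rep_dim V)) :
  v != 0 -> wt_vec k v -> wt_vec k' v -> k =1 k'.
Proof.
move=> v0 h h' i; have := h (delta_mx 0 i); rewrite h' => /eqP.
have E (q : 'I_n -> C) : pairing q (fun j => (delta_mx 0 i : 'rV[C]_n) 0 j) = q i.
  rewrite /pairing (bigD1 i) //= !mxE !eqxx mulr1 big1 ?addr0 // => j /negbTE ji.
  by rewrite !mxE ji mulr0.
by rewrite -subr_eq0 -scalerBl scaler_eq0 (negbTE v0) orbF subr_eq0 !E => /eqP.
Qed.

(** Strict positivity on the positive roots of type D. Weights are compared through their pairing
    with [l], which stays a parameter because [weyl_multiplicity] uses an [l] built from the two
    weights it compares. *)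
Definition sdom (l : 'I_n -> C) : Prop :=
  forall i j : 'I_n, (i < j)%N -> 0 < l i - l j /\ 0 < l i + l j.

Lemma wt_vec_soF V k (v : 'cV[C]_(rep_dim V)) a b : wt_vec k v ->
  wt_vec (fun i => k i + (vwt (fun j => (j == i)%:R) a - vwt (fun j => (j == i)%:R) b))
    (rep_act V (soF C a b) *m v).
Proof.
move=> hv h; rewrite act_lie ?cartan_so ?soF_so // hv lie_cartan actZ ?soF_so //.
rewrite -scalemxAr -scalemxAl -scalerDl; congr (_ *: _).
rewrite /pairing /=; under [RHS]eq_bigr do rewrite mulrDl; rewrite big_split /=; congr (_ + _).
have E c : vwt (h 0) c = \sum_i vwt (fun j => (j == i)%:R) c * h 0 i.
  by case: (split_ordP c) => j ->; rewrite ?vwt_lshift ?vwt_rshift;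
    under eq_bigr do rewrite ?vwt_lshift ?vwt_rshift;
    (rewrite (bigD1 j) //= big1 ?addr0 => [|i ij]; first by rewrite eqxx ?mulN1r ?mul1r);
    rewrite eq_sym (negbTE ij) ?oppr0 mul0r.
by rewrite !E -sumrB; apply: eq_bigr => i _; rewrite mulrBl.
Qed.

(** * The module generated by a highest weight vector *)

Section Cyclic.
Variables (V : so_rep C n) (l : 'I_n -> C) (k : 'I_n -> C) (v : 'cV[C]_(rep_dim V)).
Hypotheses (l_dom : sdom l) (hv : hw_vec k v).

(** Generated by the highest weight vector under the lowering operators only;
    that this is already stable under all of [so] is the content of [cyc_stable]. *)
Inductive cyc : 'cV[C]_(rep_dim V) -> Prop :=
| cyc_gen : cyc v
| cyc_lin (a : C) u w : cyc u -> cyc w -> cyc (a *: u + w)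
| cyc_low a b u : vwt l a < vwt l b -> cyc u -> cyc (rep_act V (soF C a b) *m u).

Lemma cyc0 : cyc 0.
Proof. by rewrite -[0](addNr v) -scaleN1r; apply: cyc_lin; apply: cyc_gen. Qed.

Lemma cycZ (a : C) u : cyc u -> cyc (a *: u).
Proof. by move=> hu; rewrite -[_ *: _]addr0; apply: cyc_lin => //; exact: cyc0. Qed.

Lemma cyc_sum (I : Type) (r : seq I) (f : I -> 'cV[C]_(rep_dim V)) :
  (forall i, cyc (f i)) -> cyc (\sum_(i <- r) f i).
Proof.
move=> h; elim/big_rec: _ => [|i u _ hu]; first exact: cyc0.
by rewrite -[f i]scale1r; apply: cyc_lin.
Qed.

(** Raising operators kill [v], Cartan elements scale it, and the others are lowering operators; the
    symmetry under [bar] reduces the redundant [soF a b] to these. *)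
Lemma cyc_soF a b : cyc (rep_act V (soF C a b) *m v).
Proof.
have [_ wv kill] := hv.
have sub (i j : 'I_n) : cyc (rep_act V (soF C (lshift n i) (lshift n j)) *m v).
  case: (ltngtP i j) => [ij|ji|/val_inj ->].
  - by have [-> _] := kill i j ij; exact: cyc0.
  - apply: cyc_low; last exact: cyc_gen.
    by rewrite !vwt_lshift -subr_gt0; have [] := l_dom ji.
  - by rewrite soF_lshift wv; apply/cycZ/cyc_gen.
have add (i j : 'I_n) : cyc (rep_act V (soF C (lshift n i) (rshift n j)) *m v).
  case: (ltngtP i j) => [ij|ji|/val_inj ->].
  - by have [_ ->] := kill i j ij; exact: cyc0.
  - rewrite -[lshift n i]bar_rshift -[rshift n j]bar_lshift soF_bar actN ?soF_so // mulNmx.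
    by have [_ ->] := kill j i ji; rewrite oppr0; exact: cyc0.
  - by rewrite -bar_lshift soF_abar act0 mul0mx; exact: cyc0.
case: (split_ordP a) => i ->; case: (split_ordP b) => j -> //.
  case: (eqVneq i j) => [->|nij].
    by rewrite -bar_lshift -{2}[lshift n j]barK soF_abar act0 mul0mx; exact: cyc0.
  apply: cyc_low; last exact: cyc_gen; rewrite vwt_lshift vwt_rshift -subr_gt0 opprK.
  move: nij; rewrite neq_ltn => /orP[ij|ji]; first by rewrite addrC; have [] := l_dom ij.
  by have [] := l_dom ji.
by rewrite -[rshift n i]bar_lshift -[rshift n j]bar_lshift soF_bar actN ?soF_so // mulNmx -scaleN1r; apply: cycZ.
Qed.

(** Moving [x] past a lowering operator leaves a bracket that again lies in [so]. The induction
    hypothesis holds for all [x] at once and so covers this extra term. *)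
Lemma cyc_stable u : cyc u -> forall x, x \in so -> cyc (rep_act V x *m u).
Proof.
elim=> [|a u1 w _ IHu _ IHw|a b u1 ab _ IH] x hx.
- rewrite (act_soF_span V hx) -scalemxAl; apply: cycZ.
  rewrite mulmx_suml; apply: cyc_sum => a; rewrite mulmx_suml; apply: cyc_sum => b.
  by rewrite -scalemxAl; apply/cycZ/cyc_soF.
- by rewrite mulmxDr -scalemxAr; apply: cyc_lin; [apply: IHu|apply: IHw].
- rewrite act_lie ?soF_so //; rewrite -[_ *m (_ *m _)]scale1r.
  by apply: cyc_lin; [apply: cyc_low => //; apply: IH|apply/IH/lie_so => //; exact: soF_so].
Qed.

Inductive low (c : C) : 'cV[C]_(rep_dim V) -> Prop :=
| low0 : low c 0
| low_add w q u : wt_vec q w -> pairing q l < c -> low c u -> low c (w + u).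

Lemma lowD c u w : low c u -> low c w -> low c (u + w).
Proof.
elim=> [|w1 q u1 hw hq _ IH] hw2; first by rewrite add0r.
by rewrite -addrA; apply: low_add (IH hw2).
Qed.

Lemma lowZ c (a : C) u : low c u -> low c (a *: u).
Proof.
elim=> [|w1 q u1 hw hq _ IH]; first by rewrite scaler0; exact: low0.
rewrite scalerDr; apply: low_add hq IH.
by move=> h; rewrite -scalemxAr hw !scalerA mulrC.
Qed.

Lemma vwt_pairing a : vwt l a = \sum_i vwt (fun j => (j == i)%:R) a * l i.
Proof.
by case: (split_ordP a) => j ->; rewrite ?vwt_lshift ?vwt_rshift;
    under eq_bigr do rewrite ?vwt_lshift ?vwt_rshift;
    (rewrite (bigD1 j) //= big1 ?addr0 => [|i ij]; first by rewrite eqxx ?mulN1r ?mul1r);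
    rewrite eq_sym (negbTE ij) ?oppr0 mul0r.
Qed.

Lemma pairing_soF (q : 'I_n -> C) a b :
  pairing (fun i => q i + (vwt (fun j => (j == i)%:R) a - vwt (fun j => (j == i)%:R) b)) l
  = pairing q l + (vwt l a - vwt l b).
Proof.
rewrite /pairing /=; under eq_bigr do rewrite mulrDl; rewrite big_split /=; congr (_ + _).
by rewrite !vwt_pairing -sumrB; apply: eq_bigr => i _; rewrite mulrBl.
Qed.

Lemma cyc_low_form u : cyc u -> exists (a : C) w, u = a *: v + w /\ low (pairing k l) w.
Proof.
have [_ wv _] := hv.
elim=> [|a u1 w1 _ [a1 [w2 [-> h2]]] _ [a3 [w3 [-> h3]]]|a b u1 ab _ [a1 [w2 [-> h2]]]].
- by exists 1, 0; rewrite scale1r addr0; split=> //; exact: low0.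
- exists (a * a1 + a3), (a *: w2 + w3); split; last by apply: lowD => //; exact: lowZ.
  by rewrite scalerDr scalerA scalerDl addrACA.
- exists 0, (rep_act V (soF C a b) *m (a1 *: v + w2)).
  split; first by rewrite scale0r add0r.
  rewrite mulmxDr -scalemxAr; apply: lowD.
    apply: lowZ; rewrite -[X in low _ X]addr0; apply: low_add (low0 _).
      exact: wt_vec_soF wv.
    by rewrite pairing_soF gtrDl subr_lt0.
  elim: h2 => [|w q u2 hw hq _ IH]; first by rewrite mulmx0; exact: low0.
  rewrite mulmxDr; apply: low_add IH; first exact: wt_vec_soF hw.
  by rewrite pairing_soF; apply: lt_trans hq; rewrite gtrDl subr_lt0.
Qed.

Let H := rep_act V (cartan (\row_i l i)).
(** The product of the operators [H - t] over [t] in [s]. It is a scalar on each weight vector,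
    which lets it separate [v] from lower terms. *)
Let Kop (s : seq C) (u : 'cV[C]_(rep_dim V)) : 'cV[C]_(rep_dim V) := foldr (fun t w => H *m w - t *: w) u s.

Let HE q w : wt_vec q w -> H *m w = pairing q l *: w.
Proof.
move=> hw; rewrite /H hw; congr (_ *: _); apply: eq_bigr => i _; by rewrite mxE.
Qed.

Let KopD s u w : Kop s (u + w) = Kop s u + Kop s w.
Proof. by elim: s => //= t s ->; rewrite mulmxDr scalerDr opprD addrACA. Qed.

Let KopZ s (a : C) u : Kop s (a *: u) = a *: Kop s u.
Proof.
by elim: s => //= t s ->; rewrite -scalemxAr scalerBr !scalerA mulrC.
Qed.

Let Kop_eig s q w : wt_vec q w ->
  Kop s w = (\prod_(t <- s) (pairing q l - t)) *: w.
Proof.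
move=> hw; elim: s => [|t s IH] /=; first by rewrite big_nil scale1r.
by rewrite IH -scalemxAr (HE hw) big_cons !scalerA -scalerBl mulrBl [t * _]mulrC
  [_ * pairing _ _]mulrC.
Qed.

Lemma low_annihilator c u : low c u -> exists s, all (< c) s /\ Kop s u = 0.
Proof.
elim=> [|w q u1 hw hq _ [s [hs h0]]]; first by exists [::].
exists (pairing q l :: s); split; first by rewrite /= hq.
rewrite /= KopD h0 addr0 (Kop_eig _ hw) -scalemxAr (HE hw) !scalerA mulrC.
by rewrite subrr.
Qed.

(** Write [w] as a multiple of [v] plus a lower part, and apply a product of operators [H - t] that
    kills the lower part but not [v]. If the two pairings agree, [w] is proportional to [v].
    Otherwise one more application of [H] forces the scalar on [w] to vanish, so the pairing of [q]
    is one of the [t], all of which lie below that of [k]. *)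
Lemma cyc_top q w : cyc w -> wt_vec q w -> w != 0 ->
  pairing q l < pairing k l \/ exists a : C, w = a *: v.
Proof.
have [v0 wv _] := hv.
move=> hw wq w0; have [a [u [wE lu]]] := cyc_low_form hw.
have [s [hs Ks]] := low_annihilator lu.
have nz : \prod_(t <- s) (pairing k l - t) != 0.
  rewrite prodf_seq_neq0; apply/allP => t /(allP hs) /= tc.
  by rewrite subr_eq0 gt_eqF.
have := congr1 (Kop s) wE; rewrite KopD Ks addr0 KopZ (Kop_eig _ wq) (Kop_eig _ wv) => E.
case: (eqVneq (pairing q l) (pairing k l)) => [qk|nqk].
  right; exists a; apply: (scalerI nz); rewrite -qk E qk !scalerA; congr (_ *: _).
  by rewrite mulrC.
left; have := congr1 (mulmx H) E; rewrite -!scalemxAr (HE wq) (HE wv) => E2.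
have : (pairing q l - pairing k l) *: ((\prod_(t <- s) (pairing q l - t)) *: w) = 0.
  rewrite !scalerA mulrC in E2.
  rewrite scalerBl scalerA E2 E !scalerA -scalerBl.
  by rewrite [X in (X - _) *: _](_ : _ = pairing k l * (a * \prod_(t <- s) (pairing k l - t))) ?subrr ?scale0r //; ring.
move/eqP; rewrite !scaler_eq0 (negbTE w0) orbF subr_eq0 (negbTE nqk) /=.
by rewrite prodf_seq_eq0 => /hasP[t ts]; rewrite /= subr_eq0 => /eqP ->; apply: (allP hs).
Qed.

End Cyclic.

Lemma irr_dichotomy V (P : 'cV[C]_(rep_dim V) -> Prop) :
  irreducible_rep V -> P 0 -> (forall (a : C) u w, P u -> P w -> P (a *: u + w)) ->
  (forall u, P u -> forall x, x \in so -> P (rep_act V x *m u)) ->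
  (forall u, P u -> u = 0) \/ (forall u, P u).
Proof.
move=> [_ irr] P0 Plin Pst; have [U hU] := subspace_comprehension P0 Plin.
have [|UE|UE] := irr U.
- by move=> x hx v /hU Pv; apply/hU/Pst.
- by left=> u /hU; rewrite UE memv0 => /eqP.
- by right=> u; apply/hU; rewrite UE memvf.
Qed.

Lemma irr_top V l k v q w : sdom l -> irreducible_rep V -> hw_vec (V := V) k v ->
  wt_vec (V := V) q w -> w != 0 ->
  pairing q l < pairing k l \/ exists a : C, w = a *: v.
Proof.
move=> ld irr hv; have [v0 _ _] := hv.
have [|||h|h] := irr_dichotomy (P := cyc l v) irr.
- exact: cyc0.
- by move=> a u1 w1; apply: cyc_lin.
- by move=> u hu; exact: (cyc_stable ld hv hu).
- by move: v0; rewrite (h v (cyc_gen _ _)) eqxx.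
- by move=> wq w0; apply: (cyc_top hv (h w) wq w0).
Qed.

Definition rho_ (i : 'I_n) : C := (n - i.+1)%:R.

Lemma rho_sdom : sdom rho_.
Proof.
move=> i j ij; rewrite /rho_; split.
  by rewrite subr_gt0 ltr_nat; have := ltn_ord j; lia.
by rewrite -natrD ltr0n; have := ltn_ord j; lia.
Qed.

(** By [irr_top] either one vector is a multiple of the other, and the weights agree, or each weight
    lies strictly below the other, which is absurd. *)
Lemma irr_hw_uniq V k v k' v' : irreducible_rep V -> hw_vec (V := V) k v ->
  hw_vec (V := V) k' v' -> k =1 k'.
Proof.
move=> irr hv hv'; have [v0 wv _] := hv; have [v0' wv' _] := hv'.
have [lt1|[a va]] := irr_top rho_sdom irr hv wv' v0'.
  have [lt2|[a va]] := irr_top rho_sdom irr hv' wv v0.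
    by have := lt_trans lt1 lt2; rewrite ltxx.
  apply: wt_vec_uniq v0 wv _; rewrite va => h.
  by rewrite -scalemxAr wv' !scalerA mulrC.
apply: wt_vec_uniq v0' _ wv'; rewrite va => h.
by rewrite -scalemxAr wv !scalerA mulrC.
Qed.

End Reps.

Lemma tensmx11 (R : comPzRingType) m m' :
  (1%:M : 'M[R]_m) *t (1%:M : 'M[R]_m') = 1%:M.
Proof.
apply/matrixP => i j.
case: (mxtens_indexP i) => i1 i2; case: (mxtens_indexP j) => j1 j2.
rewrite tensmxE !mxE (inj_eq (can_inj (@mxtens_indexK _ _))) xpair_eqE.
by case: eqP => _; case: eqP => _; rewrite ?mulr0 ?mul0r ?mulr1.
Qed.

(** * Direct sums, idempotents and isomorphisms of irreducibles *)

Section Iso.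
Variables (C : numClosedFieldType) (n : nat).
Implicit Types (V W Q : so_rep C n) (x y : 'M[C]_(n + n)).
Local Notation so := (@so C n).

Definition rep_hom V W (A : 'M[C]_(rep_dim W, rep_dim V)) : Prop :=
  {in so, forall x, A *m rep_act V x = rep_act W x *m A}.

Lemma rep_hom_mul V W Q A B : rep_hom (V := V) (W := W) A -> rep_hom (V := W) (W := Q) B ->
  rep_hom (V := V) (W := Q) (B *m A).
Proof. by move=> hA hB x hx; rewrite -mulmxA hA // mulmxA hB // mulmxA. Qed.

Lemma iso_refl V : rep_iso V V.
Proof. by exists 1%:M, 1%:M; split; rewrite ?mulmx1 // => x _; rewrite mulmx1 mul1mx. Qed.

Lemma iso_sym V W : rep_iso V W -> rep_iso W V.
Proof.
move=> [A [B [AB BA hA]]]; exists B, A; split=> // x hx.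
by rewrite -[LHS]mulmx1 -AB mulmxA -(mulmxA B) -hA // !mulmxA BA mul1mx.
Qed.

Lemma iso_trans V W Q : rep_iso V W -> rep_iso W Q -> rep_iso V Q.
Proof.
move=> [A [B [AB BA hA]]] [A' [B' [AB' BA' hA']]]; exists (A' *m A), (B *m B').
split; last exact: rep_hom_mul hA hA'.
  by rewrite mulmxA -(mulmxA A') AB mulmx1.
by rewrite mulmxA -(mulmxA B) BA' mulmx1.
Qed.

(** A direct sum given by injections and projections. Regrouping and swapping summands becomes plain
    matrix algebra, whereas [rep_sum] is associative and commutative only up to isomorphism. *)
Definition biprod W V1 V2 : Prop :=
  exists (B1 : 'M_(rep_dim W, rep_dim V1)) (L1 : 'M_(rep_dim V1, rep_dim W))
         (B2 : 'M_(rep_dim W, rep_dim V2)) (L2 : 'M_(rep_dim V2, rep_dim W)),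
  [/\ [/\ L1 *m B1 = 1%:M, L2 *m B2 = 1%:M, L1 *m B2 = 0, L2 *m B1 = 0 &
          B1 *m L1 + B2 *m L2 = 1%:M],
      rep_hom (V := V1) (W := W) B1, rep_hom (V := W) (W := V1) L1,
      rep_hom (V := V2) (W := W) B2 & rep_hom (V := W) (W := V2) L2].

Lemma biprod_iso W V1 V2 : biprod W V1 V2 -> rep_iso W (rep_sum V1 V2).
Proof.
move=> [B1 [L1 [B2 [L2 [[E11 E22 E12 E21 E] hB1 hL1 hB2 hL2]]]]].
exists (col_mx L1 L2), (row_mx B1 B2); split.
- by rewrite mul_col_row E11 E22 E12 E21 -scalar_mx_block.
- by rewrite mul_row_col.
- move=> x hx; rewrite mul_col_mx hL1 // hL2 //= /rep_sum_act.
  by rewrite mul_block_col !mul0mx addr0 add0r.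
Qed.

Lemma iso_biprod W V1 V2 : rep_iso W (rep_sum V1 V2) -> biprod W V1 V2.
Proof.
move=> iW; have [A [B [AB BA hA]]] := iW; have [B' [A' [BA' AB' hB']]] := iso_sym iW.
have {A' B' BA' AB' hB'} hB : rep_hom (V := rep_sum V1 V2) (W := W) B.
  move=> x hx; rewrite -[LHS]mulmx1 -AB mulmxA -(mulmxA B) -hA // !mulmxA BA.
  by rewrite mul1mx.
have hA' x : x \in so -> col_mx (usubmx A *m rep_act W x) (dsubmx A *m rep_act W x) =
    col_mx (rep_act V1 x *m usubmx A) (rep_act V2 x *m dsubmx A).
  move=> hx; rewrite -mul_col_mx vsubmxK hA //= /rep_sum_act -{1}[A]vsubmxK.
  by rewrite mul_block_col !mul0mx addr0 add0r.
have hB' x : x \in so -> row_mx (lsubmx B *m rep_act V1 x) (rsubmx B *m rep_act V2 x) =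
    row_mx (rep_act W x *m lsubmx B) (rep_act W x *m rsubmx B).
  move=> hx; rewrite -mul_mx_row hsubmxK -hB //= /rep_sum_act -{3}[B]hsubmxK.
  by rewrite mul_row_block !mulmx0 addr0 add0r.
exists (lsubmx B), (usubmx A), (rsubmx B), (dsubmx A).
have : block_mx (usubmx A *m lsubmx B) (usubmx A *m rsubmx B)
    (dsubmx A *m lsubmx B) (dsubmx A *m rsubmx B) = block_mx 1%:M 0 0 1%:M.
  by rewrite -mul_col_row vsubmxK hsubmxK AB -scalar_mx_block.
move=> /eq_block_mx[E11 E12 E21 E22].
split; first by split=> //; rewrite -mul_row_col vsubmxK hsubmxK.
- by move=> x /hB' /eq_row_mx[].
- by move=> x /hA' /eq_col_mx[].
- by move=> x /hB' /eq_row_mx[].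
- by move=> x /hA' /eq_col_mx[].
Qed.

Lemma biprod_sym W V1 V2 : biprod W V1 V2 -> biprod W V2 V1.
Proof.
move=> [B1 [L1 [B2 [L2 [[E11 E22 E12 E21 E] hB1 hL1 hB2 hL2]]]]].
by exists B2, L2, B1, L1; split=> //; split=> //; rewrite addrC.
Qed.

Lemma biprod_congl W V1 V2 V1' : rep_iso V1 V1' -> biprod W V1 V2 -> biprod W V1' V2.
Proof.
move=> i1 [B1 [L1 [B2 [L2 [[E11 E22 E12 E21 E] hB1 hL1 hB2 hL2]]]]].
have [A [B [AB BA hA]]] := i1.
have hB : rep_hom (V := V1') (W := V1) B.
  move=> x hx; rewrite -[LHS]mulmx1 -AB mulmxA -(mulmxA B) -hA // !mulmxA BA.
  by rewrite mul1mx.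
exists (B1 *m B), (A *m L1), B2, L2; split; rewrite //; last 2 first.
- exact: rep_hom_mul hB hB1.
- exact: rep_hom_mul hL1 hA.
split=> //.
- by rewrite mulmxA -(mulmxA A) E11 mulmx1.
- by rewrite -mulmxA E12 mulmx0.
- by rewrite mulmxA E21 mul0mx.
- by rewrite mulmxA -(mulmxA B1) BA mulmx1.
Qed.

Lemma biprod_assoc W Q W' V1 V2 : biprod W Q W' -> biprod W' V1 V2 ->
  biprod W (rep_sum Q V1) V2.
Proof.
move=> [B1 [L1 [B2 [L2 [[E11 E22 E12 E21 E] hB1 hL1 hB2 hL2]]]]].
move=> [D1 [M1 [D2 [M2 [[F11 F22 F12 F21 F] hD1 hM1 hD2 hM2]]]]].
exists (row_mx B1 (B2 *m D1)), (col_mx L1 (M1 *m L2)), (B2 *m D2), (M2 *m L2).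
have X p q (U : 'M_(p, _)) (U' : 'M_(_, q)) : U *m L2 *m (B2 *m U') = U *m U'.
  by rewrite mulmxA -(mulmxA U) E22 mulmx1.
split; last 4 first.
- move=> x hx; rewrite /= /rep_sum_act mul_row_block !mulmx0 addr0 add0r mul_mx_row.
  by rewrite hB1 // (rep_hom_mul hD1 hB2).
- move=> x hx; rewrite /= /rep_sum_act mul_block_col !mul0mx addr0 add0r mul_col_mx.
  by rewrite hL1 // (rep_hom_mul hL2 hM1).
- exact: rep_hom_mul hD2 hB2.
- exact: rep_hom_mul hL2 hM2.
split.
- rewrite mul_col_row E11 X F11 mulmxA E12 mul0mx -mulmxA E21 mulmx0.
  by rewrite -scalar_mx_block.
- by rewrite X.
- by rewrite mul_col_mx mulmxA E12 mul0mx X F12 col_mx0.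
- by rewrite mul_mx_row -mulmxA E21 mulmx0 X F21 row_mx0.
- rewrite mul_row_col -addrA -E; congr (_ + _).
  rewrite !mulmxA -mulmxDl -(mulmxA B2) -(mulmxA B2 D2) -mulmxDr F.
  by rewrite mulmx1.
Qed.

Definition sub_rep W (P : 'M[C]_(rep_dim W)) Q : Prop :=
  exists (B : 'M_(rep_dim W, rep_dim Q)) (L : 'M_(rep_dim Q, rep_dim W)),
    [/\ L *m B = 1%:M, B *m L = P, rep_hom (V := Q) (W := W) B & rep_hom (V := W) (W := Q) L].

(** In a full-rank factorisation [P = B L] the factor [B] has a left inverse and [L] a right
    inverse; cancelling them in [B L B L = B L] leaves [L B = 1]. *)
Lemma idempotent_factor d (P : 'M[C]_d) : P *m P = P ->
  exists r (B : 'M_(d, r)) (L : 'M_(r, d)), B *m L = P /\ L *m B = 1%:M.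
Proof.
move=> PP; exists (\rank P), (col_base P), (row_base P).
split; first exact: mulmx_base.
move: (mulmx_base P) (col_base_full P) (row_base_free P).
move: (col_base P) (row_base P); move: (\rank P) => r B L BL fB fL.
move: (mulVpmx fB) (mulmxVp fL); move: (pinvmx B) (pinvmx L) => B' L' B'B LL'.
have -> : L *m B = B' *m (P *m P) *m L'.
  by rewrite -BL !mulmxA B'B mul1mx -!mulmxA LL' mulmx1.
by rewrite PP -BL !mulmxA B'B mul1mx LL'.
Qed.

(** The action is compressed to the image: [x] acts as [L x B], which respects products because
    [B L = P] commutes with [so]. *)
Lemma sub_rep_exists W (P : 'M[C]_(rep_dim W)) :
  P *m P = P -> rep_hom (V := W) (W := W) P -> exists Q, sub_rep P Q.
Proof.
move=> PP hP; have [r [B [L [BL LB]]]] := idempotent_factor PP.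
pose act x := L *m rep_act W x *m B.
have lin (a : C) : {in so &, forall x y, act (a *: x + y) = a *: act x + act y}.
  move=> x y hx hy; rewrite /act rep_linear // mulmxDr mulmxDl.
  by rewrite -scalemxAr -scalemxAl.
have XB x : x \in so -> B *m act x = rep_act W x *m B.
  move=> hx; rewrite /act !mulmxA BL hP // -mulmxA.
  by rewrite -BL -mulmxA LB mulmx1.
have XL x : x \in so -> act x *m L = L *m rep_act W x.
  by move=> hx; rewrite /act -mulmxA BL -mulmxA -hP // mulmxA -BL mulmxA LB mul1mx.
have M x y : x \in so -> y \in so -> act x *m act y = L *m (rep_act W x *m rep_act W y) *m B.
  by move=> hx hy; rewrite {2}/act !mulmxA XL // !mulmxA.
have li : {in so &, forall x y, act (lie x y) = lie (act x) (act y)}.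
  move=> x y hx hy; rewrite {1}/act rep_lie // /lie mulmxBr mulmxBl.
  by rewrite -!M.
exists (SoRep lin li); exists B, L; split=> //.
by move=> x hx; exact/esym/XL.
Qed.

Lemma sub_repE W (P : 'M[C]_(rep_dim W)) Q : sub_rep P Q -> P *m P = P.
Proof.
by move=> [B [L [LB BL hB hL]]]; rewrite -BL -mulmxA (mulmxA L) LB mul1mx.
Qed.

Lemma sub_rep_biprod W (P P1 P2 : 'M[C]_(rep_dim W)) Q Q1 Q2 :
  P1 *m P2 = 0 -> P2 *m P1 = 0 -> P = P1 + P2 ->
  sub_rep P Q -> sub_rep P1 Q1 -> sub_rep P2 Q2 -> biprod Q Q1 Q2.
Proof.
move=> P12 P21 PE sQ s1 s2; have I1 := sub_repE s1; have I2 := sub_repE s2.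
move: sQ s1 s2 => [B [L [LB BL hB hL]]] [B1 [L1 [LB1 BL1 hB1 hL1]]] [B2 [L2 [LB2 BL2 hB2 hL2]]].
have K1 : P1 *m B1 = B1 by rewrite -BL1 -mulmxA LB1 mulmx1.
have K2 : P2 *m B2 = B2 by rewrite -BL2 -mulmxA LB2 mulmx1.
have K1' : L1 *m P1 = L1 by rewrite -BL1 mulmxA LB1 mul1mx.
have K2' : L2 *m P2 = L2 by rewrite -BL2 mulmxA LB2 mul1mx.
have PB1 : P *m B1 = B1 by rewrite PE mulmxDl K1 -K1 mulmxA P21 mul0mx addr0.
have PB2 : P *m B2 = B2 by rewrite PE mulmxDl K2 -K2 mulmxA P12 mul0mx add0r.
exists (L *m B1), (L1 *m B), (L *m B2), (L2 *m B); split; last 4 first.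
- exact: rep_hom_mul hB1 hL.
- exact: rep_hom_mul hB hL1.
- exact: rep_hom_mul hB2 hL.
- exact: rep_hom_mul hB hL2.
split.
- by rewrite -mulmxA (mulmxA B) BL PB1.
- by rewrite -mulmxA (mulmxA B) BL PB2.
- by rewrite -mulmxA (mulmxA B) BL PB2 -K1' -K2 mulmxA -(mulmxA L1) P12 mulmx0 mul0mx.
- by rewrite -mulmxA (mulmxA B) BL PB1 -K2' -K1 mulmxA -(mulmxA L2) P21 mulmx0 mul0mx.
- rewrite -!mulmxA (mulmxA B1) (mulmxA B2) BL1 BL2 -mulmxDr -mulmxDl -PE -BL.
  by rewrite -(mulmxA B) mulmxA LB mulmx1.
Qed.

Lemma mult_iso V W W' m : rep_iso W W' -> multiplicity V W' m -> multiplicity V W m.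
Proof.
by move=> i [r [S [hS iS]]]; exists r, S; split=> //; apply: iso_trans i iS.
Qed.

Lemma mult_zero V W : rep_dim W = 0 -> multiplicity V W 0.
Proof.
move=> W0; exists 0, (fun=> V); split; first by case.
rewrite !big_ord0; exists 0, 0.
have E (M : 'M[C]_(rep_dim W)) : M = 0 by apply/matrixP=> i; case: i => i hi; exfalso; rewrite W0 in hi.
split; first by apply/matrixP=> -[].
  by rewrite [LHS]E [RHS]E.
by move=> x _; apply/matrixP=> -[].
Qed.

Lemma mult_add_same V W Q W' m : biprod W Q W' -> rep_iso Q V ->
  multiplicity V W' m -> multiplicity V W m.+1.
Proof.
move=> bW iQ [r [S [hS iS]]]; exists r, S; split=> //.
rewrite big_ord_recl; apply: biprod_iso; apply: biprod_assoc (iso_biprod iS).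
exact: biprod_congl iQ bW.
Qed.

Lemma mult_add_other V W Q W' m : biprod W Q W' -> irreducible_rep Q -> ~ rep_iso Q V ->
  multiplicity V W' m -> multiplicity V W m.
Proof.
move=> bW irrQ niQ [r [S [hS iS]]].
exists r.+1, (fun i => if unlift ord0 i is Some j then S j else Q); split.
  by move=> i; case: unliftP => [j|] _ //; exact: hS.
rewrite big_ord_recl unlift_none; under [X in rep_sum Q X]eq_bigr do rewrite liftK.
apply: biprod_iso; apply: biprod_sym.
exact: biprod_assoc bW (biprod_sym (iso_biprod iS)).
Qed.

Lemma pow_iso V W m : rep_iso V W -> rep_iso (rep_pow V m) (rep_pow W m).
Proof.
move=> [A [B [AB BA hA]]]; elim: m => [|m [A' [B' [AB' BA' hA']]]].
  exact: iso_refl.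
exists (A *t A'), (B *t B'); split.
- by rewrite tensmx_mul AB AB' tensmx11.
- by rewrite tensmx_mul BA BA' tensmx11.
move=> x hx /=; rewrite /rep_tens_act mulmxDr mulmxDl !tensmx_mul.
by rewrite hA // hA' // !mulmx1 !mul1mx.
Qed.

(** The submodule [G] of the direct sum generated by [(v, w)] is the graph of an isomorphism. Its
    vectors of weight [k] are the multiples of [(v, w)], so it contains neither summand, and
    irreducibility makes both projections bijective. *)
Lemma irr_iso V W k v w : irreducible_rep V -> irreducible_rep W ->
  hw_vec (V := V) k v -> hw_vec (V := W) k w -> rep_iso V W.
Proof.
move=> irrV irrW hv hw; have [v0 wv kv] := hv; have [w0 ww kw] := hw.
have S x p q : rep_act (rep_sum V W) x *m col_mx p q =
    col_mx (rep_act V x *m p) (rep_act W x *m q).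
  by rewrite /= /rep_sum_act mul_block_col !mul0mx addr0 add0r.
have hvw : hw_vec (V := rep_sum V W) k (col_mx v w).
  split.
  - by apply: contraNneq v0 => /eqP; rewrite col_mx_eq0 => /andP[].
  - by move=> h; rewrite S wv ww scale_col_mx.
  - move=> i j ij; rewrite !S; have [-> ->] := kv i j ij; have [-> ->] := kw i j ij.
    by rewrite !col_mx0.
have rd := @rho_sdom C n.
pose G p q := cyc (V := rep_sum V W) (@rho_ C n) (col_mx v w) (col_mx p q).
have G0 : G 0 0 by rewrite /G col_mx0; exact: cyc0.
have Gvw : G v w by exact: cyc_gen.
have Gl (a : C) p q p' q' : G p q -> G p' q' -> G (a *: p + p') (a *: q + q').
  by rewrite /G -add_col_mx -scale_col_mx; apply: cyc_lin.
have Gs x p q : x \in so -> G p q -> G (rep_act V x *m p) (rep_act W x *m q).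
  by move=> hx; rewrite /G -S => g; apply: (cyc_stable rd hvw g).
have GB p q p' q' : G p q -> G p' q' -> G (p - p') (q - q').
  move=> g g'; rewrite ![_ - _]addrC -!(scaleN1r p') -!(scaleN1r q').
  exact: Gl.
(* If [G] contained the whole summand [W], then [(0, w)] would have the top weight without being a
   multiple of [(v, w)]. *)
have inj1 q : G 0 q -> q = 0.
  have [|||h|h] := irr_dichotomy (P := G 0) irrW.
  - exact: G0.
  - by move=> a q1 q2 g1 g2; have := Gl a _ _ _ _ g1 g2; rewrite scaler0 addr0.
  - by move=> q1 g1 x hx; have := Gs _ _ _ hx g1; rewrite mulmx0.
  - exact: h.
  have g0w : wt_vec (V := rep_sum V W) k (col_mx 0 w).
    by move=> y; rewrite S ww mulmx0 scale_col_mx scaler0.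
  have n0w : col_mx (0 : 'cV[C]_(rep_dim V)) w != 0.
    by rewrite col_mx_eq0 eqxx (negbTE w0).
  have [|[a]] := cyc_top hvw (h w) g0w n0w; first by rewrite ltxx.
  rewrite scale_col_mx => /eq_col_mx[/esym/eqP]; rewrite scaler_eq0 (negbTE v0) orbF.
  by move=> /eqP -> /eqP; rewrite scale0r (negbTE w0).
have inj2 p : G p 0 -> p = 0.
  have [|||h|h] := irr_dichotomy (P := fun p => G p 0) irrV.
  - exact: G0.
  - by move=> a q1 q2 g1 g2; have := Gl a _ _ _ _ g1 g2; rewrite scaler0 addr0.
  - by move=> q1 g1 x hx; have := Gs _ _ _ hx g1; rewrite mulmx0.
  - exact: h.
  have g0w : wt_vec (V := rep_sum V W) k (col_mx v 0).
    by move=> y; rewrite S wv mulmx0 scale_col_mx scaler0.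
  have n0w : col_mx v (0 : 'cV[C]_(rep_dim W)) != 0.
    by rewrite col_mx_eq0 eqxx (negbTE v0).
  have [|[a]] := cyc_top hvw (h v) g0w n0w; first by rewrite ltxx.
  rewrite scale_col_mx => /eq_col_mx[+ /esym/eqP]; rewrite scaler_eq0 (negbTE w0) orbF.
  by move=> + /eqP a0; rewrite a0 scale0r => /eqP; rewrite (negbTE v0).
have sur1 p : exists q, G p q.
  have [|||h|h] := irr_dichotomy (P := fun p => exists q, G p q) irrV.
  - by exists 0.
  - by move=> a p1 p2 [q1 g1] [q2 g2]; exists (a *: q1 + q2); apply: Gl.
  - by move=> p1 [q1 g1] x hx; exists (rep_act W x *m q1); apply: Gs.
  - by move: v0; rewrite (h v) ?eqxx //; exists w.
  - exact: h.
have sur2 q : exists p, G p q.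
  have [|||h|h] := irr_dichotomy (P := fun q => exists p, G p q) irrW.
  - by exists 0.
  - by move=> a p1 p2 [q1 g1] [q2 g2]; exists (a *: q1 + q2); apply: Gl.
  - by move=> p1 [q1 g1] x hx; exists (rep_act V x *m q1); apply: Gs.
  - by move: w0; rewrite (h w) ?eqxx //; exists v.
  - exact: h.
have Gsum (I : finType) (f : I -> C) p q : (forall i, G (p i) (q i)) ->
    G (\sum_i f i *: p i) (\sum_i f i *: q i).
  by move=> g; elim/big_rec2: _ => // i q1 p1 _ g1; apply: Gl.
have mulcE m d (A : 'M[C]_(m, d)) (p : 'cV[C]_d) : A *m p = \sum_i p i 0 *: col i A.
  by apply/matrixP=> i j; rewrite ord1 summxE mxE; apply: eq_bigr => l _; rewrite !mxE mulrC.
have idE d (p : 'cV[C]_d) : p = \sum_i p i 0 *: delta_mx i 0.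
  by rewrite {1}[p]matrix_sum_delta; apply: eq_bigr => i _; rewrite big_ord1.
(* Partners of the basis vectors are chosen in [G]; by linearity every [(p, A p)] and [(B q, q)]
   then lies in [G], and injectivity makes [A] and [B] mutually inverse. *)
have [fA hA] := fin_all_exists (fun i => sur1 (delta_mx i 0)).
have [fB hB] := fin_all_exists (fun i => sur2 (delta_mx i 0)).
pose A : 'M[C]_(rep_dim W, rep_dim V) := \matrix_(i, j) fA j i 0.
pose B : 'M[C]_(rep_dim V, rep_dim W) := \matrix_(i, j) fB j i 0.
have cA i : col i A = fA i by apply/matrixP=> a b; rewrite ord1 !mxE.
have cB i : col i B = fB i by apply/matrixP=> a b; rewrite ord1 !mxE.
have GA p : G p (A *m p) by rewrite {1}[p]idE mulcE; apply: Gsum => i; rewrite cA.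
have GBm q : G (B *m q) q by rewrite {2}[q]idE mulcE; apply: Gsum => i; rewrite cB.
have mxE' m d (X Y : 'M[C]_(m, d)) : (forall p : 'cV[C]_d, X *m p = Y *m p) -> X = Y.
  move=> h; apply/matrixP=> i j; have := h (delta_mx j 0).
  by rewrite -!colE => /matrixP/(_ i 0); rewrite !mxE.
exists A, B; split.
- apply: mxE' => q; rewrite mul1mx -mulmxA; apply/eqP; rewrite -subr_eq0; apply/eqP.
  by apply: inj1; have := GB _ _ _ _ (GA (B *m q)) (GBm q); rewrite subrr.
- apply: mxE' => p; rewrite mul1mx -mulmxA; apply/eqP; rewrite -subr_eq0; apply/eqP.
  by apply: inj2; have := GB _ _ _ _ (GBm (A *m p)) (GA p); rewrite subrr.
- move=> x hx; apply: mxE' => p; rewrite -!mulmxA; apply/eqP; rewrite -subr_eq0.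
  apply/eqP/inj1; have := GB _ _ _ _ (GA (rep_act V x *m p)) (Gs _ _ _ hx (GA p)).
  by rewrite subrr.
Qed.

End Iso.

(** * Unitary representations and the Weyl character formula *)

Section Adjoint.
Variable C : numClosedFieldType.

Definition adj m n (A : 'M[C]_(m, n)) : 'M[C]_(n, m) := (map_mx Num.conj A)^T.

Lemma adjK m n (A : 'M[C]_(m, n)) : adj (adj A) = A.
Proof. by apply/matrixP=> i j; rewrite !mxE conjCK. Qed.

Lemma adjM m n p (A : 'M[C]_(m, n)) (B : 'M_(n, p)) : adj (A *m B) = adj B *m adj A.
Proof. by rewrite /adj map_mxM trmx_mul. Qed.

Lemma adjB m n (A B : 'M[C]_(m, n)) : adj (A - B) = adj A - adj B.
Proof. by apply/matrixP=> i j; rewrite !mxE rmorphB. Qed.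

Lemma adj_sqnorm d (v : 'cV[C]_d) : (adj v *m v) 0 0 = \sum_i `|v i 0| ^+ 2.
Proof. by rewrite mxE; apply: eq_bigr => i _; rewrite !mxE normCKC. Qed.

Lemma adj_sqnorm_ge0 d (v : 'cV[C]_d) : 0 <= (adj v *m v) 0 0.
Proof. by rewrite adj_sqnorm sumr_ge0 // => i _; rewrite exprn_ge0. Qed.

Lemma adj_sqnorm_eq0 d (v : 'cV[C]_d) : (adj v *m v) 0 0 = 0 -> v = 0.
Proof.
rewrite adj_sqnorm => /eqP; rewrite psumr_eq0 => [/allP h|i _]; last by rewrite exprn_ge0.
apply/matrixP=> i j; rewrite ord1 mxE; have := h i (mem_index_enum _).
by rewrite /= expf_eq0 /= normr_eq0 => /eqP.
Qed.

(** With a basis of [U] as the columns of [B] and the Gram matrix [G = adj B *m B], the projector is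
    [B *m invmx G *m adj B]. The matrix [G] is invertible because [u *m G = 0] makes the norm of
    [B *m adj u] vanish. *)
Lemma orthogonal_projector d (U : {vspace 'cV[C]_d}) :
  exists P : 'M[C]_d, [/\ adj P = P, P *m P = P & forall v, v \in U <-> P *m v = v].
Proof.
pose B : 'M[C]_(d, \dim U) := \matrix_(i, j) (vbasis U)`_j i 0.
have BE (c : 'cV_(\dim U)) : B *m c = \sum_j c j 0 *: (vbasis U)`_j.
  apply/matrixP=> i j; rewrite ord1 summxE mxE; apply: eq_bigr => l _.
  by rewrite !mxE mulrC.
have BU v : v \in U <-> exists c, v = B *m c.
  split=> [vU|[c ->]]; last first.
    by rewrite BE; apply: memv_suml => j _; rewrite memvZ // vbasis_mem // mem_nth // size_tuple.
  exists (\col_j coord (vbasis U) j v); rewrite BE {1}(coord_vbasis vU).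
  by apply: eq_bigr => j _; rewrite mxE.
have Binj (c : 'cV_(\dim U)) : B *m c = 0 -> c = 0.
  rewrite BE => h; apply/matrixP=> j l; rewrite ord1 mxE.
  by have /freeP fr := basis_free (vbasisP U); exact: (fr (fun j => c j 0) h j).
pose G := adj B *m B.
have Gu : G \in unitmx.
  rewrite -row_free_unit -kermx_eq0; apply/eqP/row_matrixP=> i; rewrite row0.
  set u := row i _; have : u *m G = 0 by rewrite /u -row_mul mulmx_ker row0.
  move=> /(congr1 (fun X => X *m adj u)); rewrite mul0mx /G => uG.
  suff : adj u = 0 by move=> /(congr1 (@adj _ _)); rewrite adjK => ->; apply/matrixP=> a b; rewrite !mxE conjC0.
  apply: Binj; apply: adj_sqnorm_eq0; rewrite adjM adjK.
  by rewrite mulmxA -(mulmxA u) uG mxE.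
have Ga : adj G = G by rewrite /G adjM adjK.
have Gia : adj (invmx G) = invmx G.
  have : adj (invmx G) *m G = 1%:M.
    by rewrite -{2}Ga -adjM mulmxV //; apply/matrixP=> a b; rewrite !mxE conjC_nat eq_sym.
  by move=> /(congr1 (fun X => X *m invmx G)); rewrite mulmxK // mul1mx.
exists (B *m invmx G *m adj B); split.
- by rewrite !adjM adjK Gia mulmxA.
- by rewrite !mulmxA -(mulmxA (B *m invmx G) (adj B)) -/G mulmxKV.
- move=> v; split=> [/BU[c ->]|h].
    by rewrite -(mulmxA (B *m invmx G)) (mulmxA (adj B)) -[adj B *m B]/G -mulmxA mulKmx.
  by apply/BU; exists (invmx G *m adj B *m v); rewrite -{1}h !mulmxA.
Qed.

End Adjoint.

Section Unitary.
Variables (C : numClosedFieldType) (n : nat).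
Implicit Types (V W Q : so_rep C n).
Local Notation so := (@so C n).

(** Invariance of the standard Hermitian form under the compact real form, stated on the complex Lie
    algebra itself. *)
Definition unitary_rep V : Prop :=
  {in so, forall x, rep_act V (adj x) = adj (rep_act V x)}.

Definition inv_proj V (P : 'M[C]_(rep_dim V)) : Prop :=
  [/\ P *m P = P, adj P = P & rep_hom (V := V) (W := V) P].

(** Stability gives [P x P = x P]; the same identity for [adj x], after taking adjoints, gives
    [P x P = P x]. This is where complete reducibility enters. *)
Lemma stable_inv_proj V (U : {vspace 'cV[C]_(rep_dim V)}) : unitary_rep V ->
  {in so, forall x, {in U, forall v, rep_act V x *m v \in U}} ->
  exists P, inv_proj P /\ forall v, v \in U <-> P *m v = v.
Proof.
move=> uV sU; have [P [aP PP PU]] := orthogonal_projector U.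
exists P; split=> //; split=> //.
have S x : x \in so -> P *m rep_act V x *m P = rep_act V x *m P.
  move=> hx; apply/matrixP=> i j.
  pose v : 'cV[C]_(rep_dim V) := delta_mx j 0.
  have : P *m (rep_act V x *m (P *m v)) = rep_act V x *m (P *m v).
    by apply: (PU _).1; apply: sU => //; apply: (PU _).2; rewrite mulmxA PP.
  by rewrite !mulmxA -!colE => /matrixP/(_ i 0); rewrite ![col _ _ _ _]mxE.
move=> x hx; have := S _ (adj_so hx); rewrite -/(adj x) uV //.
move=> /(congr1 (@adj _ _ _)); rewrite !adjM !adjK aP => E.
by rewrite -E !mulmxA S.
Qed.

Lemma sub_rep_trace V (P : 'M[C]_(rep_dim V)) Q : sub_rep P Q -> \tr P = (rep_dim Q)%:R.
Proof. by move=> [B [L [LB BL _ _]]]; rewrite -BL mxtrace_mulC LB mxtrace1. Qed.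

Lemma sub_rep_dim0 V (P : 'M[C]_(rep_dim V)) Q : sub_rep P Q -> P != 0 -> (0 < rep_dim Q)%N.
Proof.
move=> [B [L [LB BL _ _]]]; apply: contraNltn => d0; rewrite -BL.
have -> : B = 0; last by rewrite mul0mx.
by apply/matrixP=> i [j hj]; have := leq_trans hj d0.
Qed.

Lemma inv_projB V (P P1 : 'M[C]_(rep_dim V)) : inv_proj P -> inv_proj P1 -> P *m P1 = P1 ->
  [/\ P1 *m P = P1, inv_proj (P - P1), P1 *m (P - P1) = 0 & (P - P1) *m P1 = 0].
Proof.
move=> [PP aP hP] [PP1 aP1 hP1] E.
have E' : P1 *m P = P1 by have /(congr1 (@adj _ _ _)) := E; rewrite adjM aP aP1.
split=> //.
- split; first by rewrite mulmxBr !mulmxBl PP E E' PP1 subrr subr0.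
    by rewrite adjB aP aP1.
  by move=> x hx; rewrite mulmxBl mulmxBr hP // hP1.
- by rewrite mulmxBr E' PP1 subrr.
- by rewrite mulmxBl E PP1 subrr.
Qed.

(** The rank of an idempotent is its trace, and the trace is additive. *)
Lemma sub_dim_split V (P P1 : 'M[C]_(rep_dim V)) Q Q1 Q2 :
  sub_rep P Q -> sub_rep P1 Q1 -> sub_rep (P - P1) Q2 ->
  rep_dim Q = (rep_dim Q1 + rep_dim Q2)%N.
Proof.
move=> s s1 s2; apply/eqP; rewrite -(@eqr_nat C) natrD -(sub_rep_trace s).
by rewrite -(sub_rep_trace s1) -(sub_rep_trace s2) raddfB /= addrC subrK.
Qed.

(** As long as the image is reducible, a proper submodule yields a nonzero invariant projector [P1]
    under [P]. Its image is smaller because [P - P1] is nonzero. *)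
Lemma irr_inv_proj V (P : 'M[C]_(rep_dim V)) : unitary_rep V -> inv_proj P -> P != 0 ->
  exists P1 Q1, [/\ inv_proj P1, P1 != 0, P *m P1 = P1, sub_rep P1 Q1 & irreducible_rep Q1].
Proof.
move=> uV pP P0; have [PP _ hP] := pP; have [Q sQ] := sub_rep_exists PP hP.
have [d] := ubnP (rep_dim Q); elim: d => // d IH in P pP P0 PP hP Q sQ *; rewrite ltnS => dQ.
case: (classic (irreducible_rep Q)) => [irr|nirr]; first by exists P, Q; split.
have [U [sU [U0 UT]]] : exists U : {vspace 'cV[C]_(rep_dim Q)},
    {in so, forall x, {in U, forall v, rep_act Q x *m v \in U}} /\ U <> 0%VS /\ U <> fullv.
  apply: NNPP => h; apply: nirr; split; first exact: sub_rep_dim0 sQ P0.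
  move=> U sU; case: (classic (U = 0%VS)) => [->|U0]; first by left.
  by case: (classic (U = fullv)) => [->|UT]; [right|case: h; exists U].
have [B [L [LB BL hB hL]]] := sQ.
have [U' hU'] : exists U' : {vspace 'cV[C]_(rep_dim V)},
    forall v, v \in U' <-> exists2 u, u \in U & v = B *m u.
  apply: subspace_comprehension; first by exists 0; rewrite ?mem0v ?mulmx0.
  move=> a u v [u1 h1 ->] [v1 h2 ->]; exists (a *: u1 + v1).
    by rewrite memvD ?memvZ.
  by rewrite mulmxDr scalemxAr.
have [|P1 [pP1 PU1]] := @stable_inv_proj V U' uV.
  move=> x hx v /hU'[u uU ->]; apply/hU'; exists (rep_act Q x *m u); first exact: sU.
  by rewrite !mulmxA hB.
have [PP1 aP1 hP1] := pP1.
have mxP m k (X Y : 'M[C]_(m, k)) : (forall p : 'cV[C]_k, X *m p = Y *m p) -> X = Y.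
  move=> h; apply/matrixP=> i j; have := h (delta_mx j 0).
  by rewrite -!colE => /matrixP/(_ i 0); rewrite !mxE.
have E1 : P *m P1 = P1.
  apply: mxP => v; have : P1 *m v \in U' by apply/PU1; rewrite mulmxA PP1.
  by move=> /hU'[u uU E]; rewrite -mulmxA E -BL -mulmxA (mulmxA L) LB mul1mx.
have P1n0 : P1 != 0.
  apply/eqP => P10; apply: U0; apply/eqP; rewrite -subv0; apply/subvP=> u uU.
  have /PU1 : B *m u \in U' by apply/hU'; exists u.
  rewrite P10 mul0mx => /esym/(congr1 (mulmx L)); rewrite mulmxA LB mul1mx mulmx0 => ->.
  exact: mem0v.
have P1nP : P - P1 != 0.
  apply/eqP => /eqP; rewrite subr_eq0 => /eqP PE; apply: UT; apply/eqP.
  rewrite eqEsubv subvf /=; apply/subvP=> u _.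
  have : B *m u \in U'.
    by apply/PU1; rewrite -PE -BL -mulmxA (mulmxA L) LB mul1mx.
  move=> /hU'[u' u'U /(congr1 (mulmx L))]; rewrite !mulmxA LB !mul1mx => ->; exact: u'U.
have [E1' pD _ _] := inv_projB pP pP1 E1.
have [Q1 s1] := sub_rep_exists PP1 hP1.
have [PPD _ hPD] := pD; have [Q2 s2] := sub_rep_exists PPD hPD.
have dd := sub_dim_split sQ s1 s2; have d2 := sub_rep_dim0 s2 P1nP.
have [|P2 [Q3 [p2 n2 E2 s3 i3]]] := IH P1 pP1 P1n0 PP1 hP1 Q1 s1.
  by apply: leq_trans dQ; rewrite dd -[X in (X < _)%N]addn0 ltn_add2l.
by exists P2, Q3; split=> //; rewrite -E2 mulmxA E1.
Qed.

End Unitary.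

(** * Euler operators and products over pairs of indices *)

Section Euler.
Variables (R : comNzRingType) (n : nat).
Implicit Types (s t : R) (i : 'I_n) (f g : {mpoly R[n]}).

(** The operator x_i d/dx_i on Laurent monomials that have been multiplied by x_i^s to become
    polynomials: it scales ['X_[m]] by [m i - s]. Shifts add under products ([eulM]). *)
Definition eul s i f : {mpoly R[n]} := 'X_i * f^`M(i) - s *: f.

Lemma eulD s i f g : eul s i (f + g) = eul s i f + eul s i g.
Proof. by rewrite /eul mderivD mulrDr scalerDr opprD addrACA. Qed.

Lemma eulZ s i (a : R) f : eul s i (a *: f) = a *: eul s i f.
Proof. by rewrite /eul mderivZ -scalerAr scalerBr !scalerA [s * a]mulrC. Qed.

Lemma eul_sum s i (I : Type) (r : seq I) (P : pred I) (F : I -> {mpoly R[n]}) :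
  eul s i (\sum_(j <- r | P j) F j) = \sum_(j <- r | P j) eul s i (F j).
Proof.
apply: (big_morph _ (eulD s i)).
by have := eulZ s i 0 0; rewrite !scale0r.
Qed.

Lemma eulX s i m : eul s i 'X_[m] = ((m i)%:R - s) *: 'X_[m].
Proof.
rewrite /eul mderivX -scalerAr scalerBl; congr (_ - _).
case: (eqVneq (m i) 0%N) => [->|mi]; first by rewrite !scale0r.
by rewrite -mpolyXD addmC submK // lep1mP.
Qed.

Lemma eul_coeff s i f m : (eul s i f)@_m = ((m i)%:R - s) * f@_m.
Proof.
rewrite {1 2}[f]mpolyE eul_sum !raddf_sum mulr_sumr; apply: eq_bigr => k _ /=.
rewrite eulZ eulX !mcoeffZ mcoeffX; case: eqVneq => [->|_]; rewrite ?mulr0 //.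
by rewrite !mulr1 mulrC.
Qed.

Lemma eulM s t i f g : eul (s + t) i (f * g) = eul s i f * g + f * eul t i g.
Proof.
rewrite /eul mderivM scalerDl mulrDr mulrBl mulrBr opprD.
rewrite -[in RHS]scalerAl -[in RHS]scalerAr.
have -> : 'X_i * (f * g^`M(i)) = f * ('X_i * g^`M(i)) by ring.
by rewrite !mulrA addrACA.
Qed.

Lemma eulDs s t i f : eul (s + t) i f = eul s i f - t *: f.
Proof. by rewrite /eul scalerDl opprD addrA. Qed.

End Euler.

Section LogDerivative.
Variables (R : comNzRingType).

Lemma derivation_prod (d : R -> R) (I : Type) (r : seq I) (P : pred I) (g w : I -> R) :
  (forall f h, d (f * h) = d f * h + f * d h) ->
  (forall s, P s -> d (g s) = g s * w s) ->
  d (\prod_(s <- r | P s) g s) = (\prod_(s <- r | P s) g s) * \sum_(s <- r | P s) w s.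
Proof.
move=> dM hd; elim/big_rec2: _ => [|s p q Ps IH].
  have /eqP := dM 1 1; rewrite !mulr1 mul1r -subr_eq0 opprD addrA subrr sub0r oppr_eq0.
  by rewrite mulr0 => /eqP.
by rewrite dM hd // IH; ring.
Qed.

End LogDerivative.

Section Pairs.
Variables (n : nat).

Definition pair_lt (s : 'I_n * 'I_n) : bool := (s.1 < s.2)%N.

Lemma big_pairs (T : Type) (idx : T) (op : Monoid.com_law idx) (F : 'I_n -> 'I_n -> T) :
  \big[op/idx]_i \big[op/idx]_j F i j =
  op (\big[op/idx]_i F i i) (\big[op/idx]_(s | pair_lt s) op (F s.1 s.2) (F s.2 s.1)).
Proof.
rewrite pair_big /= (bigID (fun s => s.1 == s.2)) /=; congr (op _ _).
  rewrite -(pair_big_dep xpredT (fun i j => i == j) (fun i j => F i j)) /=.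
  by apply: eq_bigr => i _; apply: big_pred1 => j; rewrite eq_sym.
rewrite (bigID (@pair_lt)) big_split /=; congr (op _ _).
  by apply: eq_bigl => -[i j]; rewrite /pair_lt /= -val_eqE neq_ltn /=; case: ltngtP.
have sK : involutive (fun s : 'I_n * 'I_n => (s.2, s.1)) by case.
rewrite (reindex_inj (inv_inj sK)) /=.
by apply: eq_bigl => -[i j]; rewrite /pair_lt /= -val_eqE neq_ltn /=; case: ltngtP.
Qed.

Lemma big_pair_bool (T : Type) (idx : T) (op : Monoid.com_law idx)
    (w : ('I_n * 'I_n) * bool -> T) :
  \big[op/idx]_(s | pair_lt s.1) w s =
  \big[op/idx]_(s | pair_lt s) op (w (s, false)) (w (s, true)).
Proof.
transitivity (\big[op/idx]_(s | pair_lt s) \big[op/idx]_(b : bool) w (s, b)).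
  rewrite pair_big_dep /=; apply: eq_big => [s|[s b] _] //; by rewrite andbT.
by apply: eq_bigr => s _; rewrite big_bool /= Monoid.mulmC.
Qed.

Lemma sum_pairs (V : nmodType) (F : 'I_n -> 'I_n -> V) :
  \sum_i \sum_j F i j = \sum_i F i i + \sum_(s | pair_lt s) (F s.1 s.2 + F s.2 s.1).
Proof. exact: big_pairs. Qed.

(** Each index belongs to n - 1 pairs. *)
Lemma sum_pairs_sym (V : zmodType) (h : 'I_n -> V) :
  \sum_(s | pair_lt s) (h s.1 + h s.2) = (\sum_i h i) *+ n.-1.
Proof.
have := sum_pairs (fun i j => h i); rewrite /=.
under eq_bigr do rewrite sumr_const card_ord.
rewrite sumrMnl => E; apply: (addrI (\sum_i h i)).
rewrite -E -mulrS; case: (posnP n) => [n0|n0]; last by rewrite prednK.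
by rewrite big1 ?mul0rn // => i; have := ltn_ord i; rewrite {2}n0.
Qed.

End Pairs.

Section WeylDenominator.
Variables (R : comNzRingType) (n : nat).

(** The boolean selects eps_i + eps_j or eps_i - eps_j. Each factor is e^(alpha/2) - e^(-alpha/2)
    times the square root of x_i x_j, so a pair contributes one surplus x_i x_j. *)
Definition gfac (s : ('I_n * 'I_n) * bool) : {mpoly R[n]} :=
  if s.2 then 'X_s.1.1 * 'X_s.1.2 - 1 else 'X_s.1.1 - 'X_s.1.2.

(** The Weyl denominator, multiplied by (x_1 ... x_n)^(n-1). *)
Definition weyl_den : {mpoly R[n]} := \prod_(s | pair_lt s.1) gfac s.

End WeylDenominator.

(** * The Casimir operator and its effect on characters *)

Section Weyl.
Variables (C : numClosedFieldType) (n : nat).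
Local Notation so := (@so C n).

Lemma lie_soF_opp (a b : 'I_(n + n)) : b != bar a -> lie (soF C a b) (soF C b a) = soF C a a - soF C b b.
Proof.
move=> ba; rewrite lie_soF ?soF_so //.
have ab : (a == bar b) = false by rewrite bar_sym eq_sym (negbTE ba).
congr (_ - _).
  rewrite (bigD1 a) //= big1 ?addr0 => [|c /negbTE ca].
    by rewrite !mxE !eqxx (negbTE ba) andbF subr0 scale1r.
  by rewrite !mxE ca (negbTE ba) andbF subr0 scale0r.
rewrite (bigD1 b) //= big1 ?addr0 => [|c /negbTE cb].
  by rewrite !mxE !eqxx ab andFb subr0 scale1r.
by rewrite !mxE cb ab andbF andFb subr0 scale0r.
Qed.

(** For half the trace form, [soF b a] is dual to [soF a b]; the factor 1/2 undoes the double
    counting of the spanning set. *)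
Definition casimir (V : so_rep C n) : 'M[C]_(rep_dim V) :=
  2^-1 *: \sum_a \sum_b rep_act V (soF C a b) *m rep_act V (soF C b a).

Lemma casimir_hom (V : so_rep C n) : rep_hom (V := V) (W := V) (casimir V).
Proof.
move=> x hx; rewrite /casimir -scalemxAl -scalemxAr; congr (_ *: _).
apply/esym/eqP; rewrite -subr_eq0 mulmx_sumr mulmx_suml -sumrB; apply/eqP.
pose F a b := rep_act V (soF C a b).
have Fl a b : rep_act V x *m F a b = F a b *m rep_act V x +
    (\sum_c x c a *: F c b - \sum_c x b c *: F a c).
  rewrite -[F a b]mulmx1 act_lie ?soF_so // !mulmx1; congr (_ + _).
  have m1 c : x c a *: soF C c b \in so by rewrite soZ ?soF_so.
  have m2 c : x b c *: soF C a c \in so by rewrite soZ ?soF_so.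
  rewrite (lie_soF _ _ hx) actD ?soN ?so_sum // actN ?so_sum //.
  rewrite !act_sum //.
  by congr (_ - _); apply: eq_bigr => c _; rewrite actZ ?soF_so.
have E a b : rep_act V x *m (F a b *m F b a) - (F a b *m F b a) *m rep_act V x =
   (\sum_c x c a *: (F c b *m F b a) - \sum_c x b c *: (F a c *m F b a)) +
   (\sum_c x c b *: (F a b *m F c a) - \sum_c x a c *: (F a b *m F b c)).
  rewrite mulmxA Fl mulmxDl -(mulmxA (F a b)) Fl mulmxDr -[F a b *m F b a *m _]mulmxA. set U := F a b *m (F b a *m _).
  rewrite -!(addrA U) [U + _]addrC subrK.
  rewrite addrC mulmxBl mulmxBr !mulmx_suml !mulmx_sumr.
  by congr (_ - _ + (_ - _)); apply: eq_bigr => c _; rewrite -?scalemxAl -?scalemxAr.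
under eq_bigr => a _ do rewrite mulmx_sumr mulmx_suml -sumrB.
under eq_bigr => a _ do under eq_bigr => b _ do rewrite E.
under eq_bigr => a _ do rewrite big_split /= !sumrB.
rewrite big_split /= !sumrB.
set A1 := \sum_i _; set A2 := \sum_i _; set A3 := \sum_i _; set A4 := \sum_i _.
(* After exchanging summation indices, the four sums of structure constants cancel in pairs. *)
have -> : A4 = A1.
  rewrite /A4 /A1 exchange_big [RHS]exchange_big /=; apply: eq_bigr => b _.
  by rewrite exchange_big.
have -> : A3 = A2.
  by rewrite /A3 /A2; apply: eq_bigr => a _; rewrite exchange_big.
by rewrite addrC addrA subrK subrr.
Qed.

Variables (V : so_rep C n) (N : nat) (e : 'I_(rep_dim V) -> 'X_{1..n}).
Local Notation F a b := (rep_act V (soF C a b)).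
Local Notation sg := (N%:R / 2 : C).
Local Notation lf := (lshift n).
Local Notation rt := (rshift n).

(** The exponent [e b] is the weight shifted by N/2. In the applications [N] counts spin factors, an
    exterior algebra counting as two. *)
Definition ewt b : 'I_n -> C := fun i => (e b i)%:R - N%:R / 2.

Definition diag_wt : Prop := forall h : 'rV[C]_n,
  rep_act V (cartan h) = diag_mx (\row_b pairing (ewt b) (h 0)).

Hypothesis dV : diag_wt.

Lemma pairing_delta (q : 'I_n -> C) i :
  pairing q ((delta_mx 0 i : 'rV[C]_n) 0) = q i.
Proof.
rewrite /pairing (bigD1 i) //= !mxE !eqxx mulr1 big1 ?addr0 // => j /negbTE ji.
by rewrite !mxE ji mulr0.
Qed.

Lemma entry_wt a b c d : F a b c d != 0 -> forall i,
  ewt c i - ewt d i = vwt (fun j => (j == i)%:R) a - vwt (fun j => (j == i)%:R) b.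
Proof.
move=> Fn i; have := rep_lie V (cartan_so (delta_mx 0 i)) (soF_so C a b).
rewrite lie_cartan actZ ?soF_so // dV => /matrixP/(_ c d).
rewrite /lie mul_diag_mx mul_mx_diag !mxE !pairing_delta => E.
have D x : vwt ((delta_mx 0 i : 'rV[C]_n) 0) x = vwt (fun j => (j == i)%:R) x.
  by case: (split_ordP x) => j ->; rewrite ?vwt_lshift ?vwt_rshift !mxE eqxx.
by apply: (mulIf Fn); rewrite mulrBl -!D E [ewt d i * _]mulrC.
Qed.

(** The trace of A e^h, multiplied by (x_1 ... x_n)^(N/2). At an invariant projector it is the
    character of the corresponding summand. *)
Definition chi (A : 'M[C]_(rep_dim V)) : {mpoly C[n]} := \sum_b A b b *: 'X_[e b].

Lemma chiD A B : chi (A + B) = chi A + chi B.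
Proof. by rewrite -big_split; apply: eq_bigr => b _; rewrite mxE scalerDl. Qed.

Lemma chiZ t A : chi (t *: A) = t *: chi A.
Proof. by rewrite scaler_sumr; apply: eq_bigr => b _; rewrite mxE scalerA. Qed.

Lemma chiB A B : chi (A - B) = chi A - chi B.
Proof. by rewrite chiD -scaleN1r chiZ scaleN1r. Qed.

Lemma chi_sum (I : Type) (r : seq I) (P : pred I) (f : I -> 'M[C]_(rep_dim V)) :
  chi (\sum_(i <- r | P i) f i) = \sum_(i <- r | P i) chi (f i).
Proof.
apply: (big_morph _ chiD).
by have := chiZ 0 0; rewrite !scale0r.
Qed.

(** The twisted trace property: a root vector A shifts weights by w - u. *)
Lemma chi_comm (A B : 'M[C]_(rep_dim V)) (u w : 'X_{1..n}) :
  (forall a b, A a b != 0 -> (e a + u)%MM = (e b + w)%MM) ->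
  'X_[u] * chi (A *m B) = 'X_[w] * chi (B *m A).
Proof.
move=> h; rewrite /chi !mulr_sumr.
under eq_bigr do rewrite mxE scaler_suml mulr_sumr.
under [RHS]eq_bigr do rewrite mxE scaler_suml mulr_sumr.
rewrite exchange_big /=; apply: eq_bigr => b _; apply: eq_bigr => a _.
rewrite -!scalerAr -!mpolyXD [B b a * _]mulrC.
case: (eqVneq (A a b) 0) => [->|/h]; first by rewrite mul0r !scale0r.
by rewrite ![(_ + e _)%MM]addmC => ->.
Qed.

Definition Hd i := F (lf i) (lf i).

Lemma chi_Hd (A : 'M[C]_(rep_dim V)) i : chi (A *m Hd i) = eul sg i (chi A).
Proof.
rewrite /Hd soF_lshift dV mul_mx_diag /chi eul_sum; apply: eq_bigr => b _.
by rewrite eulZ eulX !mxE pairing_delta scalerA.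
Qed.

Section Invariant.
Variable P : 'M[C]_(rep_dim V).
Hypothesis hP : rep_hom (V := V) (W := V) P.

Definition Tsub i j := chi (P *m (F (lf j) (lf i) *m F (lf i) (lf j))).
Definition Tadd i j := chi (P *m (F (rt j) (lf i) *m F (lf i) (rt j))).

Lemma FF_opp a b : b != bar a ->
  F a b *m F b a = F b a *m F a b + (F a a - F b b).
Proof.
move=> ba; rewrite -[F b a]mulmx1 act_lie ?soF_so // !mulmx1; congr (_ + _).
by rewrite lie_soF_opp // actD ?actN ?soN ?soF_so.
Qed.

Lemma PFF a b : P *m (F a b *m F b a) = F a b *m (P *m F b a).
Proof. by rewrite !mulmxA hP ?soF_so. Qed.

Lemma ewt_eq (m1 m2 : 'X_{1..n}) b c :
  (forall i, ewt b i - ewt c i = (m2 i)%:R - (m1 i)%:R) -> (e b + m1)%MM = (e c + m2)%MM.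
Proof.
move=> h; apply/mnmP=> i; rewrite !mnmDE; apply/eqP; rewrite -(@eqr_nat C) !natrD.
by have := h i; rewrite /ewt => E; rewrite -subr_eq0; apply/eqP; move: E; 
  move/eqP; rewrite -subr_eq0 => /eqP <-; ring.
Qed.

(** Moving one root vector around the trace costs a monomial, and commuting it back adds the coroot.
    The result is a linear equation for the contribution of the root, whose coefficient is the
    factor of the Weyl denominator belonging to that root; [Tadd_eq] does the same for eps_i +
    eps_j. *)
Lemma Tsub_eq i j : i != j ->
  ('X_i - 'X_j) * Tsub i j = 'X_j * (eul sg i (chi P) - eul sg j (chi P)).
Proof.
move=> ij; have ne : lf j != bar (lf i) by rewrite bar_lshift eq_lrshift.
have K a b : F (lf i) (lf j) a b != 0 -> (e a + U_(j))%MM = (e b + U_(i))%MM.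
  move=> /entry_wt h; apply: ewt_eq => l; rewrite h !vwt_lshift !mnm1E; congr (_%:R - _%:R).
have := chi_comm (P *m F (lf j) (lf i)) K; rewrite -PFF FF_opp // mulmxDr mulmxBr.
rewrite chiD chiB -/(Hd i) -/(Hd j) !chi_Hd -mulmxA -/(Tsub i j) => E.
by rewrite mulrBl -E mulrDr addrC addKr.
Qed.

Lemma Tadd_eq i j : i != j ->
  ('X_i * 'X_j - 1) * Tadd i j = eul sg i (chi P) + eul sg j (chi P).
Proof.
move=> ij; have ne : rt j != bar (lf i) by rewrite bar_lshift eq_rshift eq_sym.
have K a b : F (lf i) (rt j) a b != 0 -> (e a + 0)%MM = (e b + (U_(i) + U_(j)))%MM.
  move=> /entry_wt h; apply: ewt_eq => l; rewrite h vwt_lshift vwt_rshift mnm0E mnmDE.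
  by rewrite !mnm1E natrD opprK subr0.
have := chi_comm (P *m F (rt j) (lf i)) K; rewrite -PFF FF_opp // mulmxDr mulmxBr.
have -> : F (rt j) (rt j) = - Hd j.
  by rewrite -bar_lshift soF_bar actN ?soF_so.
rewrite mulmxN opprK.
rewrite !chiD -/(Hd i) !chi_Hd -mulmxA -/(Tadd i j) mpolyX0 mul1r mpolyXD => E.
by rewrite mulrBl mul1r -E addrC addKr.
Qed.

Lemma casimir_pairs : casimir V = \sum_i Hd i *m Hd i +
  \sum_(s | pair_lt s)
     ((F (lf s.1) (lf s.2) *m F (lf s.2) (lf s.1) + F (lf s.2) (lf s.1) *m F (lf s.1) (lf s.2))
    + (F (lf s.1) (rt s.2) *m F (rt s.2) (lf s.1) + F (rt s.2) (lf s.1) *m F (lf s.1) (rt s.2))).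
Proof.
have Fb a b : F (bar a) (bar b) = - F b a by rewrite soF_bar actN ?soF_so.
have Fb1 i j : F (rt i) (rt j) = - F (lf j) (lf i) by rewrite -!bar_lshift Fb.
have Fb2 i j : F (lf j) (rt i) = - F (lf i) (rt j).
  by rewrite -[lf j]bar_rshift -(bar_lshift i) Fb.
have Fb3 i j : F (rt j) (lf i) = - F (rt i) (lf j).
  by rewrite -[lf i]bar_rshift -(bar_lshift j) Fb.
have -> : casimir V = 2^-1 *: \sum_i \sum_j
   ((F (lf i) (lf j) *m F (lf j) (lf i) *+ 2) +
    (F (lf i) (rt j) *m F (rt j) (lf i) + F (rt j) (lf i) *m F (lf i) (rt j))).
  rewrite /casimir; congr (_ *: _); rewrite big_split_ord /=.
  under eq_bigr do rewrite big_split_ord /=.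
  under [X in _ + X]eq_bigr do rewrite big_split_ord /=.
  rewrite !big_split /=.
  under [X in _ = X]eq_bigr do rewrite !big_split /=.
  rewrite !big_split /=.
  have -> : \sum_i \sum_j F (rt i) (rt j) *m F (rt j) (rt i) =
     \sum_i \sum_j F (lf i) (lf j) *m F (lf j) (lf i).
    rewrite exchange_big /=; apply: eq_bigr => i _; apply: eq_bigr => j _.
    by rewrite !Fb1 mulmxN mulNmx opprK.
  have -> : \sum_i \sum_j F (rt i) (lf j) *m F (lf j) (rt i) =
     \sum_i \sum_j F (rt j) (lf i) *m F (lf i) (rt j).
    by rewrite exchange_big.
  by rewrite [X in _ + X = _]addrC addrACA.
rewrite sum_pairs scalerDr; congr (_ + _).
  rewrite scaler_sumr; apply: eq_bigr => i _.
  rewrite -{4}(bar_lshift i) -{1}(bar_lshift i) soF_abar act0 mul0mx mulmx0 !addr0.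
  by rewrite -scaler_nat scalerA mulVf ?pnatr_eq0 // scale1r.
rewrite scaler_sumr; apply: eq_bigr => -[i j] _ /=.
rewrite [F (lf j) (rt i)]Fb2 [F (rt i) (lf j)]Fb3 !mulmxN !mulNmx !opprK.
rewrite addrACA -mulrnDl -mulr2n -mulrnDl -scaler_nat scalerA mulVf ?pnatr_eq0 //.
by rewrite scale1r.
Qed.

(** Ordering every product as lowering times raising produces the coroots of eps_i - eps_j and eps_i
    + eps_j. Their sum is twice the i-th Cartan element, hence the lone index [s.1]. *)
Lemma chi_casimir : chi (P *m casimir V) =
  \sum_i eul sg i (eul sg i (chi P)) +
  \sum_(s | pair_lt s) (Tsub s.1 s.2 + Tadd s.1 s.2 + eul sg s.1 (chi P)) *+ 2.
Proof.
rewrite casimir_pairs mulmxDr !mulmx_sumr chiD !chi_sum; congr (_ + _).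
  by apply: eq_bigr => i _; rewrite mulmxA !chi_Hd.
apply: eq_bigr => -[i j]; rewrite /pair_lt /= => ij.
have n1 : lf j != bar (lf i) by rewrite bar_lshift eq_lrshift.
have n2 : rt j != bar (lf i) by rewrite bar_lshift eq_rshift -val_eqE /= gtn_eqF.
rewrite (FF_opp n1) (FF_opp n2) !mulmxDr !chiD -/(Tsub i j) -/(Tadd i j).
have -> : F (rt j) (rt j) = - Hd j by rewrite -bar_lshift soF_bar actN ?soF_so.
rewrite opprK mulmxN -[- (P *m _)]scaleN1r chiZ -/(Hd i) -/(Hd j) !chi_Hd.
by rewrite scaleN1r; ring.
Qed.

Local Notation weyl_den := (weyl_den C n).

(** The derivation [d] along the gradient of [chi P] has a logarithmic derivative on each factor of
    the denominator, which [Tsub_eq] and [Tadd_eq] express through the contribution of the root. The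
    shift n - 1 then subtracts [h i + h j] for every pair. *)
Lemma den_chi_gradient :
  \sum_i eul n.-1%:R i weyl_den * eul sg i (chi P) =
  weyl_den * \sum_(s | pair_lt s) (Tsub s.1 s.2 + Tadd s.1 s.2 + eul sg s.1 (chi P)).
Proof.
pose h i := eul sg i (chi P).
pose d (f : {mpoly C[n]}) := \sum_i eul 0 i f * h i.
have dM f g : d (f * g) = d f * g + f * d g.
  rewrite /d mulr_suml mulr_sumr -big_split; apply: eq_bigr => i _ /=.
  by rewrite -[0 : C]addr0 eulM addr0; ring.
have dX i : d 'X_i = 'X_i * h i.
  rewrite /d (bigD1 i) //= big1 ?addr0 => [|j ji].
    by rewrite eulX subr0 mnm1E eqxx scale1r.
  by rewrite eulX mnm1E eq_sym (negbTE ji) subrr scale0r mul0r.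
have dB f g : d (f - g) = d f - d g.
  by rewrite /d -sumrB; apply: eq_bigr => i _; rewrite -scaleN1r eulD eulZ scaleN1r mulrBl.
have d1 : d 1 = 0.
  by have /eqP := dM 1 1; rewrite !mulr1 mul1r -subr_eq0 opprD addrA subrr sub0r oppr_eq0 => /eqP.
pose w (s : ('I_n * 'I_n) * bool) := if s.2 then h s.1.1 + h s.1.2 + Tadd s.1.1 s.1.2
  else h s.1.1 + Tsub s.1.1 s.1.2.
have dD : d weyl_den = weyl_den * \sum_(s | pair_lt s.1) w s.
  apply: derivation_prod => // -[[i j] []]; rewrite /pair_lt /gfac /w /= => ij;
    have nij : i != j by rewrite -val_eqE neq_ltn ij.
    by rewrite dB d1 dM !dX [X in _ = X]mulrDr (Tadd_eq nij) -/(h i) -/(h j); ring.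
  by rewrite dB !dX [X in _ = X]mulrDr (Tsub_eq nij) -/(h i) -/(h j); ring.
have -> : \sum_i eul n.-1%:R i weyl_den * h i = d weyl_den - (weyl_den * (\sum_i h i) *+ n.-1).
  rewrite /d -mulrnAr -sum_pairs_sym sum_pairs_sym -scaler_nat -scalerAr mulr_sumr.
  rewrite scaler_sumr -sumrB; apply: eq_bigr => i _.
  by rewrite -[n.-1%:R]add0r eulDs add0r mulrBl -scalerAl.
rewrite dD -mulrnAr -sum_pairs_sym -mulrBr; congr (_ * _).
rewrite big_pair_bool /= -sumrB; apply: eq_bigr => s _; rewrite /w /=.
by rewrite -/(h s.1); ring.
Qed.

(** Product rule for the Laplacian: by [den_chi_gradient] its cross term is the denominator times
    the root part of the Casimir operator, so only eigenvalues remain. *)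
Lemma laplace_den_chi (R c : C) :
  \sum_i eul n.-1%:R i (eul n.-1%:R i weyl_den) = R *: weyl_den ->
  P *m casimir V = c *: P ->
  \sum_i eul (n.-1%:R + sg) i (eul (n.-1%:R + sg) i (weyl_den * chi P)) =
  (R + c) *: (weyl_den * chi P).
Proof.
move=> hR hc; have := chi_casimir; rewrite hc chiZ => E.
rewrite scalerDl scalerAl -hR scalerAr E mulrDr.
rewrite sumrMnl mulrnAr -den_chi_gradient.
move: (chi P) => X; move: weyl_den => D.
rewrite -sumrMnl mulr_suml mulr_sumr -!big_split; apply: eq_bigr => i _ /=.
by rewrite eulM eulD !eulM; ring.
Qed.

End Invariant.

End Weyl.

(** * The Weyl denominator as a determinant *)

Section Vandermonde.

Lemma det_size_poly (R : comNzRingType) n (y : 'I_n -> R) (p : 'I_n -> {poly R}) :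
  (forall i, size (p i) <= i.+1)%N ->
  \det (\matrix_(i, j) (p i).[y j]) =
  (\prod_i (p i)`_i) * \prod_(s | pair_lt s) (y s.2 - y s.1).
Proof.
move=> hp; have -> : \matrix_(i, j) (p i).[y j] =
    (\matrix_(i < n, k < n) (p i)`_k) *m Vandermonde n (\row_j y j).
  apply/matrixP=> i j; rewrite !mxE (@horner_coef_wide _ n); last first.
    exact: leq_trans (hp i) (ltn_ord i).
  by apply: eq_bigr => k _; rewrite !mxE.
rewrite det_mulmx det_Vandermonde det_trig; last first.
  apply/is_trig_mxP => i j ij; rewrite mxE nth_default //.
  exact: leq_trans (hp i) ij.
congr (_ * _); first by apply: eq_bigr => i _; rewrite mxE.
rewrite pair_big_dep /=; apply: eq_big => [s|s _] //; by rewrite !mxE.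
Qed.

Lemma prod_pairs (K : fieldType) n (w : 'I_n -> K) : (forall i, w i != 0) ->
  \prod_(s | pair_lt s) (w s.1 * w s.2) = \prod_i (w i) ^+ n.-1.
Proof.
move=> w0; have := big_pairs (idx := 1) *%R (fun i j => w i); rewrite /=.
under eq_bigr do rewrite prodr_const card_ord.
move=> E; apply: (mulfI (x := \prod_i w i)); first by apply/prodf_neq0 => i _.
rewrite -E -big_split /=; apply: eq_bigr => i _; rewrite -exprS prednK //.
exact: leq_ltn_trans (ltn_ord i).
Qed.

Lemma det_hom_Vandermonde_field (K : fieldType) n (v w : 'I_n -> K) : (forall i, w i != 0) ->
  \det (\matrix_(i < n, j < n) (v j ^+ i * w j ^+ (n.-1 - i))) =
  \prod_(s | pair_lt s) (v s.2 * w s.1 - v s.1 * w s.2).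
Proof.
move=> w0; have -> : \matrix_(i < n, j < n) (v j ^+ i * w j ^+ (n.-1 - i)) =
   (\matrix_(i < n, j < n) ('X^i).[v j / w j]) *m diag_mx (\row_j (w j) ^+ n.-1).
  apply/matrixP=> i j; rewrite mul_mx_diag !mxE hornerXn expr_div_n -mulrA; congr (_ * _).
  have in1 : (i <= n.-1)%N by have := ltn_ord i; lia.
  by rewrite -{2}(subnK in1) exprD [X in _ = _ * X]mulrC mulKf ?expf_neq0.
rewrite det_mulmx det_diag det_size_poly => [|i]; last by rewrite size_polyXn.
rewrite big1 ?mul1r => [|i _]; last by rewrite coefXn eqxx.
under [X in _ * X]eq_bigr do rewrite mxE.
rewrite -prod_pairs // -big_split /=; apply: eq_bigr => s _.
by field; rewrite !w0.
Qed.

(** In the fraction field the columns can be divided by powers of [w j], which leaves an ordinary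
    Vandermonde determinant. *)
Lemma det_hom_Vandermonde (R : idomainType) n (v w : 'I_n -> R) : (forall i, w i != 0) ->
  \det (\matrix_(i < n, j < n) (v j ^+ i * w j ^+ (n.-1 - i))) =
  \prod_(s | pair_lt s) (v s.2 * w s.1 - v s.1 * w s.2).
Proof.
move=> w0; apply/eqP; rewrite -tofrac_eq; apply/eqP.
rewrite -det_map_mx rmorph_prod.
have := @det_hom_Vandermonde_field {fraction R} n (fun i => tofrac (v i)) (fun i => tofrac (w i)).
set D := \prod_(s | _) _ => E.
rewrite [RHS](_ : _ = D); last by apply: eq_bigr => s _; rewrite rmorphB !rmorphM.
rewrite -E => [|i]; last by rewrite tofrac_eq0.
by congr (\det _); apply/matrixP=> i j; rewrite !mxE rmorphM !rmorphXn.
Qed.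

End Vandermonde.

(** * Polynomials in x + 1/x and the denominator *)

Section Homogenize.
Variables (R : idomainType).
Implicit Types p : {poly R}.

(** [x^N p(x + 1/x)] *)
Definition recip N p : {poly R} := \sum_(k < N.+1) p`_k *: (('X^2 + 1) ^+ k * 'X^(N - k)).

Lemma recipD N p q : recip N (p + q) = recip N p + recip N q.
Proof. by rewrite -big_split; apply: eq_bigr => k _; rewrite coefD scalerDl. Qed.

Lemma recipZ N (a : R) p : recip N (a *: p) = a *: recip N p.
Proof. by rewrite scaler_sumr; apply: eq_bigr => k _; rewrite coefZ scalerA. Qed.

Lemma recipC N (a : R) : recip N a%:P = a *: 'X^N.
Proof.
rewrite /recip big_ord_recl big1 => [|k _]; first by rewrite coefC /= expr0 mul1r subn0 addr0.
by rewrite coefC /= scale0r.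
Qed.

Lemma recipX N p : (size p <= N)%N -> 'X * recip N ('X * p) = ('X^2 + 1) * recip N p.
Proof.
move=> sp; rewrite /recip big_ord_recl coefXM eqxx scale0r add0r !mulr_sumr.
rewrite [RHS]big_ord_recr /= [p`_N]nth_default // scale0r mulr0 addr0.
apply: eq_bigr => k _; rewrite coefXM /= -!scalerAr; congr (_ *: _).
have -> : (N - k = (N - k.+1).+1)%N by have := ltn_ord k; lia.
by rewrite /bump /= add1n !exprS; ring.
Qed.

Lemma recip_lin N (a b : R) p : (size p <= N)%N ->
  'X * recip N ((a *: 'X + b%:P) * p) = (a *: ('X^2 + 1) + b *: 'X) * recip N p.
Proof.
move=> sp; rewrite mulrDl recipD mulrDr -scalerAl recipZ -scalerAr recipX //.
by rewrite mul_polyC recipZ -scalerAr [RHS]mulrDl -!scalerAl.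
Qed.

(** A Chebyshev polynomial: x^i + x^(-i) in terms of y = x + 1/x, from the recurrence p_(i+1) = y
    p_i - p_(i-1). For [i = 0] the value is 1 instead of 2, which keeps the polynomial monic. *)
Lemma cheb_exists i : exists p : {poly R}, [/\ (size p <= i.+1)%N, p`_i = 1 &
  forall N, (i <= N)%N -> recip N p = if i is 0 then 'X^N else 'X^(N + i) + 'X^(N - i)].
Proof.
suff : exists (p q : {poly R}), [/\ (size p <= i.+2)%N, p`_i.+1 = 1,
     forall N, (i.+1 <= N)%N -> recip N p = 'X^(N + i.+1) + 'X^(N - i.+1) &
     [/\ (size q <= i.+1)%N, (0 < i)%N -> q`_i = 1 &
     forall N, (i <= N)%N -> recip N q = 'X^(N + i) + 'X^(N - i)]].
  move=> [p [q [_ _ _ [h1 h2 h3]]]]; case: i h1 h2 h3 => [|i] h1 h2 h3; last first.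
    by exists q; split=> //; exact: h2.
  exists 1; split; rewrite ?size_poly1 ?coef1 // => N _.
  by rewrite -[1]/(1%:P) recipC scale1r.
elim: i => [|i [p [q [hp p1 hN [hq q1 hN']]]]].
  (* The recurrence has to start from 2 and y; because of this 2 the leading coefficient of [q] is
     asserted only for positive [i]. *)
  exists 'X, 2%:P; split; rewrite ?size_polyX ?coefX //.
    move=> N N0; apply: (mulfI (x := 'X)); first by rewrite polyX_eq0.
    rewrite -{2}['X]mulr1 recipX ?size_poly1 // -[1]/(1%:P) recipC scale1r.
    by rewrite mulrDr mulrDl mul1r -!exprS -exprD; congr ('X^_ + 'X^_); lia.
  split; rewrite ?size_polyC //; first by case: (_ == _).
  by move=> N _; rewrite recipC addn0 subn0 scaler_nat mulr2n.
exists ('X * p - q), p; split.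
- rewrite (leq_trans (size_polyD _ _)) // geq_max size_polyN.
  rewrite (leq_trans (size_mul_leq _ _)) ?size_polyX //=.
  by apply: leq_trans hq _; rewrite ltnW.
- by rewrite coefB coefXM /= p1 [q`_ _]nth_default ?subr0 //; exact: leq_trans hq (leqnSn _).
- move=> N hn; apply: (mulfI (x := 'X)); first by rewrite polyX_eq0.
  rewrite -scaleN1r recipD recipZ scaleN1r mulrBr recipX ?hN ?hN'; try lia.
  rewrite !mulrDr !mulrDl !mul1r -!exprS -!exprD opprD.
  have -> : (2 + (N + i.+1) = (N + i.+2).+1)%N by lia.
  have -> : (2 + (N - i.+1) = (N - i).+1)%N by lia.
  have -> : (N + i.+1 = (N + i).+1)%N by lia.
  have -> : ((N - i.+1) = (N - i.+2).+1)%N by lia.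
  by ring.
- by split=> // N hN1; apply: hN; lia.
Qed.

End Homogenize.

Section DenDet.
Variables (R : idomainType) (n : nat).

Definition mev (q : {poly R}) (i : 'I_n) : {mpoly R[n]} := (map_poly (@mpolyC n R) q).['X_i].

Lemma mevM q1 q2 i : mev (q1 * q2) i = mev q1 i * mev q2 i.
Proof. by rewrite /mev rmorphM hornerM. Qed.

(** The homogenised difference of the nodes x + 1/x is (x_b^2 + 1) x_a - (x_a^2 + 1) x_b = (x_b -
    x_a)(x_a x_b - 1), so a Vandermonde determinant gives the denominator. Reversing the columns
    produces the signs of [gfac]. *)
Lemma den_det (p : 'I_n -> {poly R}) : (forall i, size (p i) <= i.+1)%N ->
  \det (\matrix_(i, j) mev (recip n.-1 (p i)) (rev_ord j)) =
  (\prod_i (p i)`_i) *: weyl_den R n.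
Proof.
move=> hp.
pose v (j : 'I_n) : {mpoly R[n]} := 'X_(rev_ord j) ^+ 2 + 1.
pose w (j : 'I_n) : {mpoly R[n]} := 'X_(rev_ord j).
have -> : \matrix_(i, j) mev (recip n.-1 (p i)) (rev_ord j) =
   (\matrix_(i < n, k < n) ((p i)`_k)%:MP) *m (\matrix_(i < n, j < n) (v j ^+ i * w j ^+ (n.-1 - i))).
  apply/matrixP=> i j; rewrite !mxE /mev /recip rmorph_sum horner_sum /=.
  rewrite prednK; last by exact: leq_ltn_trans (ltn_ord i).
  apply: eq_bigr => k _; rewrite !mxE map_polyZ hornerZ rmorphM !rmorphXn rmorphD rmorphXn.
  by rewrite rmorph1 /= map_polyX !(hornerM, hornerXn, horner_exp, hornerD, hornerX, hornerC).
rewrite det_mulmx det_hom_Vandermonde; last first.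
  by move=> i; rewrite /w -msize_poly_eq0 msizeX.
rewrite det_trig; last first.
  apply/is_trig_mxP => i j ij; rewrite mxE nth_default ?mpolyC0 //.
  exact: leq_trans (hp i) ij.
under [X in X * _]eq_bigr do rewrite mxE.
rewrite -rmorph_prod mul_mpolyC; congr (_ *: _).
rewrite /weyl_den big_pair_bool /=.
have rK : involutive (fun s : 'I_n * 'I_n => (rev_ord s.2, rev_ord s.1)).
  by case=> a b; rewrite /= !rev_ordK.
rewrite [RHS](reindex_inj (inv_inj rK)) /=; apply: eq_big => [[a b]|[a b] _].
  rewrite /pair_lt /=; have := ltn_ord a; have := ltn_ord b; lia.
by rewrite /gfac /v /w /=; ring.
Qed.

Lemma mev_coeff (q : {poly R}) i B : (size q <= B)%N ->
  mev q i = \sum_(k < B) q`_k *: 'X_[U_(i) *+ k].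
Proof.
move=> hB; rewrite /mev (@horner_coef_wide _ B); last first.
  by apply: leq_trans hB; exact: size_poly.
by apply: eq_bigr => k _; rewrite coef_map /= mul_mpolyC -mpolyXn.
Qed.

Lemma coef_prod_mev (Q : 'I_n -> {poly R}) (m : 'X_{1..n}) :
  (\prod_i mev (Q i) i)@_m = \prod_i (Q i)`_(m i).
Proof.
pose B := (\max_i size (Q i) + mdeg m).+1.
have sB i : (size (Q i) <= B)%N.
  by apply: leqW; apply: leq_trans (leq_addr _ _); exact: (leq_bigmax i).
have mB i : (m i < B)%N.
  rewrite ltnS; apply: leq_trans (leq_addl _ _).
  by rewrite mdegE (bigD1 i) //= leq_addr.
under eq_bigr do rewrite (mev_coeff _ (sB _)).
rewrite bigA_distr_bigA /= raddf_sum /=.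
pose g0 : {ffun 'I_n -> 'I_B} := [ffun i => Ordinal (mB i)].
have E (g : {ffun 'I_n -> 'I_B}) :
    \prod_i ((Q i)`_(g i) *: 'X_[U_(i) *+ g i] : {mpoly R[n]}) =
    (\prod_i (Q i)`_(g i)) *: 'X_[[multinom (g i : nat) | i < n]].
  rewrite scaler_prod; congr (_ *: _); rewrite mprodXE; congr mpolyX.
  apply/mnmP=> i; rewrite mnm_sumE mnmE (bigD1 i) //= big1 ?addn0.
    by rewrite mulmnE mnm1E eqxx mul1n.
  by move=> j /negbTE ji; rewrite mulmnE mnm1E ji mul0n.
rewrite (bigD1 g0) //= [X in _ + X]big1 ?addr0 => [|g ng].
  rewrite E mcoeffZ mcoeffX [_ == m](_ : _ = true) ?mulr1.
    by apply: eq_bigr => i _; rewrite ffunE.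
  by apply/eqP/mnmP=> i; rewrite mnmE ffunE.
rewrite E mcoeffZ mcoeffX; case: eqP => [gm|]; last by rewrite mulr0.
case/eqP: ng; apply/ffunP=> i; rewrite ffunE; apply/val_inj.
by rewrite /= -gm mnmE.
Qed.

Lemma coef_prod_mev_perm (Q : 'I_n -> {poly R}) (m : 'X_{1..n}) (f : 'I_n -> 'I_n) :
  injective f -> (\prod_i mev (Q i) (f i))@_m = \prod_i (Q i)`_(m (f i)).
Proof.
move=> fi; have [g fg gf] := injF_bij fi.
rewrite [X in X@__](reindex_inj (can_inj gf)) [RHS](reindex_inj (can_inj gf)) /=.
under eq_bigr do rewrite gf.
by rewrite (coef_prod_mev (fun j => Q (g j))); apply: eq_bigr => j _; rewrite gf.
Qed.

Lemma coef_det_mev (Q : 'I_n -> {poly R}) (m : 'X_{1..n}) :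
  (\det (\matrix_(i, j) mev (Q i) (rev_ord j)))@_m =
  \det (\matrix_(i, j) (Q i)`_(m (rev_ord j))).
Proof.
rewrite /determinant raddf_sum; apply: eq_bigr => s _ /=.
under eq_bigr do rewrite mxE.
under [X in _ = _ * X]eq_bigr do rewrite mxE.
case: (odd_perm s); rewrite ?expr1 ?expr0.
  rewrite !mulN1r raddfN /= (@coef_prod_mev_perm _ _ (fun i => rev_ord (s i))) //.
  by move=> i j /rev_ord_inj/perm_inj.
rewrite !mul1r (@coef_prod_mev_perm _ _ (fun i => rev_ord (s i))) //.
by move=> i j /rev_ord_inj/perm_inj.
Qed.

(** Column [j] of the determinant involves a single variable. It can absorb the factor [f] in that
    variable, and the coefficient is then taken entry by entry. *)
Lemma den_mul_coeff (p : 'I_n -> {poly R}) (f : {poly R}) (m : 'X_{1..n}) :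
  (forall i, size (p i) <= i.+1)%N ->
  (\prod_i (p i)`_i) * (weyl_den R n * \prod_j mev f j)@_m =
  \det (\matrix_(i, j) (recip n.-1 (p i) * f)`_(m (rev_ord j))).
Proof.
move=> hp; rewrite -mcoeffZ scalerAl -den_det // -coef_det_mev.
rewrite (reindex_inj rev_ord_inj) /=; congr (_ @__).
rewrite -[X in _ * X](_ : \det (diag_mx (\row_j mev f (rev_ord j))) = _); last first.
  by rewrite det_diag; apply: eq_bigr => j _; rewrite mxE.
rewrite -det_mulmx; congr (\det _); apply/matrixP=> i j.
by rewrite mul_mx_diag !mxE mevM.
Qed.

(** With Chebyshev rows, the exponents of each monomial of the determinant, less n - 1, are a signed
    permutation of 0, ..., n - 1; hence all monomials have the length of rho. *)
Lemma laplace_den : exists c : R,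
  \sum_l eul n.-1%:R l (eul n.-1%:R l (weyl_den R n)) = c *: weyl_den R n.
Proof.
have [p hp] := fin_all_exists (fun i : 'I_n => @cheb_exists R i).
exists (\sum_(i < n) (i%:R) ^+ 2); apply/mpolyP=> m.
have D : weyl_den R n = \det (\matrix_(i, j) mev (recip n.-1 (p i)) (rev_ord j)).
  rewrite den_det => [|i]; last by have [] := hp i.
  by rewrite big1 ?scale1r // => i _; have [] := hp i.
rewrite raddf_sum /= mcoeffZ; under eq_bigr do rewrite !eul_coeff mulrA -expr2.
rewrite -mulr_suml D coef_det_mev; apply/eqP; rewrite -subr_eq0 -mulrBl; apply/eqP.
rewrite /determinant mulr_sumr big1 // => s _.
case: (eqVneq (\prod_i (\matrix_(i, j) (recip n.-1 (p i))`_(m (rev_ord j))) i (s i)) 0).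
  by move=> ->; rewrite !mulr0.
move=> /prodf_neq0 nz; rewrite [X in X * _](_ : _ = 0) ?mul0r //.
apply/eqP; rewrite subr_eq0; apply/eqP.
have fi : injective (fun i => rev_ord (s i)) by move=> i j /rev_ord_inj/perm_inj.
rewrite (reindex_inj fi) /=; apply: eq_bigr => i _.
have := nz i isT; rewrite mxE; have [_ _ ->] := hp i; last by have := ltn_ord i; lia.
have in1 : (i <= n.-1)%N by have := ltn_ord i; lia.
case: (i : nat) in1 => [|j] jn.
  by rewrite coefXn; case: (m _ =P _) => [-> _|_]; rewrite ?eqxx // subrr.
rewrite coefD !coefXn; case: (m _ =P (_ + _)%N) => [-> _|_].
  by rewrite natrD addrC addKr.
case: (m _ =P _) => [-> _|_]; last by rewrite addr0 eqxx.
by rewrite natrB // addrC addrA addNr add0r sqrrN.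
Qed.

End DenDet.

(** * Leading exponents and multiplicities *)

Section Lead.
Variables (C : numClosedFieldType) (n : nat) (l : 'I_n -> C).

Definition mpair (b : 'X_{1..n}) : C := \sum_i (b i)%:R * l i.

Lemma mpairD a b : mpair (a + b)%MM = mpair a + mpair b.
Proof.
by rewrite -big_split; apply: eq_bigr => i _; rewrite mnmDE natrD mulrDl.
Qed.

Lemma mpair0 : mpair 0%MM = 0.
Proof. by rewrite /mpair big1 // => i _; rewrite mnm0E mul0r. Qed.

Lemma mpairU i : mpair U_(i)%MM = l i.
Proof.
rewrite /mpair (bigD1 i) //= mnm1E eqxx mul1r big1 ?addr0 // => j /negbTE ji.
by rewrite mnm1E eq_sym ji mul0r.
Qed.

Definition lead (f : {mpoly C[n]}) (t : 'X_{1..n}) : Prop :=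
  f@_t = 1 /\ forall b, f@_b != 0 -> b = t \/ mpair b < mpair t.

Lemma coefM_neq0 (f g : {mpoly C[n]}) m : (f * g)@_m != 0 ->
  exists k1 k2, [/\ m = (k1 + k2)%MM, f@_k1 != 0 & g@_k2 != 0].
Proof.
move=> h; apply: NNPP => nex; case/eqP: h; rewrite mcoeffM big1 // => -[k1 k2] /= /eqP mE.
case: (eqVneq f@_k1 0) => [->|f0]; first by rewrite mul0r.
case: (eqVneq g@_k2 0) => [->|g0]; first by rewrite mulr0.
by case: nex; exists k1, k2.
Qed.

Lemma lead_mul f g t s : lead f t -> lead g s -> lead (f * g) (t + s)%MM.
Proof.
move=> [f1 hf] [g1 hg]; split; last first.
  move=> b /coefM_neq0[k1 [k2 [-> /hf h1 /hg h2]]]; rewrite !mpairD.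
  case: h1 => [->|h1]; case: h2 => [->|h2]; [by left|right..].
  - by rewrite ltrD2l.
  - by rewrite ltrD2r.
  - exact: ltrD.
have -> : f = 'X_[t] + (f - 'X_[t]) by rewrite addrC subrK.
rewrite mulrDl mcoeffD mulrC mcoeffMX g1; apply/eqP; rewrite -subr_eq0 addrC addKr.
apply/negP=> /negP/coefM_neq0[k1 [k2 [E]]]; rewrite mcoeffB mcoeffX.
case: (eqVneq t k1) => [<-|tk]; first by rewrite f1 subrr eqxx.
rewrite subr0 => /hf[kt|h1]; first by rewrite kt eqxx in tk.
move=> /hg h2; have := congr1 mpair E; rewrite !mpairD => E2.
have : mpair k1 + mpair k2 < mpair t + mpair s.
  by case: h2 => [->|h2]; [rewrite ltrD2r|apply: ltrD].
by rewrite E2 ltxx.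
Qed.

Lemma lead1 : lead 1 0%MM.
Proof.
split; first by rewrite mcoeff1 eqxx.
by move=> b; rewrite mcoeff1; case: (b =P _) => [->|]; [left|rewrite eqxx].
Qed.

(** The exponent of rho, shifted by n - 1 like the denominator. *)
Definition den_top : 'X_{1..n} := [multinom (n - i.+1 + n.-1)%N | i < n].

Lemma sum_ord_gt N i : (\sum_(b < N) (i < b) = N - i.+1)%N.
Proof. by elim: N => [|N IH]; rewrite ?big_ord0 // big_ord_recr /= IH; case: ltngtP; lia. Qed.

Lemma sum_ord_lt N i : (\sum_(b < N) (b < i) = minn N i)%N.
Proof. by elim: N => [|N IH]; rewrite ?big_ord0 ?min0n // big_ord_recr /= IH; case: ltngtP; lia. Qed.

Lemma lead_den : sdom l -> lead (weyl_den C n) den_top.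
Proof.
move=> ld.
(* The two factors of a pair lead with x_i x_j and x_i, so an index is counted twice for each larger
   index and once for each smaller one. *)
have -> : den_top = (\sum_(s | pair_lt s.1) (if s.2 then U_(s.1.1) + U_(s.1.2) else U_(s.1.1)))%MM.
  rewrite big_pair_bool /=; apply/mnmP=> i; rewrite mnmE mnm_sumE.
  rewrite -(pair_big_dep xpredT (fun a b : 'I_n => (a < b)%N)
     (fun a b => (U_(a) + (U_(a) + U_(b)))%MM i)) /=.
  under eq_bigr do rewrite big_mkcond.
  rewrite (eq_bigr (fun a : 'I_n => \sum_(b < n) ((a == i) * (a < b).*2 + (a < b) * (b == i)))%N); last first.
    move=> a _; apply: eq_bigr => b _; rewrite !mnmDE !mnm1E.
    by case: (a < b)%N; case: (a == i); case: (b == i).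
  under eq_bigr do rewrite big_split /=.
  have S1 : (\sum_(a < n) \sum_(b < n) (a == i) * (a < b).*2 = (n - i.+1).*2)%N.
    rewrite (bigD1 i) //= [X in (_ + X)%N]big1 ?addn0 => [|a /negbTE ai]; last first.
      by rewrite ai big1.
    by rewrite eqxx -sum_ord_gt -[RHS]mul2n big_distrr /=; apply: eq_bigr => b _; rewrite mul1n mul2n.
  have S2 : (\sum_(a < n) \sum_(b < n) (a < b) * (b == i) = i)%N.
    rewrite exchange_big /= (bigD1 i) //= [X in (_ + X)%N]big1 ?addn0 => [|a /negbTE ai]; last first.
      by rewrite ai big1 // => b _; rewrite muln0.
    under eq_bigr do rewrite eqxx muln1.
    by rewrite sum_ord_lt; have := ltn_ord i; lia.
  by rewrite big_split /= S1 S2; have := ltn_ord i; lia.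
rewrite /weyl_den; elim/big_rec2: _ => [|s f t ps IH]; first exact: lead1.
apply: lead_mul => //; move: s ps {IH f t} => [[i j] []]; rewrite /pair_lt /gfac /= => ij.
  have [_ l2] := ld i j ij.
  have E b : ('X_i * 'X_j - 1 : {mpoly C[n]})@_b = ((U_(i) + U_(j))%MM == b)%:R - (b == 0%MM)%:R.
    by rewrite -mpolyXD mcoeffB mcoeffX mcoeff1.
  have n0 : (U_(i) + U_(j))%MM != 0%MM :> 'X_{1..n}.
    by apply/eqP => /mnmP/(_ i); rewrite mnmDE mnm0E mnm1E eqxx.
  split; first by rewrite E eqxx (negbTE n0) subr0.
  move=> b; rewrite E; case: (eqVneq (U_(i) + U_(j))%MM b) => [->|_]; first by left.
  case: (eqVneq b 0%MM) => [->|_]; last by rewrite subrr eqxx.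
  by right; rewrite mpair0 mpairD !mpairU.
have [l1 _] := ld i j ij.
have E b : ('X_i - 'X_j : {mpoly C[n]})@_b = (U_(i)%MM == b)%:R - (U_(j)%MM == b)%:R.
  by rewrite mcoeffB !mcoeffX.
have nij : (j == i) = false by apply/negbTE; rewrite -val_eqE neq_ltn ij orbT.
split; first by rewrite E eqxx eq_mnm1 ?nij ?subr0 //.
move=> b; rewrite E; case: (eqVneq U_(i)%MM b) => [->|_]; first by left.
case: (eqVneq U_(j)%MM b) => [<-|_]; last by rewrite subrr eqxx.
by right; rewrite !mpairU -subr_gt0.
Qed.

End Lead.

(** * Characters of irreducible summands *)

Section IrrCharacter.
Variables (C : numClosedFieldType) (n : nat).
Local Notation so := (@so C n).
Local Notation lf := (lshift n).
Local Notation rt := (rshift n).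

Lemma pairing_ext (k k' l : 'I_n -> C) : k =1 k' -> pairing k l = pairing k' l.
Proof. by move=> h; apply: eq_bigr => i _; rewrite h. Qed.

Lemma hw_vec_ext (V : so_rep C n) k k' v : k =1 k' -> hw_vec (V := V) k v -> hw_vec k' v.
Proof.
move=> h [v0 wv kv]; split=> // y; rewrite wv; congr (_ *: _); exact: pairing_ext.
Qed.

Lemma iso_hw (V W : so_rep C n) k v : rep_iso V W -> hw_vec (V := V) k v ->
  exists w, hw_vec (V := W) k w.
Proof.
move=> [A [B [AB BA hA]]] [v0 wv kv]; exists (A *m v); split.
- apply: contraNneq v0 => /(congr1 (mulmx B)).
  by rewrite mulmxA BA mul1mx mulmx0 => ->.
- by move=> h; rewrite mulmxA -hA ?cartan_so // -mulmxA wv scalemxAr.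
- by move=> i j ij; rewrite !mulmxA -!hA ?soF_so // -!mulmxA; have [-> ->] := kv i j ij; rewrite !mulmx0.
Qed.

(** When a raising operator kills [v], unitarity makes the squared norm of its adjoint applied to
    [v] equal to that of [v] times the value of the weight on the coroot. *)
Lemma hw_dominant (V : so_rep C n) k v : unitary_rep V -> hw_vec (V := V) k v ->
  forall i j : 'I_n, (i < j)%N -> 0 <= k i - k j /\ 0 <= k i + k j.
Proof.
move=> uV [v0 wv kv].
have pos : 0 < (adj v *m v) 0 0.
  rewrite lt_def adj_sqnorm_ge0 andbT.
  by apply: contraNneq v0 => /adj_sqnorm_eq0 ->.
have wF a : rep_act V (soF C a a) *m v = vwt k a *: v.
  have W i : rep_act V (soF C (lf i) (lf i)) *m v = k i *: v.
    by rewrite soF_lshift wv pairing_delta.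
  case: (split_ordP a) => i ->; first by rewrite vwt_lshift W.
  by rewrite -bar_lshift soF_bar actN ?soF_so // mulNmx W vwt_bar vwt_lshift scaleNr.
have main a b : b != bar a -> rep_act V (soF C a b) *m v = 0 -> 0 <= vwt k a - vwt k b.
  move=> ba Fv; set v' := rep_act V (soF C b a) *m v.
  have : adj v' *m v' = (vwt k a - vwt k b) *: (adj v *m v).
    rewrite /v' adjM -uV ?soF_so // [adj (soF C b a)]adj_soF -mulmxA (mulmxA _ _ v).
    rewrite FF_opp // mulmxDl -mulmxA Fv mulmx0 add0r mulmxBl !wF -scalerBl.
    by rewrite scalemxAr.
  move=> /matrixP/(_ 0 0); rewrite [RHS]mxE => E.
  by have := adj_sqnorm_ge0 v'; rewrite E pmulr_lge0.
move=> i j ij; have [k1 k2] := kv i j ij; split.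
  have := main _ _ _ k1; rewrite !vwt_lshift; apply.
  by rewrite bar_lshift eq_lrshift.
have := main _ _ _ k2; rewrite vwt_lshift vwt_rshift opprK; apply.
by rewrite bar_lshift eq_rshift -val_eqE /= gtn_eqF.
Qed.

Variables (V : so_rep C n) (N : nat) (e : 'I_(rep_dim V) -> 'X_{1..n}).
Hypotheses (uV : unitary_rep V) (dV : diag_wt N e).

Lemma ewt_inj b c : ewt N e b =1 ewt N e c -> e b = e c.
Proof.
move=> h; apply/mnmP=> i; have := h i; rewrite /ewt => /addIr/eqP.
by rewrite eqr_nat => /eqP.
Qed.

Lemma mpair_ewt l b c : mpair l (e b) - mpair l (e c) = pairing (ewt N e b) l - pairing (ewt N e c) l.
Proof.
rewrite /mpair /pairing -!sumrB; apply: eq_bigr => i _; rewrite /ewt; ring.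
Qed.

(** The character of an irreducible summand has a dominant leading exponent
    that does not depend on the strictly dominant functional l. *)
Lemma irr_character (P : 'M[C]_(rep_dim V)) Q :
  inv_proj P -> sub_rep P Q -> irreducible_rep Q ->
  exists b, [/\ exists w, hw_vec (V := Q) (ewt N e b) w,
    forall l, sdom l -> lead l (chi e P) (e b),
    exists c, P *m casimir V = c *: P &
    forall i j : 'I_n, (i < j)%N -> 0 <= ewt N e b i - ewt N e b j /\ 0 <= ewt N e b i + ewt N e b j].
Proof.
move=> [PP aP hP] [B [L [LB BL hB hL]]] irr; have [dQ _] := irr.
pose u c := col c L.
have uE c : u c = L *m delta_mx c 0 by rewrite -colE.
have wu c : wt_vec (V := Q) (ewt N e c) (u c).
  move=> h; rewrite uE mulmxA -hL ?cartan_so // -mulmxA dV.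
  rewrite scalemxAr; congr (_ *m _); apply/matrixP=> i j.
  rewrite mul_diag_mx !mxE; case: (eqVneq i c) => [->|] //=.
  by rewrite !mulr0.
have [b0 nb0] : exists b, u b != 0.
  apply: NNPP => h; have L0 : L = 0.
    apply/matrixP=> i j; rewrite mxE; apply/eqP; apply: contra_notT h => Lij.
    by exists j; apply: contraNneq Lij => /matrixP/(_ i 0); rewrite !mxE => ->.
  have := LB; rewrite L0 mul0mx => /matrixP/(_ (Ordinal dQ) (Ordinal dQ)).
  by rewrite !mxE eqxx => /eqP; rewrite eq_sym oner_eq0.
(* The pairing with rho, as a natural number. Raising operators strictly increase it, so a nonzero
   column of [L] of maximal height is a highest weight vector. *)
pose hgt c := (\sum_i e c i * (n - i.+1))%N.
pose t := [arg max_(c > b0 | u c != 0) hgt c].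
have [ut tmax] : u t != 0 /\ forall c, u c != 0 -> (hgt c <= hgt t)%N.
  by rewrite /t; case: arg_maxnP.
have hgtD c (m1 m2 : 'X_{1..n}) d : (e c + m1 = e d + m2)%MM ->
    (hgt c + \sum_i m1 i * (n - i.+1) = hgt d + \sum_i m2 i * (n - i.+1))%N.
  move=> E; rewrite -!big_split; apply: eq_bigr => i _ /=.
  by rewrite -!mulnDl -!mnmDE E.
have hU i : (\sum_j (U_(i)%MM : 'X_{1..n}) j * (n - j.+1) = n - i.+1)%N.
  rewrite (bigD1 i) //= mnm1E eqxx mul1n big1 ?addn0 // => j /negbTE ji.
  by rewrite mnm1E eq_sym ji mul0n.
have hw : hw_vec (V := Q) (ewt N e t) (u t).
  split=> // i j ij.
  have K a d : rep_act V (soF C a d) *m delta_mx t 0 =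
      \sum_c (rep_act V (soF C a d) c t) *: delta_mx c 0 :> 'cV[C]_(rep_dim V).
    apply/matrixP=> x y; rewrite ord1 -colE summxE !mxE (bigD1 x) //= !mxE !eqxx mulr1.
    rewrite big1 ?addr0 // => z /negbTE zx; by rewrite !mxE eq_sym zx mulr0.
  have Kill a d : (forall c, rep_act V (soF C a d) c t != 0 -> (hgt t < hgt c)%N) ->
     rep_act Q (soF C a d) *m u t = 0.
    move=> h; rewrite uE mulmxA -hL ?soF_so // -mulmxA K mulmx_sumr big1 // => c _.
    rewrite -scalemxAr -uE; case: (eqVneq (rep_act V (soF C a d) c t) 0) => [->|/h tc].
      by rewrite scale0r.
    case: (eqVneq (u c) 0) => [->|/tmax]; first by rewrite scaler0.
    by rewrite leqNgt tc.
  have jn := ltn_ord j.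
  split; apply: Kill => c Fn; have Fw := entry_wt dV Fn.
    have E : (e c + U_(j) = e t + U_(i))%MM.
      by apply: (@ewt_eq _ _ _ N) => s; rewrite Fw !vwt_lshift !mnm1E.
    have := hgtD _ _ _ _ E; rewrite !hU; lia.
  have E : (e c + 0 = e t + (U_(i) + U_(j)))%MM.
    apply: (@ewt_eq _ _ _ N) => s; rewrite Fw vwt_lshift vwt_rshift mnm0E mnmDE !mnm1E.
    by rewrite natrD opprK subr0.
  have := hgtD _ _ _ _ E; rewrite addm0 in E *.
  rewrite [X in (_ + X)%N]big1 => [|s _]; last by rewrite mnm0E mul0n.
  have -> : (\sum_s (U_(i) + U_(j))%MM s * (n - s.+1) = (n - i.+1) + (n - j.+1))%N.
    by rewrite -hU -[X in (_ + X)%N]hU -big_split; apply: eq_bigr => s _; rewrite mnmDE mulnDl.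
  lia.
have [w0 _ _] := hw.
exists t; split; first by exists (u t).
- move=> l ld.
  have top c : u c != 0 -> e c = e t \/ mpair l (e c) < mpair l (e t).
    move=> uc; have [h|[a ua]] := irr_top ld irr hw (wu c) uc.
      by right; rewrite -subr_lt0 mpair_ewt subr_lt0.
    left; apply: ewt_inj; apply: wt_vec_uniq uc (wu c) _.
    by rewrite ua => y; rewrite -scalemxAr wu !scalerA mulrC.
  have Pu c : P c c != 0 -> u c != 0.
    apply: contraNneq => uc; rewrite -BL mxE big1 // => i _.
    by have /matrixP/(_ i 0) := uc; rewrite !mxE => ->; rewrite mulr0.
  have chiE m : (chi e P)@_m = \sum_(c | e c == m) P c c.
    rewrite /chi raddf_sum /= [RHS]big_mkcond; apply: eq_bigr => c _.
    by rewrite mcoeffZ mcoeffX; case: eqP; rewrite ?mulr1 ?mulr0.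
  split; last first.
    move=> m; rewrite chiE => h.
    have [c /eqP <- Pc] : exists2 c, e c == m & P c c != 0.
      apply: NNPP => nex; case/eqP: h; rewrite big1 // => c cm.
      by apply/eqP; apply: contra_notT nex => Pc; exists c.
    exact: top (Pu c Pc).
  have scal c : exists a : C, e c = e t -> u c = a *: u t.
    case: (eqVneq (u c) 0) => [->|uc]; first by exists 0; rewrite scale0r.
    case: (eqVneq (e c) (e t)) => [ct|nct]; last by exists 0 => ct; rewrite ct eqxx in nct.
    have [h|[a ua]] := irr_top ld irr hw (wu c) uc; last by exists a.
    by move: h; rewrite -subr_lt0 -mpair_ewt ct subrr ltxx.
  have [a ha] := fin_all_exists scal.
  have [v vE] : exists v, v = B *m u t by exists (B *m u t).
  have vs c : e c != e t -> v c 0 = 0.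
    move=> ct; apply/eqP; apply: contraNT ct => vc; apply/eqP/ewt_inj => i.
    have := wu t (delta_mx 0 i) => /(congr1 (mulmx B)).
    rewrite mulmxA hB ?cartan_so // -mulmxA -vE dV mul_diag_mx -scalemxAr -vE.
    move=> /matrixP/(_ c 0); rewrite !mxE !pairing_delta => /eqP.
    by rewrite -subr_eq0 -mulrBl mulf_eq0 (negbTE vc) orbF subr_eq0 => /eqP.
  have uv : u t = \sum_c v c 0 *: u c.
    rewrite -[u t]mul1mx -LB -mulmxA -vE; apply/matrixP=> i j; rewrite ord1 summxE mxE.
    by apply: eq_bigr => c _; rewrite !mxE mulrC.
  rewrite chiE; apply/eqP; rewrite -subr_eq0.
  (* The coefficient at the leading exponent is the trace of [P] on that weight space. Columns of
     [L] of this weight are multiples of [u t], and expanding [u t] in the columns shows that the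
     trace is 1. *)
  have key : (\sum_(c | e c == e t) P c c) *: u t = u t.
    rewrite [RHS]uv [RHS](bigID (fun c => e c == e t)) /=.
    rewrite [X in _ = _ + X]big1 ?addr0 => [|c ct]; last by rewrite vs // scale0r.
    rewrite scaler_suml; apply: eq_bigr => c /eqP ct.
    rewrite (ha c ct) scalerA; congr (_ *: _).
    have -> : P c c = (B *m u c) c 0 by rewrite -BL !mxE; apply: eq_bigr => i _; rewrite mxE.
    by rewrite (ha c ct) -scalemxAr -vE mxE mulrC.
  have := w0; apply: contraNT => nz; move/eqP: key.
  by rewrite -subr_eq0 -{2}[u t]scale1r -scalerBl scaler_eq0 (negbTE nz).
- have cB := @casimir_hom C n Q.
  (* The Casimir operator preserves the top weight, hence scales [u t]; the eigenvectors for this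
     scalar form a submodule. *)
  have [a ha] : exists a : C, casimir Q *m u t = a *: u t.
    case: (eqVneq (casimir Q *m u t) 0) => [->|nz]; first by exists 0; rewrite scale0r.
    have wc : wt_vec (V := Q) (ewt N e t) (casimir Q *m u t).
      by move=> h; rewrite mulmxA -cB ?cartan_so // -mulmxA wu scalemxAr.
    by have [|//] := irr_top (@rho_sdom C n) irr hw wc nz; rewrite ltxx.
  exists a.
  have cas (x : 'cV[C]_(rep_dim Q)) : casimir Q *m x = a *: x.
    have [|||h|h] := irr_dichotomy (P := fun x => casimir Q *m x = a *: x) irr.
    - by rewrite mulmx0 scaler0.
    - by move=> s x1 x2 E1 E2; rewrite mulmxDr -scalemxAr E1 E2 scalerDr !scalerA mulrC.
    - by move=> x1 E1 y hy; rewrite mulmxA cB // -mulmxA E1 scalemxAr.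
    - by move: w0; rewrite (h _ ha) eqxx.
    - exact: h.
  have casL : L *m casimir V = casimir Q *m L.
    rewrite /casimir -scalemxAr -scalemxAl; congr (_ *: _).
    rewrite mulmx_sumr mulmx_suml; apply: eq_bigr => i _.
    rewrite mulmx_sumr mulmx_suml; apply: eq_bigr => j _.
    by rewrite mulmxA hL ?soF_so // -!mulmxA hL ?soF_so.
  rewrite -BL -mulmxA casL scalemxAr; congr (B *m _).
  apply/matrixP=> i j; have := cas (u j) => /matrixP/(_ i 0).
  by rewrite !mxE => <-; apply: eq_bigr => s _; rewrite !mxE.
- apply: (hw_dominant (V := V) (v := B *m u t) uV); split.
  + by apply: contraNneq w0 => /(congr1 (mulmx L)); rewrite mulmxA LB mul1mx mulmx0 => ->.
  + by move=> h; rewrite mulmxA -hB ?cartan_so // -mulmxA wu scalemxAr.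
  + move=> i j ij; rewrite !mulmxA -!hB ?soF_so // -!mulmxA.
    by have [_ _ kl] := hw; have [-> ->] := kl i j ij; rewrite !mulmx0.
Qed.

(** [M] is the exponent of k + rho after the shifts by n - 1 and N/2. Irreducible projectors are
    split off one at a time; each contributes 1 to the coefficient if its leading exponent is [M],
    which fixes its isomorphism class, and 0 otherwise. *)
Lemma weyl_multiplicity (k : 'I_n -> C) (M : 'X_{1..n}) :
  (forall i j : 'I_n, (i < j)%N -> 0 <= k i - k j /\ 0 <= k i + k j) ->
  (forall i, (M i)%:R = k i + @rho_ C n i + n.-1%:R + N%:R / 2) ->
  forall P Q, inv_proj P -> sub_rep P Q ->
  exists m, (weyl_den C n * chi e P)@_M = m%:R /\
    forall V0, irreducible_rep V0 -> (exists v, hw_vec (V := V0) k v) -> multiplicity V0 Q m.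
Proof.
move=> kd hM P Q pP sQ.
have [d] := ubnP (rep_dim Q); elim: d => // d IH in P Q pP sQ *; rewrite ltnS => dQ.
case: (eqVneq P 0) => [P0|P0].
  have chi0 : chi e P = 0 by rewrite /chi big1 // => b _; rewrite P0 mxE scale0r.
  exists 0; rewrite chi0 mulr0 mcoeff0; split=> // V0 _ _; apply: mult_zero.
  have := sub_rep_trace sQ; rewrite P0 mxtrace0 => /eqP.
  by rewrite eq_sym pnatr_eq0 => /eqP.
have [P1 [Q1 [pP1 P10 PP1 s1 irr1]]] := irr_inv_proj uV pP P0.
have [P1P pD D1 D2] := inv_projB pP pP1 PP1.
have [PPD _ hPD] := pD; have [Q2 s2] := sub_rep_exists PPD hPD.
have bQ : biprod Q Q1 Q2.
  by apply: sub_rep_biprod sQ s1 s2 => //; rewrite addrC subrK.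
have dd := sub_dim_split sQ s1 s2; have d1 := sub_rep_dim0 s1 P10.
have [|m2 [E2 H2]] := IH _ _ pD s2.
  by apply: leq_trans dQ; rewrite dd -[X in (X < _)%N]add0n ltn_add2r.
have chiP : chi e P = chi e P1 + chi e (P - P1) by rewrite -chiD addrC subrK.
have [t [[w hw] ld1 [c hc] dom]] := irr_character pP1 s1 irr1.
case: (eqVneq M (den_top n + e t)%MM) => [ME|nM].
  exists m2.+1; split.
    rewrite chiP mulrDr mcoeffD E2 -addn1 natrD addrC; congr (_ + _).
    have rd := @rho_sdom C n.
    by have [] := lead_mul (lead_den rd) (ld1 _ rd); rewrite ME.
  move=> V0 irr0 [v hv]; apply: mult_add_same bQ _ (H2 V0 irr0 _); last by exists v.
  apply: irr_iso irr1 irr0 hw _.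
  apply: hw_vec_ext hv => i; have := hM i; rewrite ME mnmDE mnmE /ewt /rho_ !natrD => E.
  by apply/eqP; rewrite -subr_eq0; move/eqP: E; rewrite -subr_eq0 => /eqP E; apply/eqP; rewrite -[RHS]oppr0 -E; ring.
exists m2; split; last first.
  move=> V0 irr0 [v hv]; apply: (mult_add_other bQ irr1 _ (H2 V0 irr0 _)); last by exists v.
  move=> /iso_sym iQ; have [w' hw'] := iso_hw iQ hv.
  have E := irr_hw_uniq irr1 hw hw'.
  case/eqP: nM; apply/mnmP=> i; rewrite mnmDE mnmE; apply/eqP; rewrite -(@eqr_nat C).
  rewrite hM -E /ewt /rho_ !natrD -subr_eq0; apply/eqP; ring.
rewrite chiP mulrDr mcoeffD E2; apply/eqP; rewrite -subr_eq0 addrK; apply/negP=> /negP nz.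
(* |mu + rho| = |k + rho| gives (mu + k + 2 rho, mu - k) = 0, so no exponent
   other than the leading one can be both dominant and of the right length. *)
pose l i : C := ewt N e t i + k i + 2 * @rho_ C n i.
have lsd : sdom l.
  move=> i j ij; have [r1 r2] := @rho_sdom C n i j ij.
  have [k1 k2] := kd i j ij; have [e1 e2] := dom i j ij; rewrite /l; split.
    have -> : ewt N e t i + k i + 2 * rho_ C i - (ewt N e t j + k j + 2 * rho_ C j) =
       2 * (rho_ C i - rho_ C j) + (ewt N e t i - ewt N e t j + (k i - k j)) by ring.
    by rewrite ltr_pwDl ?mulr_gt0 ?ltr0n // addr_ge0.
  have -> : ewt N e t i + k i + 2 * rho_ C i + (ewt N e t j + k j + 2 * rho_ C j) =
       2 * (rho_ C i + rho_ C j) + (ewt N e t i + ewt N e t j + (k i + k j)) by ring.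
  by rewrite ltr_pwDl ?mulr_gt0 ?ltr0n // addr_ge0.
have [c1 hl] := lead_mul (lead_den lsd) (ld1 _ lsd).
have [R hR] := laplace_den C n.
have [_ _ hP1] := pP1.
have lap (m : 'X_{1..n}) : (\sum_i ((m i)%:R - (n.-1%:R + N%:R / 2)) ^+ 2) * (weyl_den C n * chi e P1)@_m
   = (R + c) * (weyl_den C n * chi e P1)@_m.
  have := congr1 (mcoeff m) (laplace_den_chi dV hP1 hR hc).
  rewrite raddf_sum mcoeffZ /= => <-; rewrite mulr_suml; apply: eq_bigr => i _.
  by rewrite !eul_coeff mulrA expr2.
have EM := mulIf nz (lap M).
have := lap (den_top n + e t)%MM; rewrite c1 !mulr1 -EM => ET.
have [E|lt] := hl M nz; first by rewrite E eqxx in nM.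
suff E : mpair l M = mpair l (den_top n + e t)%MM by rewrite E ltxx in lt.
apply/eqP; rewrite -subr_eq0; apply/eqP.
transitivity (\sum_i ((M i)%:R - (n.-1%:R + N%:R / 2)) ^+ 2 -
   \sum_i (((den_top n + e t)%MM i)%:R - (n.-1%:R + N%:R / 2)) ^+ 2 : C); last by rewrite ET subrr.
rewrite /mpair -!sumrB; apply: eq_bigr => i _.
by rewrite hM mnmDE mnmE !natrD /l /ewt /rho_; ring.
Qed.

End IrrCharacter.

(** * The spin representation *)

Section Fermions.
Variables (C : numClosedFieldType) (m : nat).
Local Notation S := {set 'I_m}.
Local Notation d := #|S|.
Implicit Types (A B : S) (i j : 'I_m).

(** Subsets index the monomials of the exterior algebra, and such an operator sends [B] to [c B]
    times [f B]. Relations between operators become identities of functions on sets, and [f] matters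
    only where [c] is nonzero. *)
Definition mono (c : S -> C) (f : S -> S) : 'M[C]_d :=
  \matrix_(a, b) (c (enum_val b) * (enum_val a == f (enum_val b))%:R).

Lemma mono_mul c f c' f' :
  mono c f *m mono c' f' = mono (fun B => c (f' B) * c' B) (f \o f').
Proof.
apply/matrixP=> a b; rewrite !mxE (bigD1 (enum_rank (f' (enum_val b)))) //=.
rewrite !mxE enum_rankK eqxx mulr1 big1 ?addr0 => [|z nz]; first by ring.
rewrite !mxE; case: (eqVneq (enum_val z)) => [E|_]; last by rewrite !mulr0.
by rewrite -E enum_valK eqxx in nz.
Qed.

Lemma mono_eq c f c' f' : (forall B, c B = c' B) -> (forall B, c B != 0 -> f B = f' B) ->
  mono c f = mono c' f'.
Proof.
move=> hc hf; apply/matrixP=> a b; rewrite !mxE -hc.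
by case: (eqVneq (c (enum_val b)) 0) => [->|/hf ->] //; rewrite !mul0r.
Qed.

Lemma mono_eq0 c f : (forall B, c B = 0) -> mono c f = 0.
Proof. by move=> h; apply/matrixP=> a b; rewrite !mxE h mul0r. Qed.

Lemma mono_add c f c' : mono c f + mono c' f = mono (fun B => c B + c' B) f.
Proof. by apply/matrixP=> a b; rewrite !mxE mulrDl. Qed.

Lemma mono1 : mono (fun=> 1) id = 1%:M.
Proof. by apply/matrixP=> a b; rewrite !mxE mul1r (inj_eq enum_val_inj). Qed.

(** The sign of moving the i-th generator to its place in the increasing product over [A]. *)
Definition fsgn i A : C := (-1) ^+ #|[set l in A | (l < i)%N]|.

Lemma fsgn_sq i A : fsgn i A * fsgn i A = 1.
Proof. by rewrite /fsgn -expr2 sqrr_sign. Qed.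

Lemma fsgn_neq0 i A : fsgn i A != 0.
Proof. by rewrite signr_eq0. Qed.

Lemma fsgn_add i j A : j \notin A -> fsgn i (j |: A) = (-1) ^+ (j < i)%N * fsgn i A.
Proof.
move=> jA; rewrite /fsgn; case: (boolP (j < i)%N) => ji.
  have -> : [set l in j |: A | (l < i)%N] = j |: [set l in A | (l < i)%N].
    by apply/setP=> l; rewrite !inE; case: eqP => [->|].
  by rewrite cardsU1 inE (negbTE jA) exprD.
rewrite mul1r; congr (_ ^+ #|pred_of_set _|); apply/setP=> l; rewrite !inE.
by case: eqP => [->|] //=; rewrite (negbTE ji) (negbTE jA).
Qed.

Lemma fsgn_self i A : fsgn i (i |: A) = fsgn i A.
Proof.
congr (_ ^+ #|pred_of_set _|); apply/setP=> l; rewrite !inE.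
by case: eqP => [->|] //=; rewrite ltnn andbF.
Qed.

Lemma fsgn_del i j A : j \in A -> fsgn i (A :\ j) = (-1) ^+ (j < i)%N * fsgn i A.
Proof.
move=> jA; rewrite -{2}(setD1K jA) fsgn_add ?setD11 // mulrA -expr2 sqrr_sign.
by rewrite mul1r.
Qed.

Definition cre i := mono (fun B => (i \notin B)%:R * fsgn i B) (fun B => i |: B).
Definition ann i := mono (fun B => (i \in B)%:R * fsgn i B) (fun B => B :\ i).

Lemma ann_cre_tr i : ann i = (cre i)^T.
Proof.
apply/matrixP=> a b; rewrite !mxE; move: (enum_val a) (enum_val b) => A B.
case: (eqVneq A (B :\ i)) => [->|nA].
  rewrite setD11 mul1r; case: (boolP (i \in B)) => iB.
    by rewrite setD1K // eqxx -{1}(setD1K iB) fsgn_self !mul1r.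
  rewrite mul0r mul0r; case: eqP => [E|_]; last by rewrite mulr0.
  by rewrite E !inE eqxx in iB.
rewrite mulr0; case: eqP => [E|_]; last by rewrite mulr0.
case: (boolP (i \in A)) => iA; first by rewrite !mul0r.
by rewrite E setU1K ?eqxx in nA.
Qed.

Lemma cre_cre i j : cre i *m cre j + cre j *m cre i = 0.
Proof.
rewrite !mono_mul; case: (eqVneq i j) => [<-|ij].
  by rewrite mono_eq0 ?addr0 // => B; rewrite setU11 /= !mul0r.
rewrite (@mono_eq _ (fun B => i |: (j |: B)) _ _ (fun B => erefl) (fun B _ => erefl)).
rewrite [X in _ + X](@mono_eq _ _
  (fun B => (j \notin i |: B)%:R * fsgn j (i |: B) * ((i \notin B)%:R * fsgn i B)) (fun B => i |: (j |: B))); last first.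
- by move=> B _ /=; rewrite setUCA.
- by [].
rewrite mono_add; apply: mono_eq0 => B; rewrite !inE (negbTE ij) eq_sym (negbTE ij) /=.
case: (boolP (i \in B)) => iB /=; first by rewrite !(mul0r, mulr0) addr0.
case: (boolP (j \in B)) => jB /=; first by rewrite !(mul0r, mulr0) addr0.
rewrite !fsgn_add //; case: ltngtP => [l|l|/val_inj E]; last by rewrite E eqxx in ij.
  by rewrite expr0 expr1; ring.
by rewrite expr0 expr1; ring.
Qed.

Lemma ann_ann i j : ann i *m ann j + ann j *m ann i = 0.
Proof.
rewrite !ann_cre_tr -!trmx_mul; have /(congr1 trmx) := cre_cre j i.
by rewrite linearD /= trmx0.
Qed.

Lemma ann_cre i j : ann i *m cre j + cre j *m ann i = (i == j)%:R%:M.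
Proof.
rewrite !mono_mul; case: (eqVneq i j) => [<-|ij].
  rewrite (@mono_eq _ _ (fun B => (i \notin B)%:R) id); last 2 first.
  - move=> B; rewrite setU11 mul1r fsgn_self mulrCA fsgn_sq mulr1 //.
  - move=> B /=; case: (boolP (i \in B)) => iB; last by rewrite setU1K.
    by rewrite /= !mul0r mulr0 eqxx.
  rewrite [X in _ + X](@mono_eq _ _ (fun B => (i \in B)%:R) id); last 2 first.
  - move=> B; rewrite setD11 mul1r; case: (boolP (i \in B)) => iB; last by rewrite !mul0r mulr0.
    by rewrite fsgn_del // ltnn !mul1r fsgn_sq.
  - move=> B /=; case: (boolP (i \in B)) => iB; first by rewrite setD1K.
    by rewrite !mul0r mulr0 eqxx.
  rewrite mono_add -mono1; apply: mono_eq => // B.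
  by case: (i \in B); rewrite ?addr0 ?add0r.
rewrite [X in _ + X](@mono_eq _ _
  (fun B => (j \notin B :\ i)%:R * fsgn j (B :\ i) * ((i \in B)%:R * fsgn i B)) (fun B => (j |: B) :\ i)); last 2 first.
- by [].
- move=> B _ /=; apply/setP=> l; rewrite !inE.
  by case: (eqVneq l j) => [->|] //=; rewrite eq_sym ij.
rewrite mono_add raddf0; apply: mono_eq0 => B; rewrite !inE (negbTE ij) eq_sym ij /=.
case: (boolP (i \in B)) => iB /=; last by rewrite !(mul0r, mulr0) addr0.
case: (boolP (j \in B)) => jB /=; first by rewrite !(mul0r, mulr0) addr0.
rewrite fsgn_add // fsgn_del //.
case: ltngtP => [l|l|/val_inj E]; last by rewrite E eqxx in ij.
  by rewrite expr0 expr1; ring.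
by rewrite expr0 expr1; ring.
Qed.

Lemma cre_ann_diag i : cre i *m ann i = diag_mx (\row_(b < d) (i \in (enum_val b : S))%:R).
Proof.
rewrite mono_mul; apply/matrixP=> a b; rewrite !mxE /= setD11 mul1r.
case: (boolP (i \in enum_val b)) => iB; last first.
  rewrite !mul0r mulr0 mul0r; case: eqP => [->|_]; last by rewrite mulr0n.
  by rewrite (negbTE iB) mulr1n.
rewrite fsgn_del // ltnn !mul1r fsgn_sq mul1r setD1K // (inj_eq enum_val_inj).
by case: eqP => [->|_]; rewrite ?iB.
Qed.

(** Clifford generators; the pairing is [so_form]. *)
Definition gam (a : 'I_(m + m)) : 'M[C]_d :=
  match split a with inl i => cre i | inr i => ann i end.

Lemma gam_lshift i : gam (lshift m i) = cre i.
Proof. by rewrite /gam (unsplitK (inl i)). Qed.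

Lemma gam_rshift i : gam (rshift m i) = ann i.
Proof. by rewrite /gam (unsplitK (inr i)). Qed.

Lemma gam_anti a b : gam a *m gam b + gam b *m gam a = (b == bar a)%:R%:M.
Proof.
case: (split_ordP a) => i ->; case: (split_ordP b) => j ->;
  rewrite ?gam_lshift ?gam_rshift ?bar_lshift ?bar_rshift ?eq_shift.
- by rewrite cre_cre raddf0.
- by rewrite addrC ann_cre.
- by rewrite ann_cre eq_sym.
- by rewrite ann_ann raddf0.
Qed.

Lemma adj_cre i : adj (cre i) = ann i.
Proof.
rewrite ann_cre_tr; apply/matrixP=> a b; rewrite !mxE !rmorphM /= !conjC_nat.
by rewrite /fsgn rmorphXn rmorphN1.
Qed.

Lemma adj_gam a : adj (gam a) = gam (bar a).
Proof.
case: (split_ordP a) => i ->; rewrite ?bar_lshift ?bar_rshift gam_lshift gam_rshift.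
  exact: adj_cre.
by rewrite -adj_cre adjK.
Qed.

(** The embedding of so into the Clifford algebra, normalised so that the commutator with [quad x]
    acts on the generators as [x] does on vectors ([quad_gam]). *)
Definition quad (x : 'M[C]_(m + m)) : 'M[C]_d :=
  2^-1 *: \sum_a \sum_b x a b *: (gam a *m gam (bar b)).

Lemma quadD x y : quad (x + y) = quad x + quad y.
Proof.
rewrite /quad -scalerDr -big_split; congr (_ *: _); apply: eq_bigr => a _ /=.
by rewrite -big_split; apply: eq_bigr => b _; rewrite mxE scalerDl.
Qed.

Lemma quadZ (t : C) x : quad (t *: x) = t *: quad x.
Proof.
rewrite /quad scalerA mulrC -scalerA; congr (_ *: _); rewrite scaler_sumr.
apply: eq_bigr => a _; rewrite scaler_sumr; apply: eq_bigr => b _.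
by rewrite mxE scalerA.
Qed.

(** Each product of two generators yields two terms; their sums agree by the skewness of [x], which
    compensates the factor 1/2. *)
Lemma quad_gam x c : x \in @so C m ->
  quad x *m gam c - gam c *m quad x = \sum_a x a c *: gam a.
Proof.
move=> hx.
have G a b : gam a *m gam (bar b) *m gam c - gam c *m (gam a *m gam (bar b)) =
    (b == c)%:R *: gam a - (c == bar a)%:R *: gam (bar b).
  have E1 : gam (bar b) *m gam c = (c == b)%:R%:M - gam c *m gam (bar b).
    by have := gam_anti (bar b) c; rewrite barK => <-; rewrite addrK.
  have E2 : gam c *m gam a = (c == bar a)%:R%:M - gam a *m gam c.
    by rewrite -gam_anti addrAC subrr add0r.
  rewrite -mulmxA E1 mulmxBr mulmxA mulmxA E2 mulmxBl opprB addrA subrK.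
  by rewrite mul_scalar_mx mul_mx_scalar [c == b]eq_sym.
rewrite /quad -scalemxAl -scalemxAr -scalerBr mulmx_suml mulmx_sumr -sumrB.
under eq_bigr => a _.
  rewrite mulmx_suml mulmx_sumr -sumrB.
  under eq_bigr => b _ do rewrite -scalemxAl -scalemxAr -scalerBr G scalerBr !scalerA.
  rewrite sumrB (bigD1 c) //= eqxx mulr1 big1 ?addr0; last first.
    by move=> b /negbTE ->; rewrite mulr0 scale0r.
  over.
rewrite sumrB [X in _ - X](bigD1 (bar c)) //= [X in _ - (_ + X)]big1 ?addr0; last first.
  by move=> a /negbTE ac; rewrite big1 // => b _; rewrite bar_sym eq_sym ac mulr0 scale0r.
rewrite barK; under [X in _ - X]eq_bigr do rewrite eqxx mulr1.
rewrite -[X in _ - X]sum_bar.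
under [X in _ - X]eq_bigr do rewrite barK (so_bar _ _ hx) scaleNr.
rewrite sumrN opprK -mulr2n -scaler_nat scalerA mulVf ?pnatr_eq0 //.
by rewrite scale1r.
Qed.

(** The commutator with [quad x] is a derivation acting on generators as [x], so it sends [quad y]
    to the image of the bracket. *)
Lemma quad_lie : {in @so C m &, forall x y, quad (lie x y) = lie (quad x) (quad y)}.
Proof.
move=> x y hx hy.
have D a b : quad x *m (gam a *m gam (bar b)) - gam a *m gam (bar b) *m quad x =
   (\sum_c x c a *: (gam c *m gam (bar b))) - \sum_c x b c *: (gam a *m gam (bar c)).
  have := quad_gam (bar b) hx; have := quad_gam a hx.
  move=> /eqP; rewrite subr_eq => /eqP E1 /eqP; rewrite subr_eq => /eqP E2.
  rewrite mulmxA E1 mulmxDl -mulmxA E2 mulmxDr !mulmxA addrA addrK mulmx_suml mulmx_sumr.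
  congr (_ + _).
    by apply: eq_bigr => c _; rewrite scalemxAl.
  rewrite -sumrN -sum_bar; apply: eq_bigr => c _.
  by rewrite -scalemxAr (so_bar1 _ _ hx) barK scaleNr.
set X := quad x in D *; clearbody X.
rewrite [in RHS]/lie [quad y]/quad -scalemxAl -scalemxAr -scalerBr {1}/quad; congr (_ *: _).
rewrite mulmx_sumr mulmx_suml -sumrB.
under [RHS]eq_bigr => a _.
  rewrite mulmx_sumr mulmx_suml -sumrB.
  under eq_bigr => b _ do rewrite -scalemxAl -scalemxAr -scalerBr D scalerBr.
  rewrite sumrB; over.
rewrite sumrB.
have -> : \sum_a \sum_b lie x y a b *: (gam a *m gam (bar b)) =
    \sum_a \sum_b (x *m y) a b *: (gam a *m gam (bar b)) -
    \sum_a \sum_b (y *m x) a b *: (gam a *m gam (bar b)).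
  rewrite -sumrB; apply: eq_bigr => a _; rewrite -sumrB; apply: eq_bigr => b _.
  by rewrite -scalerBl !mxE.
congr (_ - _).
  rewrite exchange_big [RHS]exchange_big; apply: eq_bigr => b _ /=.
  under [RHS]eq_bigr do rewrite scaler_sumr.
  rewrite exchange_big; apply: eq_bigr => c _ /=.
  by rewrite mxE scaler_suml; apply: eq_bigr => a _; rewrite scalerA mulrC.
apply: eq_bigr => a _; under [RHS]eq_bigr do rewrite scaler_sumr.
rewrite exchange_big; apply: eq_bigr => c _ /=.
by rewrite mxE scaler_suml; apply: eq_bigr => b _; rewrite scalerA.
Qed.

Definition spin_rep : so_rep C m :=
  @SoRep C m d quad (fun a => in2W (fun x y => etrans (quadD _ _) (congr1 (+%R^~ _) (quadZ a x)))) quad_lie.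

Lemma spin_unitary : unitary_rep spin_rep.
Proof.
move=> x hx /=; apply/matrixP=> u v; rewrite /quad !mxE !summxE rmorphM rmorph_sum /=.
rewrite fmorphV rmorph_nat; congr (_ * _).
under eq_bigr do rewrite summxE.
under [RHS]eq_bigr do rewrite summxE rmorph_sum /=.
rewrite exchange_big; apply: eq_bigr => a _; apply: eq_bigr => b _ /=.
have -> : adj x b a = (x a b)^* by rewrite !mxE.
rewrite [LHS]mxE [in RHS]mxE rmorphM; congr (_ * _).
have := congr1 (fun M : 'M_d => M u v) (adjM (gam a) (gam (bar b))).
by rewrite !adj_gam barK => <-; rewrite [in LHS]mxE [in LHS]mxE.
Qed.

Definition spin_exp (b : 'I_d) : 'X_{1..m} := [multinom nat_of_bool (i \in (enum_val b : S)) | i < m].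

Lemma spin_diag : @diag_wt C m spin_rep 1 spin_exp.
Proof.
move=> h /=; rewrite /quad.
have -> : \sum_a \sum_b cartan h a b *: (gam a *m gam (bar b)) =
   \sum_a vwt (h 0) a *: (gam a *m gam (bar a)).
  apply: eq_bigr => a _; rewrite (bigD1 a) //= big1 ?addr0 => [|b /negbTE ab].
    by rewrite cartanE eqxx mulr1n.
  by rewrite cartanE eq_sym ab mulr0n scale0r.
rewrite big_split_ord /= -big_split /=.
apply: (scalerI (a := 2)); first by rewrite pnatr_eq0.
rewrite scalerA divff ?pnatr_eq0 // scale1r.
have T i : vwt (h 0) (lshift m i) *: (gam (lshift m i) *m gam (bar (lshift m i))) +
    vwt (h 0) (rshift m i) *: (gam (rshift m i) *m gam (bar (rshift m i))) =
    diag_mx (\row_(b < d) (h 0 i * (2 * (i \in (enum_val b : S))%:R - 1))).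
  rewrite vwt_lshift vwt_rshift bar_lshift bar_rshift gam_lshift gam_rshift.
  have -> : ann i *m cre i = 1%:M - cre i *m ann i.
    by have := ann_cre i i; rewrite eqxx => <-; rewrite addrK.
  rewrite cre_ann_diag; apply/matrixP=> u v; rewrite !mxE.
  by case: (u == v); rewrite ?mulr1n ?mulr0n; ring.
under eq_bigr do rewrite T.
apply/matrixP=> u v; rewrite summxE !mxE /pairing -sumrMnl mulr_sumr.
apply: eq_bigr => i _; rewrite !mxE /ewt mnmE.
by case: (u == v); rewrite ?mulr1n ?mulr0n ?mulr0 //; field.
Qed.

End Fermions.

(** * The two half-spin summands *)

Section HalfSpin.
Variables (C : numClosedFieldType) (m : nat).
Local Notation S := {set 'I_m}.
Local Notation d := #|S|.
Implicit Types (A B : S) (i j : 'I_m).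
Local Notation V := (spin_rep C m).
Local Notation ev b := (enum_val b : S).

Definition parity_op : 'M[C]_d := mono (fun B => (-1) ^+ #|B|) id.

Lemma parity_cre i : parity_op *m cre C i + cre C i *m parity_op = 0.
Proof.
rewrite !mono_mul mono_add; apply: mono_eq0 => B /=.
case: (boolP (i \in B)) => iB; first by rewrite !(mul0r, mulr0) addr0.
by rewrite cardsU1 iB /= exprS; ring.
Qed.

Lemma parity_gam a : parity_op *m gam C a = - (gam C a *m parity_op).
Proof.
apply/eqP; rewrite -addr_eq0; apply/eqP.
case: (split_ordP a) => i ->; rewrite ?gam_lshift ?gam_rshift ?parity_cre //.
have T : parity_op^T = parity_op.
  apply/matrixP=> u v; rewrite !mxE /=; case: (eqVneq u v) => [->|uv] //.
  by rewrite !(inj_eq enum_val_inj) eq_sym (negbTE uv) !mulr0.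
have := congr1 trmx (parity_cre i).
by rewrite linearD /= !trmx_mul T -ann_cre_tr trmx0 addrC.
Qed.

Lemma parity_quad x : parity_op *m quad x = quad x *m parity_op.
Proof.
rewrite /quad -scalemxAl -scalemxAr; congr (_ *: _).
rewrite mulmx_sumr mulmx_suml; apply: eq_bigr => a _.
rewrite mulmx_sumr mulmx_suml; apply: eq_bigr => b _.
rewrite -scalemxAl -scalemxAr; congr (_ *: _).
by rewrite mulmxA parity_gam mulNmx -[in LHS]mulmxA parity_gam mulmxN opprK mulmxA.
Qed.

Definition half_proj (q : bool) : 'M[C]_d := diag_mx (\row_(b < d) (odd #|ev b| == q)%:R).

Lemma half_projE q : half_proj q = 2^-1 *: (1%:M + (-1) ^+ q *: parity_op).
Proof.
apply/matrixP=> u v; rewrite !mxE (inj_eq enum_val_inj) /=.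
case: (eqVneq u v) => [->|]; last by rewrite mulr0n !mulr0 addr0 mulr0.
rewrite !mulr1n !mulr1 -(signr_odd _ #|_|).
by case: q; case: (odd _); rewrite /= ?expr0 ?expr1; field.
Qed.

Lemma half_projM q q' : half_proj q *m half_proj q' = (q == q')%:R *: half_proj q.
Proof.
rewrite mulmx_diag; apply/matrixP=> u v; rewrite !mxE.
case: (u == v); rewrite ?mulr0n ?mulr0 // !mulr1n.
by case: q; case: q'; case: (odd _); rewrite /= ?mulr0 ?mul0r ?mulr1.
Qed.

Lemma half_proj_sum : half_proj true + half_proj false = 1%:M.
Proof.
apply/matrixP=> u v; rewrite !mxE.
by case: (u == v); case: (odd _); rewrite /= ?addr0 ?add0r.
Qed.

Lemma half_inv_proj q : inv_proj (V := V) (half_proj q).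
Proof.
split; first by rewrite half_projM eqxx scale1r.
  apply/matrixP=> u v; rewrite !mxE; case: (eqVneq u v) => [->|uv].
    by rewrite mulr1n conjC_nat.
  by rewrite !mulr0n conjC0.
move=> x hx /=; rewrite half_projE; move: (quad x) (parity_quad x) => X E.
rewrite -scalemxAl -scalemxAr; congr (_ *: _).
by rewrite mulmxDl mulmxDr mul1mx mulmx1 -scalemxAl -scalemxAr E.
Qed.

Lemma quad_soF (a b : 'I_(m + m)) : quad (soF C a b) = 2^-1 *: (gam C a *m gam C (bar b) - gam C (bar b) *m gam C a).
Proof.
have D x y : quad (delta_mx x y : 'M[C]_(m + m)) = 2^-1 *: (gam C x *m gam C (bar y)).
  rewrite /quad (bigD1 x) //= [X in _ + X]big1 ?addr0 => [|z /negbTE zx]; last first.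
    by rewrite big1 // => w _; rewrite !mxE zx scale0r.
  rewrite (bigD1 y) //= big1 ?addr0 => [|z /negbTE zy]; last by rewrite !mxE zy andbF scale0r.
  by rewrite !mxE !eqxx scale1r.
by rewrite /soF -scaleN1r quadD quadZ !D barK scaleN1r scalerBr.
Qed.

Lemma quad_sub i j : i != j -> quad (soF C (lshift m i) (lshift m j)) = cre C i *m ann C j.
Proof.
move=> ij; rewrite quad_soF bar_lshift gam_lshift gam_rshift.
have /eqP := ann_cre C j i; rewrite [j == i]eq_sym (negbTE ij) raddf0 addr_eq0 => /eqP ->.
by rewrite opprK -mulr2n -scaler_nat scalerA mulVf ?pnatr_eq0 // scale1r.
Qed.

Lemma quad_add i j : quad (soF C (lshift m i) (rshift m j)) = cre C i *m cre C j.
Proof.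
rewrite quad_soF bar_rshift !gam_lshift.
have /eqP := cre_cre C j i; rewrite addr_eq0 => /eqP ->.
by rewrite opprK -mulr2n -scaler_nat scalerA mulVf ?pnatr_eq0 // scale1r.
Qed.

Section Commutant.
Variable P : 'M[C]_d.
Hypothesis hP : rep_hom (V := V) (W := V) P.

(** All weights of the spin representation are distinct, since a subset can be read off from the
    signs of its weight. *)
Lemma commutant_diag a b : a != b -> P a b = 0.
Proof.
move=> ab; have [i iab] : exists i, (i \in ev a) != (i \in ev b).
  apply: NNPP => h; case/eqP: ab; apply: enum_val_inj; apply/setP=> i.
  by apply/eqP; apply: contra_notT h => iab; exists i.
have := hP (cartan_so (delta_mx 0 i)); rewrite spin_diag => /matrixP/(_ a b).
rewrite mul_mx_diag mul_diag_mx !mxE !pairing_delta /ewt !mnmE => /eqP.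
rewrite mulrC -subr_eq0 -mulrBl mulf_eq0 => /orP[|/eqP //].
rewrite opprB addrA subrK subr_eq0 eqr_nat.
by move: iab; case: (i \in ev a); case: (i \in ev b).
Qed.

Definition cval A := P (enum_rank A) (enum_rank A).

Lemma commutant_step x (c : S -> C) f A : x \in @so C m -> quad x = mono c f ->
  c A != 0 -> cval (f A) = cval A.
Proof.
move=> hx xE cA; have := hP hx; rewrite /= xE => /matrixP/(_ (enum_rank (f A)) (enum_rank A)).
rewrite !mxE (bigD1 (enum_rank (f A))) //= [X in _ + X]big1 ?addr0 => [|z zA]; last first.
  by rewrite commutant_diag ?mul0r // eq_sym.
rewrite [RHS](bigD1 (enum_rank A)) //= [X in _ = _ + X]big1 ?addr0 => [|z zA]; last first.
  by rewrite commutant_diag ?mulr0.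
rewrite !mxE !enum_rankK eqxx mulr1 => E; apply: (mulIf cA).
by rewrite /cval E mulrC.
Qed.

Lemma commutant_hop i j A : i != j -> i \notin A -> j \notin A ->
  cval (i |: A) = cval (j |: A).
Proof.
move=> ij iA jA.
have := quad_sub ij; rewrite mono_mul => E.
have := @commutant_step _ _ _ (j |: A) (soF_so C _ _) E.
rewrite /= setU1K //; apply.
rewrite iA !inE eqxx /= !mul1r mulf_neq0 ?fsgn_neq0 //.
Qed.

Lemma commutant_pair i j A : i != j -> i \notin A -> j \notin A ->
  cval (i |: (j |: A)) = cval A.
Proof.
move=> ij iA jA.
have := quad_add i j; rewrite mono_mul => E.
have := @commutant_step _ _ _ A (soF_so C _ _) E.
rewrite /=; apply.
by rewrite !inE (negbTE ij) iA jA /= !mul1r mulf_neq0 ?fsgn_neq0.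
Qed.

(** Root vectors exchange one element of a subset for another, or add two. These moves connect all
    subsets of one parity, and [cval] is constant along them. *)
Lemma commutant_parity A B : odd #|A| = odd #|B| -> cval A = cval B.
Proof.
have red A' : (1 < #|A'|)%N -> exists A2, [/\ cval A' = cval A2, #|A'| = #|A2|.+2 & True].
  move=> /card_gt1P[i [j [iA jA ij]]].
  exists (A' :\ i :\ j).
  have jA' : j \in A' :\ i by rewrite !inE eq_sym ij.
  split=> //; last by rewrite (cardsD1 i A') iA (cardsD1 j (A' :\ i)) jA'.
  rewrite -{1}(setD1K iA) -{1}(setD1K jA') commutant_pair // !inE ?eqxx ?andbF //.
have [k] := ubnP (#|A| + #|B|); elim: k => // k IH in A B *; rewrite ltnS => hk par.
case: (ltnP 1 #|A|) => [/red[A2 [-> cA _]]|A1].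
  by apply: IH; rewrite ?cA /= ?negbK in hk par *; [lia|].
case: (ltnP 1 #|B|) => [/red[B2 [-> cB _]]|B1].
  by apply: IH; rewrite ?cB /= ?negbK in hk par *; [lia|].
case: (posnP #|A|) => [A0|Apos].
  have B0 : #|B| = 0 by move: B1 par; rewrite A0; case: #|B| => [|[]].
  by rewrite (cards0_eq A0) (cards0_eq B0).
have /cards1P[i ->] : #|A| == 1 by rewrite eqn_leq A1.
have /cards1P[j ->] : #|B| == 1.
  have cA : #|A| = 1 by apply/eqP; rewrite eqn_leq A1.
  by move: B1 par; rewrite cA; case: #|B| => [|[]].
case: (eqVneq i j) => [->|ij] //.
by have := @commutant_hop i j set0 ij; rewrite !inE !setU0; apply.
Qed.

End Commutant.

(** An irreducible projector under [half_proj q] is diagonal with idempotent entries, constant on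
    the subsets of parity [q]; being nonzero, it is all of [half_proj q]. The set [B0] certifies
    that this parity occurs. *)
Lemma half_irreducible q B0 : odd #|B0| = q ->
  exists Q, sub_rep (W := V) (half_proj q) Q /\ irreducible_rep Q.
Proof.
move=> hB.
have nz : half_proj q != 0.
  apply/eqP => /matrixP/(_ (enum_rank B0) (enum_rank B0)); rewrite !mxE eqxx mulr1n enum_rankK hB eqxx.
  by move/eqP; rewrite oner_eq0.
have [P1 [Q1 [[PP aP hP] P10 E s1 i1]]] := irr_inv_proj (@spin_unitary C m) (half_inv_proj q) nz.
exists Q1; split=> //.
suff <- : P1 = half_proj q by [].
have dg := commutant_diag hP.
have idm A : cval P1 A * cval P1 A = cval P1 A.
  have := congr1 (fun M : 'M_d => M (enum_rank A) (enum_rank A)) PP.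
  rewrite /= mxE (bigD1 (enum_rank A)) //= big1 ?addr0 // => z zA.
  by rewrite (dg z) ?mulr0.
have off A : odd #|A| != q -> cval P1 A = 0.
  move=> Aq; have := congr1 (fun M : 'M_d => M (enum_rank A) (enum_rank A)) E.
  by rewrite mul_diag_mx /= mxE [X in X * _]mxE enum_rankK (negbTE Aq) mul0r.
have [A nA] : exists A, cval P1 A != 0.
  apply: NNPP => h; case/eqP: P10; apply/matrixP=> a b; rewrite mxE.
  case: (eqVneq a b) => [<-|/dg //].
  by apply/eqP; apply: contra_notT h => n0; exists (ev a); rewrite /cval enum_valK.
have Aq : odd #|A| = q by apply/eqP; apply: contraNT nA => /off ->.
have A1 : cval P1 A = 1 by apply: (mulIf nA); rewrite idm mul1r.
apply/matrixP=> a b; rewrite !mxE; case: (eqVneq a b) => [<-|/dg //].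
rewrite mulr1n; have -> : P1 a a = cval P1 (ev a) by rewrite /cval enum_valK.
case: (eqVneq (odd #|ev a|) q) => [aq|/off //].
by rewrite -A1; apply: commutant_parity => //; rewrite aq Aq.
Qed.

Lemma half_hw q B0 Q : odd #|B0| = q -> sub_rep (W := V) (half_proj q) Q ->
  (forall i j, (i < j)%N -> i \in B0) ->
  exists w, hw_vec (V := Q) (fun i => (i \in B0)%:R - 2^-1) w.
Proof.
move=> hB [B [L [LB BL hB' hL]]] top; pose v : 'cV[C]_d := delta_mx (enum_rank B0) 0.
have Ev : half_proj q *m v = v.
  apply/matrixP=> a b; rewrite mul_diag_mx !mxE.
  case: (eqVneq a (enum_rank B0)) => [->|_]; last by rewrite mulr0.
  by rewrite enum_rankK hB eqxx mul1r.
have M c f : c B0 = 0 -> mono c f *m v = 0.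
  move=> c0; rewrite -colE; apply/matrixP=> a b.
  by rewrite !mxE enum_rankK c0 mul0r.
exists (L *m v); split.
- apply/eqP => /(congr1 (mulmx B)); rewrite mulmx0 mulmxA BL Ev => /matrixP/(_ (enum_rank B0) 0).
  by rewrite !mxE !eqxx => /eqP; rewrite oner_eq0.
- move=> h; rewrite mulmxA -hL ?cartan_so // -mulmxA spin_diag scalemxAr.
  congr (_ *m _); apply/matrixP=> a b; rewrite ord1 mul_diag_mx !mxE eqxx andbT.
  case: (eqVneq a (enum_rank B0)) => [->|_]; last by rewrite !mulr0.
  rewrite !mulr1; apply: eq_bigr => i _; rewrite /ewt mnmE enum_rankK; congr (_ * _).
  by rewrite div1r.
- move=> i j ij; have iB := top i j ij.
  have nij : i != j by rewrite -val_eqE neq_ltn ij.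
  rewrite !mulmxA -!hL ?soF_so // -!mulmxA /= quad_sub // quad_add !mono_mul.
  rewrite !M ?mulmx0 //.
    by rewrite !inE iB orbT /= !mul0r.
  by rewrite !inE nij iB /= !mul0r.
Qed.

End HalfSpin.

(** The full set has weight Lambda_n and the parity of [n]; removing the last index gives
    Lambda_(n-1) and the opposite parity. *)
Lemma spin_sum_iso (C : numClosedFieldType) n (S1 S2 : so_rep C n) (last : 'I_n) :
  last.+1 = n -> irrep_of_weight (@Lambda_pred_n n) S1 -> irrep_of_weight (@Lambda_n n) S2 ->
  rep_iso (rep_sum S1 S2) (spin_rep C n).
Proof.
move=> hlast [irr1 [v1 /highest_weight_vectorE h1]] [irr2 [v2 /highest_weight_vectorE h2]].
have half : ratr (1 / 2 : rat) = 2^-1 :> C.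
  by rewrite rmorphM fmorphV rmorph1 rmorph_nat mul1r.
pose B1 : {set 'I_n} := ~: [set last]; pose B2 : {set 'I_n} := setT.
have c2 : #|B2| = n by rewrite cardsT card_ord.
have c1 : #|B1| = n.-1 by rewrite cardsC1 card_ord.
pose q := odd n.
have o2 : odd #|B2| = q by rewrite c2.
have o1 : odd #|B1| = ~~ q by rewrite c1 /q -hlast /= negbK.
have [Q2 [s2 i2]] := half_irreducible C o2.
have [Q1 [s1 i1]] := half_irreducible C o1.
have [|w2 hw2] := half_hw o2 s2; first by move=> i j _; rewrite inE.
have [|w1 hw1] := half_hw o1 s1.
  move=> i j ij; rewrite !inE; have := ltn_ord j; rewrite -[X in (_ < X)%N]hlast ltnS.
  by apply: contraTneq => <-; rewrite -ltnNge.
have iso2 : rep_iso Q2 S2.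
  apply: irr_iso i2 irr2 hw2 _; apply: hw_vec_ext h2 => i.
  rewrite /Lambda_n half /B2 inE mulr1n. by field.
have iso1 : rep_iso Q1 S1.
  apply: irr_iso i1 irr1 hw1 _; apply: hw_vec_ext h1 => i.
  have iE : (i.+1 == n) = (i == last) by rewrite -val_eqE -[RHS]eqSS hlast.
  rewrite !inE /Lambda_pred_n iE; case: eqP => _ /=.
    by rewrite rmorphN /= half mulr0n sub0r.
  by rewrite half mulr1n; field.
apply: iso_sym; apply: biprod_iso.
apply: (biprod_congl iso1); apply: biprod_sym; apply: (biprod_congl iso2); apply: biprod_sym.
apply: (@sub_rep_biprod _ _ (spin_rep C n) 1%:M (half_proj C n (~~ q)) (half_proj C n q)) s1 s2 => //.
- by rewrite half_projM; case: (q) => /=; rewrite scale0r.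
- by rewrite half_projM; case: (q) => /=; rewrite scale0r.
- by rewrite -half_proj_sum; case: (q) => //=; rewrite addrC.
by exists 1%:M, 1%:M; split; rewrite ?mulmx1 // => x hx; rewrite mulmx1 mul1mx.
Qed.

(** * Graded characters *)

Section GradedCharacter.
Variables (C : numClosedFieldType) (n : nat).
Local Notation so := (@so C n).
Implicit Types V W : so_rep C n.

Definition graded_rep V (N : nat) (e : 'I_(rep_dim V) -> 'X_{1..n}) (g : 'I_(rep_dim V) -> nat) : Prop :=
  [/\ unitary_rep V, diag_wt N e &
      {in so, forall x b c, rep_act V x b c != 0 -> g b = g c}].

Definition graded_char (d : nat) (e : 'I_d -> 'X_{1..n}) (g : 'I_d -> nat) : {mpoly {poly C}[n]} :=
  \sum_b 'X^(g b) *: 'X_[e b].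

Definition has_char V N f : Prop :=
  exists (e : 'I_(rep_dim V) -> 'X_{1..n}) g, graded_rep N e g /\ graded_char e g = f.

Lemma has_char_triv : has_char (rep_triv C n) 0 1.
Proof.
exists (fun _ => 0%MM), (fun _ => 0%N); split; last first.
  by rewrite /graded_char big_ord1 expr0 scale1r mpolyX0.
split => //.
  by move=> x _ /=; apply/matrixP=> i j; rewrite !mxE conjC0.
move=> h /=; apply/matrixP=> i j; rewrite !mxE /pairing big1 ?mul0rn // => s _.
by rewrite /ewt mnm0E mul0r subrr mul0r.
Qed.

Lemma has_char_tens V W N1 N2 f1 f2 : has_char V N1 f1 -> has_char W N2 f2 ->
  has_char (rep_tens V W) (N1 + N2) (f1 * f2).
Proof.
move=> [e1 [g1 [[u1 d1 k1] <-]]] [e2 [g2 [[u2 d2 k2] <-]]].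
pose i1 (b : 'I_(rep_dim V * rep_dim W)) := (mxtens_unindex b).1.
pose i2 (b : 'I_(rep_dim V * rep_dim W)) := (mxtens_unindex b).2.
exists (fun b => e1 (i1 b) + e2 (i2 b))%MM, (fun b => g1 (i1 b) + g2 (i2 b))%N; split; last first.
  rewrite /graded_char mulr_sum; apply: eq_bigr => b _.
  by rewrite exprD mpolyXD -scalerAl -scalerAr scalerA.
split.
- move=> x hx /=; rewrite /rep_tens_act u1 // u2 //; apply/matrixP=> b c.
  rewrite !mxE rmorphD !rmorphM /= !conjC_nat.
  by rewrite [(mxtens_unindex b).1 == _]eq_sym [(mxtens_unindex b).2 == _]eq_sym.
- move=> h /=; rewrite /rep_tens_act d1 d2; apply/matrixP=> b c.
  rewrite !mxE -/(i1 b) -/(i2 b) -/(i1 c) -/(i2 c).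
  have -> : (b == c) = (i1 b == i1 c) && (i2 b == i2 c).
    rewrite -(inj_eq (can_inj (@mxtens_unindexK _ _))) /i1 /i2.
    by case: (mxtens_unindex b) => [? ?]; case: (mxtens_unindex c) => [? ?].
  have -> : pairing (ewt (V := rep_tens V W) (N1 + N2) (fun b => e1 (i1 b) + e2 (i2 b))%MM b) (h 0) =
      pairing (ewt N1 e1 (i1 b)) (h 0) + pairing (ewt N2 e2 (i2 b)) (h 0).
    rewrite /pairing -big_split; apply: eq_bigr => i _ /=; rewrite /ewt mnmDE !natrD.
    by field.
  by case: (i1 b == i1 c); case: (i2 b == i2 c); rewrite ?mulr1n ?mulr0n ?mulr1 ?mulr0 ?mul1r ?mul0r ?addr0.
- move=> x hx b c /=; rewrite /rep_tens_act !mxE -/(i1 b) -/(i2 b) -/(i1 c) -/(i2 c).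
  have K1 := k1 x hx (i1 b) (i1 c); have K2 := k2 x hx (i2 b) (i2 c).
  case: (eqVneq (rep_act V x (i1 b) (i1 c)) 0) => [->|/K1 E1].
    rewrite mul0r add0r; case: (eqVneq (i1 b)) => [->|_]; last by rewrite mul0r eqxx.
    by rewrite mul1r => /K2 ->.
  case: (eqVneq (rep_act W x (i2 b) (i2 c)) 0) => [->|/K2 E2]; last by rewrite E1 E2.
  rewrite mulr0 addr0; case: (eqVneq (i2 b)) => [->|_]; last by rewrite mulr0 eqxx.
  by rewrite E1.
Qed.

Lemma has_char_pow V N f m : has_char V N f -> has_char (rep_pow V m) (m * N) (f ^+ m).
Proof.
move=> h; elim: m => [|m IH]; first exact: has_char_triv.
by rewrite mulSn exprS; exact: has_char_tens.
Qed.

Lemma weyl_den_map : weyl_den {poly C} n = map_mpoly (@polyC C) (weyl_den C n).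
Proof.
rewrite /weyl_den rmorph_prod; apply: eq_bigr => -[[i j] []] _; rewrite /gfac /=.
  by rewrite rmorphB rmorphM rmorph1 /= !map_mpolyX.
by rewrite rmorphB /= !map_mpolyX.
Qed.

(** The action preserves the grading, so the projector onto each degree is invariant. Hence every
    coefficient in t, and not just the value at t = 1, counts irreducible summands; positivity rests
    on this. *)
Lemma graded_char_coeff V N f (k : 'I_n -> C) (M : 'X_{1..n}) : has_char V N f ->
  (forall i j : 'I_n, (i < j)%N -> 0 <= k i - k j /\ 0 <= k i + k j) ->
  (forall i, (M i)%:R = k i + @rho_ C n i + n.-1%:R + N%:R / 2) ->
  (forall r, exists m : nat, ((weyl_den _ n * f)@_M)`_r = m%:R) /\
  exists m : nat, ((weyl_den _ n * f)@_M).[1] = m%:R /\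
    forall V0, irreducible_rep V0 -> (exists v, hw_vec (V := V0) k v) -> multiplicity V0 V m.
Proof.
move=> [e [g [[uV dV kV] <-]]] kd hM.
pose R := (\max_b g b).+1.
have gR b : (g b < R)%N by rewrite ltnS; exact: leq_bigmax.
pose P r : 'M[C]_(rep_dim V) := diag_mx (\row_b (g b == r)%:R).
have PP r : inv_proj (P r).
  split.
  - rewrite mulmx_diag; apply/matrixP=> b c; rewrite !mxE.
    by case: (g b == r); rewrite ?mulr1 ?mulr0.
  - apply/matrixP=> b c; rewrite !mxE.
    by case: (eqVneq b c) => [->|_]; rewrite ?mulr1n ?mulr0n ?conjC_nat ?conjC0.
  - move=> x hx; rewrite mul_diag_mx mul_mx_diag; apply/matrixP=> b c; rewrite !mxE.
    case: (eqVneq (rep_act V x b c) 0) => [->|/(kV x hx) ->]; first by rewrite mulr0 mul0r.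
    by rewrite mulrC.
have chiP r : chi e (P r) = \sum_b (g b == r)%:R *: 'X_[e b].
  by apply: eq_bigr => b _; rewrite !mxE eqxx mulr1n.
have E : graded_char e g = \sum_(r < R) 'X^r *: map_mpoly (@polyC C) (chi e (P r)).
  under [RHS]eq_bigr do rewrite chiP rmorph_sum scaler_sumr /=.
  rewrite exchange_big; apply: eq_bigr => b _ /=.
  rewrite (bigD1 (Ordinal (gR b))) //= [X in _ = _ + X]big1 ?addr0 => [|r rb].
    by rewrite eqxx scale1r map_mpolyX.
  case: eqP => [gr|_]; last by rewrite scale0r rmorph0 scaler0.
  by case/eqP: rb; apply: val_inj.
have F : (weyl_den _ n * graded_char e g)@_M =
    \sum_(r < R) (weyl_den C n * chi e (P r))@_M *: 'X^r.
  rewrite E mulr_sumr raddf_sum; apply: eq_bigr => r _ /=.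
  rewrite weyl_den_map -scalerAr mcoeffZ -rmorphM /= mcoeff_map_mpoly /=.
  by rewrite mulrC mul_polyC.
split=> [r|].
  have [PPr _ hPr] := PP r; have [Q sQ] := sub_rep_exists PPr hPr.
  have [m [mE _]] := weyl_multiplicity uV dV kd hM (PP r) sQ.
  rewrite F coef_sum; case: (ltnP r R) => rR; last first.
    exists 0; rewrite big1 // => s _; rewrite coefZ coefXn gtn_eqF ?mulr0 //.
    exact: leq_trans (ltn_ord s) rR.
  exists m; rewrite (bigD1 (Ordinal rR)) //= big1 ?addr0 => [|s sr].
    by rewrite coefZ coefXn eqxx mulr1.
  rewrite coefZ coefXn; case: eqP => [rs|_]; last by rewrite mulr0.
  by case/eqP: sr; apply: val_inj.
have P1 : inv_proj (1%:M : 'M[C]_(rep_dim V)).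
  split; first by rewrite mulmx1.
    by apply/matrixP=> b c; rewrite !mxE conjC_nat eq_sym.
  by move=> x hx; rewrite mulmx1 mul1mx.
have s1 : sub_rep (1%:M : 'M[C]_(rep_dim V)) V.
  by exists 1%:M, 1%:M; split; rewrite ?mulmx1 // => x hx; rewrite mulmx1 mul1mx.
have [m [mE mV]] := weyl_multiplicity uV dV kd hM P1 s1.
exists m; split=> //; rewrite F -mE horner_sum.
have -> : (1%:M : 'M[C]_(rep_dim V)) = \sum_(r < R) P r.
  apply/matrixP=> b c; rewrite summxE (bigD1 (Ordinal (gR b))) //= big1 ?addr0 => [|r rb].
    by rewrite !mxE eqxx.
  rewrite !mxE; case: (g b =P r) => [gr|_]; last by rewrite mul0rn.
  by case/eqP: rb; apply: val_inj.
rewrite chi_sum mulr_sumr raddf_sum; apply: eq_bigr => r _ /=.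
by rewrite hornerZ hornerXn expr1n mulr1.
Qed.

Lemma prod_subset (I : finType) (R : comNzRingType) (F G : I -> R) :
  \sum_(A : {set I}) \prod_i (if i \in A then F i else G i) = \prod_i (F i + G i).
Proof. by rewrite bigA_distr. Qed.

Lemma has_char_spin : has_char (spin_rep C n) 1 (\prod_i mev (1 + 'X) i).
Proof.
exists (@spin_exp n), (fun=> 0%N); split.
  by split; [exact: spin_unitary|exact: spin_diag|].
rewrite /graded_char -(big_enum_val (fun A : {set 'I_n} => 'X^0 *: 'X_[[multinom nat_of_bool (i \in A) | i < n]])) /=.
rewrite (eq_bigr (fun A : {set 'I_n} => \prod_i (if i \in A then 'X_i else 1))); last first.
  move=> A _; rewrite expr0 scale1r mpolyXE_id; apply: eq_bigr => i _; rewrite mnmE.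
  by case: (i \in A).
rewrite (eq_bigl xpredT) // prod_subset; apply: eq_bigr => i _.
by rewrite /mev rmorphD rmorph1 /= map_polyX hornerD hornerX hornerC addrC.
Qed.

Definition big_mx (x : 'M[C]_(n + n)) : 'M[C]_((n + n) + (n + n)) := block_mx x 0 0 (- x^T).

Lemma big_so x : big_mx x \in @Defs.so C (n + n).
Proof.
apply/mem_soP=> a b; case: (split_ordP a) => k ->; case: (split_ordP b) => l ->;
  rewrite ?bar_lshift ?bar_rshift /big_mx
    ?(block_mxEul, block_mxEur, block_mxEdl, block_mxEdr) !mxE ?oppr0 ?opprK //.
Qed.

Fact ext_linear (a : C) : {in so &, forall x y,
  quad (big_mx (a *: x + y)) = a *: quad (big_mx x) + quad (big_mx y)}.
Proof.
move=> x y _ _; rewrite -quadZ -quadD; congr quad.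
rewrite /big_mx scale_block_mx add_block_mx !scaler0 !addr0 linearD linearZ /=.
by rewrite opprD scalerN.
Qed.

Fact ext_lie : {in so &, forall x y,
  quad (big_mx (lie x y)) = lie (quad (big_mx x)) (quad (big_mx y))}.
Proof.
move=> x y _ _; rewrite -quad_lie ?big_so //; congr quad.
rewrite /big_mx /lie !mulmx_block !(mulmx0, mul0mx, addr0, add0r) opp_block_mx add_block_mx.
by rewrite !subr0 linearB /= !trmx_mul !mulmxN !mulNmx !opprK opprB.
Qed.

(** The exterior algebra of the vector representation [C^2n], as the spin
    representation of so_4n restricted to gl_2n. *)
Definition ext_rep : so_rep C n := SoRep ext_linear ext_lie.

(** A subset has weight eps_i for each e_i in it and - eps_i for each e_(n+i) in it. Adding 1 to
    make exponents natural turns the latter into counting absence, which explains [ex]. *)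
Lemma has_char_ext (c : nat) :
  has_char ext_rep 2 (\prod_i mev (('X^c *: 'X + 1) * ('X + ('X^c)%:P)) i).
Proof.
pose T := {set 'I_(n + n)}.
pose ex (A : T) : 'X_{1..n} :=
  [multinom ((lshift n i \in A) + (rshift n i \notin A))%N | i < n].
have big_cartan h : big_mx (cartan h) = cartan (row_mx h (- h)).
  rewrite /big_mx {2}/cartan; congr block_mx.
    by rewrite diag_mx_row linearN.
  by rewrite /cartan tr_block_mx !trmx0 linearN /= !tr_diag_mx diag_mx_row linearN.
exists (fun b => ex (enum_val b)), (fun b => (c * #|(enum_val b : T)|)%N); split.
  split.
  - move=> x hx /=; rewrite -(spin_unitary (big_so x)) /=; congr quad.
    rewrite /big_mx /adj map_block_mx tr_block_mx !map_mx0 !trmx0; congr block_mx.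
    by apply/matrixP=> a b; rewrite !mxE rmorphN.
  - move=> h /=; rewrite big_cartan; apply: (etrans (@spin_diag C (n + n) (row_mx h (- h)))).
    congr diag_mx; apply/matrixP=> a b; rewrite !mxE.
    rewrite /pairing big_split_ord /= -big_split /=; apply: eq_bigr => i _ /=.
    rewrite row_mxEl row_mxEr !mxE /ewt !mnmE natrD.
    by case: (lshift n i \in _); case: (rshift n i \in _); rewrite /= ?mulr1n ?mulr0n; field.
  - move=> x hx a b /= nz; congr (_ * _)%N; move: nz; set Q := quad _ => nz.
    (* The identity of gl_2n acts as the degree minus a constant and commutes with [big_mx x], so
       nonzero entries join subsets of equal size. *)
    pose h1 : 'rV[C]_(n + n) := const_mx 1.
    have cx : lie (cartan h1) (big_mx x) = 0.
      apply/matrixP=> u v; case: (split_ordP u) => k ->; case: (split_ordP v) => l ->;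
        rewrite /lie /cartan /big_mx !mulmx_block !(mulmx0, mul0mx, addr0, add0r) !diag_const_mx
          ?(mulmxN, mulNmx) ?(mul1mx, mulmx1) ?subrr !mxE
          ?(block_mxEul, block_mxEur, block_mxEdl, block_mxEdr) ?mxE ?subrr //.
    have := rep_lie (spin_rep C (n + n)) (cartan_so h1) (big_so x).
    rewrite cx act0 spin_diag /lie -[rep_act _ (big_mx x)]/Q.
    move: Q nz => Q nz; rewrite mul_diag_mx mul_mx_diag => /matrixP/(_ a b).
    rewrite !mxE mulrC -mulrBr => /esym/eqP; rewrite mulf_eq0 (negbTE nz) /=.
    have pE u : pairing (ewt (V := spin_rep C (n + n)) 1 (@spin_exp (n + n)) u) (h1 0) =
        #|(enum_val u : T)|%:R - (n + n)%:R / 2.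
      rewrite /pairing; under eq_bigr do rewrite mxE mulr1 /ewt mnmE.
      rewrite sumrB sumr_const card_ord -natr_sum -sum1_card [in RHS]big_mkcond /=.
      rewrite -[_ *+ (n + n)]mulr_natr; congr (_%:R - _); last by field.
    by rewrite !pE opprB addrA subrK subr_eq0 eqr_nat => /eqP.
rewrite /graded_char -(big_enum_val (fun A : T => 'X^(c * #|A|) *: 'X_[ex A])) /=.
pose F (a : 'I_(n + n)) : {mpoly {poly C}[n]} :=
  match split a with inl i => 'X^c *: 'X_i | inr i => ('X^c)%:MP end.
pose G (a : 'I_(n + n)) : {mpoly {poly C}[n]} :=
  match split a with inl i => 1 | inr i => 'X_i end.
have Fl i : F (lshift n i) = 'X^c *: 'X_i by rewrite /F (unsplitK (inl i)).
have Fr i : F (rshift n i) = ('X^c)%:MP by rewrite /F (unsplitK (inr i)).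
have Gl i : G (lshift n i) = 1 by rewrite /G (unsplitK (inl i)).
have Gr i : G (rshift n i) = 'X_i by rewrite /G (unsplitK (inr i)).
rewrite (eq_bigr (fun A : T => \prod_a (if a \in A then F a else G a))); last first.
  move=> A _; rewrite big_split_ord /= -big_split /=.
  have -> : 'X_[ex A] = \prod_i ('X_i ^+ (lshift n i \in A) * 'X_i ^+ (rshift n i \notin A)) :> {mpoly {poly C}[n]}.
    by rewrite mpolyXE_id; apply: eq_bigr => i _; rewrite mnmE exprD.
  have -> : 'X^(c * #|A|) = \prod_i ('X^c ^+ (lshift n i \in A) * 'X^c ^+ (rshift n i \in A)) :> {poly C}.
    have -> : #|A| = (\sum_i ((lshift n i \in A) + (rshift n i \in A)))%N.
      rewrite -sum1_card big_mkcond big_split_ord /= -big_split /=.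
      by apply: eq_bigr => i _; case: (_ \in A); case: (_ \in A).
    by rewrite exprM -prodrXr; apply: eq_bigr => i _; rewrite exprD.
  rewrite -scaler_prod; apply: eq_bigr => i _; rewrite Fl Fr Gl Gr.
  case: (lshift n i \in A); case: (rshift n i \in A); rewrite /= ?expr0 ?expr1 ?mulr1 ?mul1r ?scale1r //.
    by rewrite -scalerAl [_ * _%:MP]mulrC mul_mpolyC scalerA.
    by rewrite scalerAl.
  by rewrite -[RHS]mulr1 mul_mpolyC.
rewrite (eq_bigl xpredT) // prod_subset big_split_ord /= -big_split; apply: eq_bigr => i _ /=.
rewrite Fl Fr Gl Gr mevM; congr (_ * _).
  rewrite /mev rmorphD rmorph1 /= map_polyZ map_polyX.
  by rewrite hornerD hornerZ hornerX hornerC mul_mpolyC.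
rewrite /mev rmorphD /= map_polyX map_polyC /=.
by rewrite hornerD hornerX hornerC addrC.
Qed.

End GradedCharacter.

(** * Gaussian binomials *)

Section Gauss.

Lemma qnumD m r : qnum (m + r) = qnum m + 'X^m * qnum r.
Proof.
rewrite /qnum big_split_ord /= mulr_sumr; congr (_ + _).
by apply: eq_bigr => i _; rewrite exprD.
Qed.

Lemma qnum_geom m : (1 - 'X) * qnum m = 1 - 'X^m.
Proof.
elim: m => [|m IH]; first by rewrite /qnum big_ord0 mulr0 expr0 subrr.
by rewrite /qnum big_ord_recr /= mulrDr -/(qnum m) IH exprS; ring.
Qed.

Lemma qnum_monic m : qnum m.+1 \is monic.
Proof.
have -> : qnum m.+1 = \poly_(i < m.+1) 1.
  by rewrite poly_def; apply: eq_bigr => i _; rewrite scale1r.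
by rewrite monicE lead_coef_poly ?oner_eq0.
Qed.

Lemma qfactS m : qfact m.+1 = qfact m * qnum m.+1.
Proof. by rewrite /qfact big_nat_recr. Qed.

Lemma qfact0 : qfact 0 = 1.
Proof. by rewrite /qfact big_geq. Qed.

Lemma qfact_monic m : qfact m \is monic.
Proof.
elim: m => [|m IH]; first by rewrite qfact0 monic1.
by rewrite qfactS monicMl // qnum_monic.
Qed.

Lemma qfact_neq0 m : qfact m != 0.
Proof. by rewrite monic_neq0 ?qfact_monic. Qed.

(** Gaussian binomials by the Pascal recursion; [qbinomE] identifies them with the Euclidean
    quotients in [qbinom]. *)
Fixpoint gauss a b : {poly int} :=
  match a, b with
  | _, 0 => 1
  | 0, _.+1 => 0
  | a'.+1, b'.+1 => 'X^(b'.+1) * gauss a' b'.+1 + gauss a' b'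
  end.

Lemma gauss_n0 a : gauss a 0 = 1.
Proof. by case: a. Qed.

Lemma gauss_small a b : (a < b)%N -> gauss a b = 0.
Proof.
by elim: a b => [|a IH] [|b] //= ab; rewrite (IH b.+1) ?(IH b) ?mulr0 ?addr0 //; lia.
Qed.

Lemma gauss_fact b r : gauss (b + r) b * (qfact b * qfact r) = qfact (b + r).
Proof.
have [a] := ubnP (b + r); elim: a => // a IH in b r *; rewrite ltnS => ar.
case: b ar => [|b] ar; first by rewrite gauss_n0 add0n mul1r qfact0 mul1r.
case: r ar => [|r] ar.
  have := IH b 0%N; rewrite addn0 in ar *; rewrite addn0 qfact0 !mulr1 => {}IH.
  by rewrite /= gauss_small // mulr0 add0r qfactS mulrA IH //; lia.
rewrite addSn /= mulrDl.
have E1 := IH b.+1 r; have E2 := IH b r.+1.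
rewrite -!mulrA; have -> : (b + r.+1 = b.+1 + r)%N by lia.
have -> : gauss (b.+1 + r) b.+1 * (qfact b.+1 * qfact r.+1) = qfact (b.+1 + r) * qnum r.+1.
  by rewrite [qfact r.+1]qfactS -E1; [ring|lia].
have -> : gauss (b.+1 + r) b * (qfact b.+1 * qfact r.+1) = qfact (b.+1 + r) * qnum b.+1.
  have -> : (b.+1 + r = b + r.+1)%N by lia.
  by rewrite [qfact b.+1]qfactS -E2; [ring|lia].
rewrite [RHS]qfactS; have -> : ((b.+1 + r).+1 = b.+1 + r.+1)%N by lia.
by rewrite qnumD; ring.
Qed.

Lemma gauss_sym b r : gauss (b + r) b = gauss (b + r) r.
Proof.
have E1 := gauss_fact b r; have E2 := gauss_fact r b; rewrite addnC in E2.
apply: (mulIf (x := qfact b * qfact r)); first by rewrite mulf_neq0 ?qfact_neq0.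
by rewrite E1 -E2 addnC; ring.
Qed.

(** The other Pascal rule, obtained from the defining one by [gauss_sym]. *)
Lemma gauss_pascal a b : (b <= a)%N -> gauss a.+1 b.+1 = gauss a b.+1 + 'X^(a - b) * gauss a b.
Proof.
move=> ba; have [r ->] : exists r, (a = b + r)%N by exists (a - b)%N; lia.
rewrite addKn; case: r {ba} => [|r].
  by rewrite addn0 /= (@gauss_small b b.+1) // mulr0 expr0 mul1r.
have -> : (b + r.+1).+1 = (b.+1 + r.+1)%N by lia.
rewrite gauss_sym.
have -> : (b.+1 + r.+1 = (b + r.+1).+1)%N by lia.
rewrite [LHS]/= [gauss (b + r.+1) b]gauss_sym.
have -> : (b + r.+1 = b.+1 + r)%N by lia.
by rewrite [in RHS]gauss_sym addrC.
Qed.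

Lemma qbinomE a b : qbinom a (Posz b) = gauss a b.
Proof.
rewrite /qbinom; case: leqP => ab; last by rewrite gauss_small.
have E := gauss_fact b (a - b); rewrite subnKC // in E.
by rewrite -E Pdiv.IdomainMonic.mulpK ?monicMl ?qfact_monic.
Qed.

Lemma qbinom_neg a (z : int) : z < 0 -> qbinom a z = 0.
Proof. by case: z. Qed.

Lemma gauss1 a b : (gauss a b).[1] = 'C(a, b)%:R.
Proof.
elim: a b => [|a IH] [|b] /=; rewrite ?hornerC ?bin0 //.
by rewrite hornerD hornerM hornerXn expr1n mul1r !IH binS natrD.
Qed.

(** One Pascal step of each kind. This is the recurrence that a further factor [cfac] imposes on the
    coefficients of [char_prod]. *)
Lemma gauss_step2 M s : (s <= M)%N -> gauss M.+2 s.+2 =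
  'X^(s.+2) * gauss M s.+2 + ('X^(M.+1) + 1) * gauss M s.+1 + 'X^(M - s) * gauss M s.
Proof.
move=> sM; have -> : gauss M.+2 s.+2 = 'X^(s.+2) * gauss M.+1 s.+2 + gauss M.+1 s.+1 by [].
rewrite [gauss M.+1 s.+1]gauss_pascal //.
case: (ltnP s M) => sM1; last first.
  have -> : s = M by lia.
  rewrite (@gauss_small M.+1 M.+2) // (@gauss_small M M.+1) // (@gauss_small M M.+2) //.
  by rewrite subnn; ring.
rewrite [gauss M.+1 s.+2]gauss_pascal //.
have -> : 'X^(M.+1) = 'X^(s.+2) * 'X^(M - s.+1) :> {poly int}.
  by rewrite -exprD; congr (_ ^+ _); lia.
ring.
Qed.

Lemma gauss_step1 M : gauss M.+2 1 = 'X * gauss M 1 + ('X^(M.+1) + 1).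
Proof.
have -> : gauss M.+2 1 = 'X^1 * gauss M.+1 1 + 1 by [].
by rewrite gauss_pascal // gauss_n0 subn0 mulr1 expr1 [in RHS]exprS; ring.
Qed.

End Gauss.

Lemma PoszS m : (m.+1)%:Z = m%:Z + 1.
Proof. by rewrite -addn1 PoszD. Qed.

(** * Coefficients of graded characters *)

Section Specialization.
Variables (C : numClosedFieldType) (p : nat).
Hypothesis hp : p = 0%N \/ p = 1%N.

(** q-integers are read in the variable [t] with [q = t^2]. *)
Definition qsq (f : {poly int}) : {poly C} := (map_poly intr f) \Po 'X^2.

Lemma qsqM f g : qsq (f * g) = qsq f * qsq g.
Proof. by rewrite /qsq rmorphM /= comp_polyM. Qed.

Lemma qsqD f g : qsq (f + g) = qsq f + qsq g.
Proof. by rewrite /qsq rmorphD /= comp_polyD. Qed.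

Lemma qsq1 : qsq 1 = 1.
Proof. by rewrite /qsq rmorph1 comp_polyC. Qed.

Lemma qsqXn m : qsq 'X^m = 'X^(2 * m).
Proof. by rewrite /qsq map_polyXn comp_Xn_poly exprM. Qed.

Lemma qsqXM m f : qsq ('X^m * f) = 'X^(2 * m) * qsq f.
Proof. by rewrite qsqM qsqXn. Qed.

Lemma qsqX : qsq 'X = 'X^2.
Proof. by rewrite /qsq map_polyX comp_polyX. Qed.

Lemma qsq0 : qsq 0 = 0.
Proof. by rewrite /qsq rmorph0 comp_poly0. Qed.

Definition cfac (c : nat) : {poly {poly C}} := ('X^c *: 'X + 1) * ('X + ('X^c)%:P).

Definition char_prod (c : nat -> nat) K : {poly {poly C}} :=
  (\prod_(a < K) cfac (c a)) * (1 + 'X) ^+ p.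

Lemma char_prodS c K : char_prod c K.+1 = char_prod c K * cfac (c K).
Proof. by rewrite /char_prod big_ord_recr /= mulrAC. Qed.

Lemma cfacE c : cfac c = 'X^c *: 'X^2 + ('X^(2 * c) + 1) *: 'X + ('X^c)%:P.
Proof.
rewrite /cfac mulrDl mul1r mulrDr -scalerAl -expr2 -scalerAl [in 'X * _]mulrC mul_polyC.
by rewrite scalerA -exprD addnn -mul2n scalerDl scale1r; ring.
Qed.

Lemma coef_mul_cfac f c s : (f * cfac c)`_s =
  'X^c * (if s is s'.+2 then f`_s' else 0) +
  ('X^(2 * c) + 1) * (if s is s'.+1 then f`_s' else 0) + 'X^c * f`_s.
Proof.
rewrite cfacE !mulrDr -!scalerAr !coefD !coefZ coefMXn coefMX coefMC [_ * 'X^c]mulrC.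
by case: s => [|[|s]] //=; rewrite ?subn2.
Qed.

(** With M = 2a + p and q = t^2, this choice makes the middle coefficient t^(2c) + 1 of [cfac c]
    equal to q^(M+1) + 1, as [gauss_step2] requires. *)
Definition cgrade a := (2 * a + 1 + p)%N.

(** The two factors are equal or consecutive integers for the allowed [p], so the product is
    nonnegative and [absz] changes nothing. *)
Definition cexp (K s : nat) : nat := absz ((K%:Z - s%:Z) * (K%:Z + p%:Z - s%:Z)).

Lemma cexpE K s : (cexp K s)%:Z = (K%:Z - s%:Z) * (K%:Z + p%:Z - s%:Z).
Proof.
rewrite /cexp abszE ger0_norm //; case: hp => ->.
  by rewrite addr0 -expr2 sqr_ge0.
case: (leqP s K) => sK; first by rewrite mulr_ge0 //; lia.
by rewrite mulr_le0 //; lia.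
Qed.

(** A symmetric form of the finite q-binomial theorem: each factor raises the upper index by 2,
    while [E1] and [E2] track the powers of t. *)
Lemma coef_char_prod K s :
  (char_prod cgrade K)`_s = 'X^(cexp K s) * qsq (gauss (2 * K + p) s).
Proof.
elim: K s => [|K IH] s.
  rewrite /char_prod big_ord0 mul1r muln0 add0n; case: hp => pE.
    rewrite pE expr0 coef1; case: s => [|s] /=; last by rewrite qsq0 mulr0.
    by rewrite qsq1 mulr1 /cexp pE subr0 mul0r.
  rewrite pE expr1 coefD coef1 coefX; case: s => [|[|s]] /=.
  - by rewrite qsq1 mulr1 addr0 /cexp subr0 mul0r.
  - by rewrite mulr0 !add0r qsq1 mulr1 /cexp pE subrr mulr0.
  - by rewrite mulr0 !addr0 qsq0 mulr0.
rewrite char_prodS coef_mul_cfac !IH.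
have -> : (2 * K.+1 + p = (2 * K + p).+2)%N by lia.
have c1 : (cgrade K = (2 * K + p).+1)%N by rewrite /cgrade; lia.
have E1 t : (cgrade K + cexp K t = cexp K.+1 t + 2 * t)%N.
  apply/eqP; rewrite -eqz_nat !PoszD !cexpE; apply/eqP.
  by rewrite !PoszS; ring.
have E2 t : cexp K t = cexp K.+1 t.+1.
  apply/eqP; rewrite -eqz_nat !cexpE !PoszS; apply/eqP; ring.
case: s => [|s].
  by rewrite !mulr0 !add0r !gauss_n0 mulrA -exprD E1 muln0 addn0.
case: s => [|s].
  rewrite mulr0 add0r !IH gauss_n0 qsq1 mulr1 [X in _ + X]mulrA -exprD E1.
  by rewrite gauss_step1 !qsqD qsqM qsq1 qsqXn qsqX c1 (E2 0%N) exprD; ring.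
rewrite !IH; case: (leqP s (2 * K + p)) => sK; last first.
  by rewrite !gauss_small ?qsq0 ?mulr0 ?addr0 //; lia.
rewrite gauss_step2 // !qsqD !qsqXM qsqM qsqD qsqXn qsq1 (E2 s.+1).
rewrite [X in X + _ + _]mulrA [X in _ + _ + X]mulrA -!exprD (E1 s.+2).
have -> : (cgrade K + cexp K s = cexp K.+1 s.+2 + 2 * (2 * K + p - s))%N.
  apply/eqP; rewrite -eqz_nat PoszD PoszD PoszM -subzn // !cexpE /cgrade; apply/eqP.
  by rewrite !PoszS !PoszD; ring.
by rewrite c1 !exprD; ring.
Qed.

(** The symmetry of Gaussian binomials turns the index K + p + u into K - u, the form in which the
    entries of [MD] are written. *)
Lemma coef_char_prod_qbinom K u :
  (char_prod cgrade K)`_(K + p + u) =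
  'X^(u * (u + p)) * qsq (qbinom (2 * K + p) (K%:Z - u%:Z)).
Proof.
rewrite coef_char_prod; congr ('X^_ * _).
  by apply/eqP; rewrite -eqz_nat cexpE PoszM !PoszD; apply/eqP; ring.
case: (leqP u K) => uK; last by rewrite gauss_small ?qbinom_neg //; lia.
rewrite subzn // qbinomE.
have -> : (2 * K + p = (K - u) + (K + p + u))%N by lia.
by rewrite gauss_sym.
Qed.

Lemma char_prod0 K : char_prod (fun=> 0%N) K = (1 + 'X) ^+ (2 * K + p).
Proof.
rewrite /char_prod prodr_const card_ord /cfac expr0 scale1r addrC -expr2 -exprM.
by rewrite -exprD.
Qed.

Lemma coef_char_prod0 K s : (char_prod (fun=> 0%N) K)`_s = 'C(2 * K + p, s)%:R.
Proof.
rewrite char_prod0 addrC; elim: (2 * K + p)%N s => [|m IH] [|s].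
- by rewrite expr0 coef1.
- by rewrite expr0 coef1.
- by rewrite exprS mulrDl mul1r coefD coefXM IH add0r !bin0.
- by rewrite exprS mulrDl mul1r coefD coefXM !IH /= binS natrD addrC.
Qed.

End Specialization.

Section LinearProducts.
Variables (R : idomainType) (a b : nat -> R).

Definition lin_prod m : {poly R} := \prod_(l < m) (a l *: 'X + (b l)%:P).

Lemma lin_prodS m : lin_prod m.+1 = (a m *: 'X + (b m)%:P) * lin_prod m.
Proof. by rewrite /lin_prod big_ord_recr mulrC. Qed.

Lemma size_lin_prod m : (size (lin_prod m) <= m.+1)%N.
Proof.
elim: m => [|m IH]; first by rewrite /lin_prod big_ord0 size_poly1.
rewrite lin_prodS; apply: leq_trans (size_polyMleq _ _) _.
have : (size ((a m *: 'X + (b m)%:P)%R) <= 2)%N.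
  by rewrite -mul_polyC size_MXaddC; case: ifP => // _; rewrite ltnS size_polyC_leq1.
lia.
Qed.

Lemma lead_lin_prod m : (lin_prod m)`_m = \prod_(l < m) a l.
Proof.
elim: m => [|m IH]; first by rewrite /lin_prod !big_ord0 coef1.
rewrite lin_prodS big_ord_recr /= -IH mulrDl coefD -scalerAl coefZ coefXM /=.
rewrite mul_polyC coefZ [(lin_prod m)`_m.+1]nth_default ?mulr0 ?addr0 ?size_lin_prod //.
by rewrite mulrC.
Qed.

End LinearProducts.

Section Determinant.
Variables (C : numClosedFieldType) (p n : nat) (c : nat -> nat) (k : nat).

Local Notation lin_prod := (lin_prod (fun l => 'X^(c (k + l)) : {poly C})
  (fun l => 'X^(2 * c (k + l)) + 1)).

(** Homogenised at y = x + 1/x, the linear factor t^c y + t^(2c) + 1 becomes [cfac c]. With these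
    rows, row [i] extends the product over a < k in the character to one over a < k + i; for [c]
    zero they are the (y + 2)^i. *)
Lemma recip_lin_prod N m : (m <= N)%N ->
  recip N (lin_prod m) = 'X^(N - m) * \prod_(l < m) cfac C (c (k + l)).
Proof.
elim: m => [|m IH] mN.
  by rewrite /lin_prod !big_ord0 recipC scale1r subn0 mulr1.
apply: (mulfI (x := 'X)); first by rewrite polyX_eq0.
rewrite lin_prodS recip_lin; last first.
  by apply: leq_trans (size_lin_prod _ _ m) mN.
rewrite IH ?(ltnW mN) // big_ord_recr /=.
have -> : 'X^(N - m) = 'X * 'X^(N - m.+1) :> {poly {poly C}} by rewrite -exprS subnSK.
by rewrite [in RHS]cfacE scalerDr alg_polyC; ring.
Qed.

Lemma char_prod_add m : char_prod C p c (k + m) = (\prod_(l < m) cfac C (c (k + l))) * char_prod C p c k.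
Proof. by rewrite /char_prod big_split_ord /= mulrA; congr (_ * _); rewrite mulrC. Qed.

(** The product on the left collects the leading coefficients of the rows; removing X^(n-1-i) from
    row [i] gives the index h j + i + j. *)
Lemma den_char_prod (M : 'X_{1..n}) (h : 'I_n -> nat) :
  (forall j, M (rev_ord j) = h j + j + n.-1)%N ->
  (\prod_(i < n) \prod_(l < i) 'X^(c (k + l))) *
    (weyl_den {poly C} n * \prod_j mev (char_prod C p c k) j)@_M =
  \det (\matrix_(i < n, j < n) (char_prod C p c (k + i))`_(h j + i + j)).
Proof.
move=> hM; have := den_mul_coeff (p := fun i : 'I_n => lin_prod i) (char_prod C p c k) M
  (fun i => size_lin_prod _ _ i).
under eq_bigr do rewrite lead_lin_prod.
move=> ->; congr (\det _); apply/matrixP=> i j; rewrite !mxE.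
have i_n : (i <= n.-1)%N by have := ltn_ord i; lia.
rewrite recip_lin_prod // -mulrA -char_prod_add coefXnM hM.
case: ltnP => H; first by lia.
by congr (_ `_ _); lia.
Qed.

End Determinant.

Lemma dominant_abs n (lam : 'I_n -> int) : dominant_D lam ->
  forall i j : 'I_n, (i < j)%N -> `|lam j| <= lam i.
Proof.
move=> [d1 d2] i j ij; have jn := ltn_ord j.
have d1' (a b : 'I_n) : (a <= b)%N -> lam b <= lam a.
  by rewrite leq_eqVlt => /orP[/eqP/val_inj->//|/d1].
case: (eqVneq j.+1 n) => jE.
  have h : (n.-2 < n)%N by lia.
  apply: le_trans (d1' i (Ordinal h) _); last by rewrite /=; lia.
  by apply: d2 => //=; lia.
have h1 : (n.-2 < n)%N by lia.
have h2 : (n.-1 < n)%N by lia.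
have : `|lam (Ordinal h2)| <= lam j.
  apply: le_trans (d1' j (Ordinal h1) _); last by rewrite /=; lia.
  by apply: d2 => //=; lia.
by move=> /(le_trans (normr_ge0 _)) h; rewrite ger0_norm // d1.
Qed.

Section WeightCoefficients.
Variables (C : numClosedFieldType) (n k p : nat) (lam : 'I_n -> int).
Hypotheses (hp : p = 0%N \/ p = 1%N) (hdom : dominant_D lam) (hlam : forall i, (absz (lam i) <= k)%N).

Definition col_shift (j : 'I_n) : nat := (j + absz (lam (rev_ord j)))%N.

Lemma MD_col_shift : MD k p lam =
  \det (\matrix_(i < n, j < n) qbinom (2 * (k + i) + p) ((k + i)%:Z - (col_shift j)%:Z)).
Proof.
congr (\det _); apply/matrixP=> i j; rewrite !mxE; congr qbinom.
by rewrite /col_shift !PoszD abszE opprD addrA.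
Qed.

(** [s] tells whether the last coordinate of the weight is negative: this covers
    both half-spin shifts and both signs of lambda_n. *)
Definition signed_weight (s : bool) (i : 'I_n) : rat :=
  let w := (absz (lam i))%:R + p%:R / 2 in if s && (i.+1 == n) then - w else w.

(** [signed_weight] shifted by k + p/2; the two halves add up to [p] or cancel. *)
Definition signed_index (s : bool) (i : 'I_n) : nat :=
  (if s && (i.+1 == n) then k - absz (lam i) else k + p + absz (lam i))%N.

Lemma signed_indexE s i :
  (signed_index s i)%:R = ratr (signed_weight s i) + k%:R + p%:R / 2 :> C.
Proof.
have E a : ratr (a%:R + p%:R / 2) = a%:R + p%:R / 2 :> C.
  by rewrite raddfD /= fmorph_div /= !ratr_nat.
rewrite /signed_index /signed_weight /=; case: ifP => _; last first.
  by rewrite E !natrD; field.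
by rewrite natrB // raddfN /= E; field.
Qed.

Lemma signed_weight_dom s (i j : 'I_n) : (i < j)%N ->
  0 <= ratr (signed_weight s i) - ratr (signed_weight s j) :> C /\
  0 <= ratr (signed_weight s i) + ratr (signed_weight s j) :> C.
Proof.
move=> ij; rewrite -rmorphB -rmorphD !ler0q /= /signed_weight.
have jn := ltn_ord j; have -> : (i.+1 == n) = false by apply/eqP; lia.
have : (absz (lam j) <= absz (lam i))%N.
  by rewrite -lez_nat !abszE; apply: le_trans (dominant_abs hdom ij) (ler_norm _).
rewrite -(ler_nat rat) andbF; set a := _%:R; set b := _%:R => ab.
have a0 : 0 <= a by exact: ler0n.
have p0 : (0 : rat) <= p%:R by exact: ler0n.
by case: ifP => _; split; lra.
Qed.

(** [V] and [c] are left open because two gradings are used: [cgrade] for positivity, and the zero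
    grading for multiplicities in the spin power. *)
Lemma char_prod_coeff V c s :
  has_char (C := C) (n := n) V (2 * k + p) (\prod_i mev (char_prod C p c k) i) ->
  exists F : {poly C},
    [/\ (\prod_(i < n) \prod_(l < i) 'X^(c (k + l))) * F =
        \det (\matrix_(i < n, j < n) (char_prod C p c (k + i))`_(signed_index s (rev_ord j) + i + j)),
        forall r, exists m : nat, F`_r = m%:R &
        exists m : nat, F.[1] = m%:R /\
          forall V0, irrep_of_weight (signed_weight s) V0 -> multiplicity V0 V m].
Proof.
move=> hV.
pose M : 'X_{1..n} := [multinom (signed_index s i + rev_ord i + n.-1)%N | i < n].
exists ((weyl_den {poly C} n * \prod_j mev (char_prod C p c k) j)@_M).
have hM i : (M i)%:R = ratr (signed_weight s i) + @rho_ C n i + n.-1%:R + (2 * k + p)%:R / 2.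
  by rewrite mnmE 2!natrD signed_indexE /rho_ /= (natrD _ (2 * k)) natrM; field.
have [h1 [m [mE mV]]] := graded_char_coeff hV (signed_weight_dom s) hM.
split=> //.
  by apply: den_char_prod => j; rewrite mnmE rev_ordK.
exists m; split=> // V0 [irr [v hv]]; apply: mV => //; exists v.
exact: highest_weight_vectorE.
Qed.

Lemma det_graded :
  \det (\matrix_(i < n, j < n) (char_prod C p (cgrade p) (k + i))`_(signed_index false (rev_ord j) + i + j)) =
  'X^(\sum_j col_shift j * (col_shift j + p)) * qsq C (MD k p lam).
Proof.
rewrite MD_col_shift /qsq -det_map_mx -(det_map_mx (comp_poly _)) -prodrXr.
set A := map_mx _ _.
have -> : \matrix_(i < n, j < n) (char_prod C p (cgrade p) (k + i))`_(signed_index false (rev_ord j) + i + j) =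
    A *m diag_mx (\row_j 'X^(col_shift j * (col_shift j + p))).
  apply/matrixP=> i j; rewrite mul_mx_diag !mxE /signed_index /=.
  have -> : (k + p + absz (lam (rev_ord j)) + i + j = (k + i) + p + col_shift j)%N.
    by rewrite /col_shift; lia.
  by rewrite coef_char_prod_qbinom // mulrC.
rewrite det_mulmx det_diag mulrC; congr (_ * _).
by apply: eq_bigr => j _; rewrite mxE.
Qed.

(** A negative last coordinate replaces the index K + p + u by its mirror image K - u, with the same
    binomial. Only column 0, where u = |lambda_n|, is affected. *)
Lemma det_ungraded s :
  (\det (\matrix_(i < n, j < n) (char_prod C p (fun=> 0%N) (k + i))`_(signed_index s (rev_ord j) + i + j))).[1] =
  ((MD k p lam).[1])%:~R.
Proof.
rewrite -[LHS]/(horner_eval 1 _) -[((MD _ _ _).[1])]/(horner_eval 1 _).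
rewrite MD_col_shift -!det_map_mx; congr (\det _); apply/matrixP=> i j; rewrite !mxE.
rewrite coef_char_prod0.
set K := (k + i)%N; set u := col_shift j.
have E : ('C(2 * K + p, K + p + u) = 'C(2 * K + p, K - u) * (u <= K))%N.
  case: leqP => uK; last by rewrite bin_small ?muln0 //; lia.
  by rewrite -bin_sub ?muln1; [congr 'C(_, _); lia|lia].
have : (qbinom (2 * K + p) (K%:Z - u%:Z)).[1] = ('C(2 * K + p, K - u) * (u <= K))%:R.
  case: leqP => uK; last by rewrite qbinom_neg ?horner0 ?muln0 //; lia.
  by rewrite subzn // qbinomE gauss1 muln1.
move: (qbinom _ _) => Q EQ; rewrite /= /horner_eval EQ hornerMn hornerC [RHS]rmorph_nat; congr (_%:R).
rewrite -E /signed_index /K /u /col_shift.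
case: ifP => [/andP[_ /eqP jE]|_]; last by congr 'C(_, _); lia.
have j0 : nat_of_ord j = 0%N by move: jE => /=; have := ltn_ord j; lia.
have := hlam (rev_ord j); rewrite j0 !addn0 add0n; set L := absz _ => Lk.
by rewrite -bin_sub; [congr 'C(_, _); lia|lia].
Qed.

Lemma has_char_char_prod c K :
  exists V, has_char (C := C) (n := n) V (2 * K + p) (\prod_i mev (char_prod C p c K) i).
Proof.
elim: K => [|K [V hV]].
  exists (rep_pow (spin_rep C n) p); rewrite /char_prod big_ord0 mul1r.
  have := has_char_pow p (has_char_spin C n); rewrite muln1 -prodrXl.
  by congr has_char; apply: eq_bigr => i _; rewrite /mev rmorphXn horner_exp.
exists (rep_tens V (ext_rep C n)); have := has_char_tens hV (has_char_ext C n (c K)).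
rewrite -big_split; congr has_char; first by lia.
by apply: eq_bigr => i _ /=; rewrite char_prodS -mevM.
Qed.

Lemma MD_pos r : 0 <= (MD k p lam)`_r.
Proof.
have [V hV] := has_char_char_prod (cgrade p) k.
have [F [FE Fnat _]] := char_prod_coeff false hV.
have E : \prod_(i < n) \prod_(l < i) 'X^(cgrade p (k + l)) =
    'X^(\sum_(i < n) \sum_(l < i) cgrade p (k + l)) :> {poly C}.
  by rewrite -prodrXr; apply: eq_bigr => i _; rewrite prodrXr.
move: FE; rewrite det_graded E; set a := (\sum_(i < n) _)%N; set b := (\sum_j _)%N => FE.
(* [qsq] puts the coefficient of q^r at t^(2r); [b] is the power of t taken out of the columns, and
   [a] the one from the leading coefficients of the rows. *)
have : ((MD k p lam)`_r)%:~R = ('X^a * F)`_(b + 2 * r) :> C.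
  rewrite FE coefXnM ltnNge leq_addr /= addKn coef_comp_poly_Xn // dvdn_mulr //.
  by rewrite mulKn // coef_map.
rewrite coefXnM; case: ifP => _; first by move=> /eqP; rewrite intr_eq0 => /eqP->.
by have [m ->] := Fnat (b + 2 * r - a)%N => Em; rewrite -(ler0z C) Em ler0n.
Qed.

Lemma spin_pow_multiplicity s : exists m : nat, m%:Z = (MD k p lam).[1] /\
  forall V, irrep_of_weight (signed_weight s) V ->
  multiplicity V (rep_pow (spin_rep C n) (2 * k + p)) m.
Proof.
have hW : has_char (rep_pow (spin_rep C n) (2 * k + p)) (2 * k + p)
    (\prod_i mev (char_prod C p (fun=> 0%N) k) i).
  have := has_char_pow (2 * k + p) (has_char_spin C n); rewrite muln1 -prodrXl char_prod0.
  by congr has_char; apply: eq_bigr => i _; rewrite /mev rmorphXn horner_exp.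
have [F [FE _ [m [Fm mV]]]] := char_prod_coeff s hW.
exists m; split=> //; apply/eqP; rewrite -(eqr_int C) -(det_ungraded s) -FE.
rewrite [X in X * _]big1 ?mul1r ?Fm -?pmulrn // => i _.
by rewrite big1 // => l _; rewrite expr0.
Qed.

End WeightCoefficients.

(** * The product formula *)

Lemma prod_ord_lt (R : comPzSemiRingType) n (F : nat -> R) :
  \prod_(i < n) \prod_(l < i) F l = \prod_(s : 'I_n * 'I_n | pair_lt s) F s.1.
Proof.
rewrite (eq_bigr (fun i : 'I_n => \prod_(l < n | (l < i)%N) F l)); last first.
  by move=> i _; rewrite (big_ord_widen_cond n xpredT F (ltnW (ltn_ord i))).
by rewrite (exchange_big_dep xpredT) //= pair_big_dep.
Qed.

Lemma qfact_falling m i : (i <= m)%N ->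
  qfact m = qfact (m - i) * \prod_(l < i) qnum (m - l).
Proof.
elim: i => [|i IH] im; first by rewrite big_ord0 mulr1 subn0.
rewrite IH ?(ltnW im) // big_ord_recr /=.
by rewrite -(subnSK im) qfactS; ring.
Qed.

(** [A] will be k + n - 1, with rows counted from the bottom. When [v] exceeds [A - i] the binomial
    is zero, and so is the factor with [l = A - v] on the right. *)
Lemma qbinom_entry p A i v : (i <= A)%N -> (v <= A)%N ->
  qbinom (2 * (A - i) + p) ((A - i)%:Z - v%:Z) * (qfact (A - v) * qfact (A + p + v)) =
  qfact (2 * (A - i) + p) * \prod_(l < i) (qnum (A - v - l) * qnum (A + p + v - l)).
Proof.
move=> iA vA; case: (leqP v (A - i)) => h; last first.
  rewrite qbinom_neg ?mul0r; last by lia.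
  have h' : (A - v < i)%N by lia.
  rewrite (bigD1 (Ordinal h')) //= subnn; have -> : qnum 0 = 0 by rewrite /qnum big_ord0.
  by rewrite !mul0r mulr0.
rewrite subzn // qbinomE big_split /=.
rewrite (@qfact_falling (A - v) i); last by lia.
rewrite (@qfact_falling (A + p + v) i); last by lia.
have := gauss_fact (A - i - v) (A + p + v - i).
have -> : (A - i - v + (A + p + v - i) = 2 * (A - i) + p)%N by lia.
move=> <-; have -> : (A - v - i = A - i - v)%N by lia.
by ring.
Qed.

Section QuantumVandermonde.
Variables (n A p : nat) (v : 'I_n -> nat).
Variables (K : fieldType) (f : {rmorphism {poly int} -> K}).
Hypotheses (f_inj : injective f) (v_lt : forall i j : 'I_n, (i < j)%N -> (v j < v i)%N)
  (v_le : forall i : 'I_n, (v i + i <= A)%N).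

Let q : K := f 'X.

Let node m : K := q ^- m + q ^+ (m + p).

Lemma frac_geom m : (1 - q) * f (qnum m) = 1 - q ^+ m.
Proof. by rewrite -(rmorph1 f) -(rmorphXn f) -!(rmorphB f) -(rmorphM f) qnum_geom. Qed.

Lemma frac_q_neq0 : q != 0.
Proof. by rewrite -(rmorph0 f) (inj_eq f_inj) polyX_eq0. Qed.

Lemma frac_q_neq1 : 1 - q != 0.
Proof.
rewrite -(rmorph1 f) -(rmorphB f) -(rmorph0 f) (inj_eq f_inj); apply/eqP => /(congr1 (fun g : {poly int} => g`_0)).
by rewrite coefB coef1 coefX coef0.
Qed.

(** The entries are polynomials of degree [i] in [q^-v + q^(v + p)]. *)
Lemma node_factor m l : (m + l <= A)%N ->
  (1 - q) ^+ 2 * (f (qnum (A - m - l)) * f (qnum (A + p + m - l))) =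
  - q ^+ (A - l) * node m + (1 + q ^+ (2 * A + p - 2 * l)).
Proof.
move=> h; rewrite expr2 mulrACA !frac_geom /node.
have -> : (A - l = A - m - l + m)%N by lia.
have -> : (2 * A + p - 2 * l = (A - m - l) + (A + p + m - l))%N by lia.
have -> : (A + p + m - l = A - m - l + m + (m + p))%N by lia.
set B := (A - m - l)%N; rewrite !exprD; have := expf_neq0 m frac_q_neq0.
by move: (q ^+ m) => x x0; field.
Qed.

Lemma node_sub a b : (b <= a)%N ->
  node b - node a =
  - q ^- a * ((1 - q) ^+ 2 * (f (qnum (a - b)) * f (qnum (a + b + p)))).
Proof.
move=> ba; rewrite expr2 mulrACA !frac_geom /node.
have [r ->] : exists r, (a = b + r)%N by exists (a - b)%N; lia.
rewrite addKn !exprD; have := expf_neq0 b frac_q_neq0; have := expf_neq0 r frac_q_neq0.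
by move: (q ^+ b) (q ^+ r) => x y x0 y0; field; rewrite x0 y0.
Qed.

(** By [node_factor] each entry, times a power of (1 - q)^2, is the value at [node (v j)] of a
    product of [i] linear polynomials, so [det_size_poly] applies. The powers of (1 - q)^2 cancel
    against those from [node_sub]. *)
Lemma det_falling :
  \det (\matrix_(i < n, j < n) \prod_(l < i) (qnum (A - v j - l) * qnum (A + p + v j - l))) =
  \prod_(s : 'I_n * 'I_n | pair_lt s)
    ('X^(A - s.1 - v s.1) * (qnum (v s.1 - v s.2) * qnum (v s.1 + v s.2 + p))).
Proof.
apply: f_inj; rewrite -det_map_mx rmorph_prod.
pose P (i : 'I_n) := lin_prod (fun l => - q ^+ (A - l)) (fun l => 1 + q ^+ (2 * A + p - 2 * l)) i.
have := det_size_poly (fun j => node (v j)) (fun i : 'I_n => size_lin_prod _ _ i : size (P i) <= i.+1)%N.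
under eq_bigr do rewrite /P lead_lin_prod.
rewrite (prod_ord_lt n (fun l => - q ^+ (A - l))) -big_split /=.
pose D : 'rV[K]_n := \row_i \prod_(l < i) (1 - q) ^+ 2.
have -> : \matrix_(i, j) (P i).[node (v j)] = diag_mx D *m
    map_mx f (\matrix_(i < n, j < n) \prod_(l < i) (qnum (A - v j - l) * qnum (A + p + v j - l))).
  apply/matrixP=> i j; rewrite mul_diag_mx !mxE rmorph_prod -big_split horner_prod /=.
  have vA := v_le j; have vA' : (v j <= A)%N := leq_trans (leq_addr _ _) vA.
  case: (leqP i (A - v j)) => h.
    apply: eq_bigr => l _; rewrite hornerD hornerZ hornerX hornerC rmorphM -node_factor //.
    by have := ltn_ord l; lia.
  (* Beyond [l = A - v j] the natural subtraction truncates and [node_factor] does not apply, but at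
     this [l] both products already have a zero factor. *)
  rewrite (bigD1 (Ordinal h)) //= [RHS](bigD1 (Ordinal h)) //=.
  rewrite hornerD hornerZ hornerX hornerC -node_factor ?subnKC // subnn.
  have -> : qnum 0 = 0 by rewrite /qnum big_ord0.
  by rewrite !(mul0r, rmorph0, mulr0).
rewrite det_mulmx det_diag; under eq_bigr do rewrite mxE.
rewrite (prod_ord_lt n (fun l => (1 - q) ^+ 2)).
set x := \prod_(s | _) _ => E; have x0 : x != 0.
  by apply/prodf_neq0 => s _; rewrite expf_neq0 ?frac_q_neq1.
apply: (mulfI x0); rewrite E -big_split; apply: eq_bigr => s /= sl.
rewrite node_sub ?(ltnW (v_lt sl)) // !rmorphM /= rmorphXn /= -/q.
have -> : (A - s.1 = A - s.1 - v s.1 + v s.1)%N by have := v_le s.1; lia.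
rewrite addnK exprD; have := expf_neq0 (v s.1) frac_q_neq0.
by move: (q ^+ v s.1) => y y0; field.
Qed.

End QuantumVandermonde.

(** [rev_ord j] is the first component of exactly [j] pairs. *)
Lemma prod_pair_fst (R : comPzSemiRingType) n (F : 'I_n -> R) :
  \prod_(s : 'I_n * 'I_n | pair_lt s) F s.1 = \prod_(j < n) F (rev_ord j) ^+ j.
Proof.
pose r (s : 'I_n * 'I_n) := (rev_ord s.2, rev_ord s.1).
have rK : involutive r by move=> [i j]; rewrite /r /= !rev_ordK.
rewrite (reindex_inj (inv_inj rK)) /=.
rewrite (eq_bigl (fun s : 'I_n * 'I_n => (s.1 < s.2)%N)); last first.
  by case=> i j; rewrite /pair_lt /=; have := ltn_ord i; have := ltn_ord j; lia.
rewrite -(pair_big_dep xpredT (fun i j : 'I_n => (i < j)%N) (fun _ j => F (rev_ord j))) /=.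
rewrite (exchange_big_dep xpredT) //=; apply: eq_bigr => j _.
rewrite -(big_ord_widen_cond n xpredT (fun=> F (rev_ord j)) (ltnW (ltn_ord j))).
by rewrite prodr_const card_ord.
Qed.

Section ProductFormula.
Variables (n k p : nat) (lam : 'I_n -> int).
Hypotheses (hdom : dominant_D lam) (hlam : forall i, (absz (lam i) <= k)%N).

Let A := (k + n.-1)%N.
Let v (i : 'I_n) : nat := (rev_ord i + absz (lam i))%N.

(** Clearing factorials by [qbinom_entry] leaves the determinant of [det_falling]. Rows and columns
    are both reversed on the way, so the two permutation signs cancel. *)
Lemma MD_qfact :
  MD k p lam * \prod_i (qfact (A - v i) * qfact (A + p + v i)) =
  'X^(\sum_(i < n) i * (k - absz (lam (rev_ord i)))) *
  ((\prod_(i < n) qfact (2 * (A - i) + p)) *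
   \prod_(s : 'I_n * 'I_n | pair_lt s) (qnum (v s.1 - v s.2) * qnum (v s.1 + v s.2 + p))).
Proof.
have v_lt (i j : 'I_n) : (i < j)%N -> (v j < v i)%N.
  move=> ij; have : (absz (lam j) <= absz (lam i))%N.
    by rewrite -lez_nat !abszE; apply: le_trans (dominant_abs hdom ij) (ler_norm _).
  by rewrite /v /=; have := ltn_ord j; lia.
have v_le (i : 'I_n) : (v i + i <= A)%N.
  by rewrite /v /A /=; have := ltn_ord i; have := hlam i; lia.
have E : MD k p lam = \det (\matrix_(i < n, j < n)
    qbinom (2 * (A - i) + p) ((A - i)%:Z - (v j)%:Z)).
  rewrite MD_col_shift.
  have -> : \matrix_(i, j) qbinom (2 * (A - i) + p) ((A - i)%:Z - (v j)%:Z) =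
      row_perm (perm (@rev_ord_inj n)) (col_perm (perm (@rev_ord_inj n)) (\matrix_(i < n, j < n)
        qbinom (2 * (k + i) + p) ((k + i)%:Z - (col_shift lam j)%:Z))).
    apply/matrixP=> i j; rewrite !mxE !permE /col_shift rev_ordK -/(v j) /=.
    by have -> : (A - i = k + (n - i.+1))%N by rewrite /A; have := ltn_ord i; lia.
  rewrite row_permE col_permE !det_mulmx !det_perm mulrCA -signr_addb.
  by rewrite odd_permV addbb mulr1.
pose R : 'rV[{poly int}]_n := \row_i qfact (2 * (A - i) + p).
pose D : 'rV[{poly int}]_n := \row_j (qfact (A - v j) * qfact (A + p + v j)).
have -> : \prod_i (qfact (A - v i) * qfact (A + p + v i)) = \det (diag_mx D).
  by rewrite det_diag; apply: eq_bigr => i _; rewrite mxE.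
have -> : \prod_(i < n) qfact (2 * (A - i) + p) = \det (diag_mx R).
  by rewrite det_diag; apply: eq_bigr => i _; rewrite mxE.
rewrite E -det_mulmx; transitivity (\det (diag_mx R *m (\matrix_(i < n, j < n)
    \prod_(l < i) (qnum (A - v j - l) * qnum (A + p + v j - l))))).
  congr (\det _); apply/matrixP=> i j; rewrite mul_diag_mx mul_mx_diag !mxE.
  apply: qbinom_entry; last exact: leq_trans (leq_addr _ _) (v_le j).
  exact: leq_trans (leq_addl _ _) (v_le i).
rewrite det_mulmx
  (@det_falling n A p v _ (@tofrac {poly int} : {rmorphism _ -> {fraction {poly int}}})) //; last first.
  by move=> x y /eqP; rewrite tofrac_eq => /eqP.
rewrite big_split /= mulrCA; congr (_ * _).
rewrite (prod_pair_fst (fun i => 'X^(A - i - v i))) -prodrXr; apply: eq_bigr => i _.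
rewrite -exprM mulnC /v rev_ordK /A /=; congr ('X^(_ * _)).
by have := ltn_ord i; lia.
Qed.

End ProductFormula.

Lemma qnum_rat_nat x m : x = m%:R -> qnum_rat x = qnum m.
Proof. by move=> ->; rewrite /qnum_rat natrK. Qed.

Lemma qfact_rat_nat x m : x = m%:R -> qfact_rat x = qfact m.
Proof. by move=> ->; rewrite /qfact_rat natrK. Qed.

Lemma not_last_ge0 n (lam : 'I_n -> int) (last : 'I_n) :
  dominant_D lam -> last.+1 = n -> forall i, i != last -> 0 <= lam i.
Proof.
move=> hdom hlast i il; apply: le_trans (dominant_abs hdom (j := last) _); first exact: normr_ge0.
have : nat_of_ord i != last by rewrite val_eqE.
by have := ltn_ord i; lia.
Qed.

Lemma irrep_of_weight_ext (C : numClosedFieldType) n (mu nu : 'I_n -> rat) (V : so_rep C n) :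
  mu =1 nu -> irrep_of_weight mu V -> irrep_of_weight nu V.
Proof.
move=> E [irr [w [w0 hw hr]]]; split=> //; exists w; split=> // h.
by rewrite hw; congr (_ *: _); apply: eq_bigr => i _; rewrite E.
Qed.

Section RationalForm.
Variables (n k p : nat) (lam : 'I_n -> int) (last : 'I_n).
Hypotheses (hdom : dominant_D lam) (hlam : forall i, (absz (lam i) <= k)%N).
Hypotheses (hlast : last.+1 = n) (hneg : p = 0%N \/ 0 <= lam last).

Let A := (k + n.-1)%N.
Let v (i : 'I_n) : nat := (rev_ord i + absz (lam i))%N.

(** Under the section hypothesis a negative coordinate forces [p = 0], and then a_i is merely
    negated. This swaps two factorials in the denominator and two q-numbers in the numerator, so the
    formula in terms of [v] is the same. *)
Lemma a_E i : a_ p lam i =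
  if lam i < 0 then - (v i)%:R else (v i)%:R + p%:R / 2.
Proof.
rewrite /a_ /v natrD natrB ?ltn_ord //; case: ltP => li; last first.
  by rewrite -{1}(gez0_abs li) -pmulrn [(_ - _) + _]addrC.
have il : i = last.
  by apply/eqP; apply: contraLR li => /(not_last_ge0 hdom hlast); rewrite -leNgt.
have -> : p = 0%N by case: hneg => // h; move: li; rewrite il ltNge h.
have E : lam i = - (absz (lam i))%:Z by rewrite ltz0_abs // opprK.
by rewrite {1}E rmorphN /= -pmulrn il hlast; ring.
Qed.

Lemma neg_p i : lam i < 0 -> p = 0%N.
Proof.
move=> li; have il : i = last.
  by apply/eqP; apply: contraLR li => /(not_last_ge0 hdom hlast); rewrite -leNgt.
by case: hneg => // h; move: li; rewrite il ltNge h.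
Qed.

Lemma MD_formula : (MD k p lam)%:F = MD_product k p lam.
Proof.
have kn : k%:R + n%:R - 1 = A%:R :> rat.
  by rewrite /A natrD -hlast /= -[in LHS]natr1 addrA addrK.
have v_le i : (v i <= A)%N.
  by rewrite /v /A /=; have := ltn_ord i; have := hlam i; lia.
have denE : MD_den k p lam = \prod_i (qfact (A - v i) * qfact (A + p + v i)).
  apply: eq_bigr => i _; rewrite kn a_E; case: ltP => [/neg_p p0|_].
    rewrite mulrC (@qfact_rat_nat _ (A - v i)) ?(@qfact_rat_nat _ (A + p + v i)) //.
      by rewrite !natrD p0; ring.
    by rewrite natrB // p0; ring.
  rewrite (@qfact_rat_nat _ (A - v i)) ?(@qfact_rat_nat _ (A + p + v i)) //.
    by rewrite !natrD; field.
  by rewrite natrB //; field.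
have v_lt (i j : 'I_n) : (i < j)%N -> (v j < v i)%N.
  move=> ij; have : (absz (lam j) <= absz (lam i))%N.
    by rewrite -lez_nat !abszE; apply: le_trans (dominant_abs hdom ij) (ler_norm _).
  by rewrite /v /=; have := ltn_ord j; lia.
have numE : MD_num k p lam = (\prod_(i < n) qfact (2 * (A - i) + p)) *
   \prod_(s : 'I_n * 'I_n | pair_lt s) (qnum (v s.1 - v s.2) * qnum (v s.1 + v s.2 + p)).
  congr (_ * _).
    by apply: eq_bigr => i _; congr qfact; rewrite /A; have := ltn_ord i; lia.
  rewrite pair_big_dep /=; apply: eq_bigr => -[i j] /= ij.
  rewrite !a_E; have -> : lam i < 0 = false.
    by apply/negbTE; rewrite -leNgt; apply: (not_last_ge0 hdom hlast); rewrite -val_eqE /=; have := ltn_ord j; lia.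
  case: ltP => [/neg_p p0|_].
    rewrite mulrC (@qnum_rat_nat _ (v i - v j)) ?(@qnum_rat_nat _ (v i + v j + p)) //.
      by rewrite !natrD p0; ring.
    by rewrite natrB ?(ltnW (v_lt _ _ ij)) // p0; ring.
  rewrite (@qnum_rat_nat _ (v i - v j)) ?(@qnum_rat_nat _ (v i + v j + p)) //.
    by rewrite !natrD; field.
  by rewrite natrB ?(ltnW (v_lt _ _ ij)) //; field.
have wE : weight_norm (complement k lam) = (\sum_(i < n) i * (k - absz (lam (rev_ord i))))%N.
  rewrite (big_morph Posz PoszD (erefl _)); apply: eq_bigr => i _.
  (* The only coordinate that may be negative has coefficient 0 in the norm. *)
  rewrite PoszM /complement; case: (eqVneq (rev_ord i) last) => il.
    have -> : nat_of_ord i = 0%N by have /(congr1 val) /= := il; have := ltn_ord i; lia.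
    by rewrite !mul0r.
  by rewrite -subzn // gez0_abs // (not_last_ge0 hdom hlast).
have den0 : (MD_den k p lam)%:F != 0.
  by rewrite tofrac_eq0 denE; apply/prodf_neq0 => i _; rewrite mulf_neq0 ?qfact_neq0.
apply: (mulIf den0); rewrite /MD_product wE -exprnP -mulrA divfK // -tofracXn -!tofracM.
by rewrite numE denE MD_qfact.
Qed.

End RationalForm.

Theorem theorem4p14 (C : numClosedFieldType) (n k p : nat)
    (hn : (1 < n)%N) (hk : (0 < k)%N) (hp : p = 0%N \/ p = 1%N)
    (lam : 'I_n -> int) (hdom : dominant_D lam)
    (hlam : forall i : 'I_n, nat_of_ord i = 0%N -> lam i <= k%:Z)
    (last : 'I_n) (hlast : last.+1 = n)
    (S1 S2 : so_rep C n)
    (hS1 : irrep_of_weight (@Lambda_pred_n n) S1)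
    (hS2 : irrep_of_weight (@Lambda_n n) S2) :
  let W := rep_pow (rep_sum S1 S2) (2 * k + p) in
  [/\ exists m : nat,
        [/\ m%:Z = (MD k p lam).[1],
            p = 0%N \/ lam last <= 0 -> forall V : so_rep C n,
              irrep_of_weight (shifted_weight lam p (@Lambda_pred_n n)) V ->
              multiplicity V W m
          & p = 0%N \/ 0 <= lam last -> forall V : so_rep C n,
              irrep_of_weight (shifted_weight lam p (@Lambda_n n)) V ->
              multiplicity V W m],
      p = 0%N \/ 0 <= lam last ->
        (MD k p lam)%:F = MD_product k p lam
    & forall i : nat, 0 <= (MD k p lam)`_i].
Proof.
have h0n : (0 < n)%N by lia.
(* Dominance bounds [|lam i|] by the first coordinate, which is nonnegative because [1 < n] keeps it
   from being the last. *)
have hk' i : (absz (lam i) <= k)%N.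
  rewrite -lez_nat abszE; apply: le_trans (hlam (Ordinal h0n) (erefl _)).
  case: (posnP i) => [i0|ip]; last exact: dominant_abs.
  have -> : Ordinal h0n = i by apply: val_inj.
  rewrite ger0_norm //; apply: (not_last_ge0 hdom hlast).
  by apply: contraTneq hn => il; rewrite -hlast -il i0.
have W_iso : rep_iso (rep_pow (rep_sum S1 S2) (2 * k + p)) (rep_pow (spin_rep C n) (2 * k + p)).
  exact: pow_iso (spin_sum_iso hlast hS1 hS2).
split; last by move=> i; exact: (MD_pos C hp hdom hk').
  (* The sign flag varies with the weight, but every such multiplicity equals the value of [MD] at
     1, so one [m] serves all cases. *)
  have [m [mE _]] := spin_pow_multiplicity C hp hdom hk' false.
  exists m; split=> // hl V hV.
    (* For [p = 1] the last coordinate is [lam last - 1/2] with [lam last <= 0], that is, minus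
       [|lam last| + 1/2], also when [lam last] is 0. *)
    have [m' [m'E mV]] := spin_pow_multiplicity C hp hdom hk' ((p == 1%N) || (lam last < 0)).
    have -> : m = m' by apply/eqP; rewrite -eqz_nat mE m'E.
    apply: mult_iso W_iso _; apply: mV; apply: irrep_of_weight_ext hV => i.
    rewrite /shifted_weight /signed_weight /Lambda_pred_n /=.
    case: (eqVneq i.+1 n) => iE; last first.
      have il : i != last by apply: contra_neq iE => ->.
      by rewrite andbF -{1}(gez0_abs (not_last_ge0 hdom hlast il)) -pmulrn; field.
    have -> : i = last by apply: val_inj; apply: succn_inj; rewrite iE hlast.
    rewrite andbT; case: hp hl => -> /=.
      move=> _; case: ltP => ll; last by rewrite -{1}(gez0_abs ll) -pmulrn; field.
      have E : lam last = - (absz (lam last))%:Z by rewrite ltz0_abs // opprK.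
      by rewrite {1}E rmorphN /= -pmulrn; field.
    case=> // ll.
    have E : lam last = - (absz (lam last))%:Z by rewrite lez0_abs // opprK.
    by rewrite {1}E rmorphN /= -pmulrn; field.
  have [m' [m'E mV]] := spin_pow_multiplicity C hp hdom hk' (lam last < 0).
  have -> : m = m' by apply/eqP; rewrite -eqz_nat mE m'E.
  apply: mult_iso W_iso _; apply: mV; apply: irrep_of_weight_ext hV => i.
  rewrite /shifted_weight /signed_weight /Lambda_n /=.
  case: ltP => ll /=; last first.
    have : 0 <= lam i.
      by case: (eqVneq i last) => [->//|]; exact: not_last_ge0.
    by move=> li; rewrite -{1}(gez0_abs li) -pmulrn; field.
  have -> : p = 0%N by case: hl => // hl; move: ll; rewrite ltNge hl.
  case: (eqVneq i.+1 n) => iE; last first.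
    have il : i != last by apply: contra_neq iE => ->.
    by rewrite -{1}(gez0_abs (not_last_ge0 hdom hlast il)) -pmulrn; field.
  have -> : i = last by apply: val_inj; apply: succn_inj; rewrite iE hlast.
  have E : lam last = - (absz (lam last))%:Z by rewrite ltz0_abs // opprK.
  by rewrite {1}E rmorphN /= -pmulrn; field.
exact: MD_formula.
Qed.
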